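(* Let $s\ge 0$ and $1/4<a<1/2<b$. Then there exists $c>0$, depending only on $a,b,s$ (the period $L>0$ being fixed), such that (i) $\|uv\|_{X^S_{s,-a}}\le c\,\|u\|_{X^S_{s,b}}\|v\|_{X^B_{s,b}}$ for all $u\in X^S_{s,b}$ and $v\in X^B_{s,b}$; (ii) $\|u_1\bar u_2\|_{X^B_{s,-a}}\le c\,\|u_1\|_{X^S_{s,b}}\|u_2\|_{X^S_{s,b}}$ for all $u_1,u_2\in X^S_{s,b}$.
   Context: Fix a period $L>0$; all functions are $L$-periodic in $x$. Write $\langle a\rangle=1+|a|$ and $\gamma_L(n)=(2\pi/L)^2\sqrt{n^2+n^4}$ for $n\in\mathbb{Z}$. Let $\widetilde F(\tau,n)$ be the time-space Fourier transform: Fourier coefficients $\frac1L\int_0^L e^{-2\pi i n x/L}(\cdot)\,dx$ in $x$ ($n\in\mathbb{Z}$) and Fourier transform in $t\in\mathbb{R}$ with dual variable $\tau\in\mathbb{R}$. Let $\mathcal{Y}$ be the space of functions $F:[0,L]\times\mathbb{R}\to\mathbb{C}$ with $F(x,\cdot)$ in the Schwartz class $S(\mathbb{R})$ for each $x\in[0,L]$, and $F(\cdot,t)\in C^\infty([0,L])$ ($L$-periodic) for each $t\in\mathbb{R}$. For $s,b\in\mathbb{R}$, the spaces $X^S_{s,b}$ and $X^B_{s,b}$ are the completions of $\mathcal{Y}$ with respect to the norms $$\|F\|_{X^S_{s,b}}=\big\|\langle\tau+(2\pi n/L)^2\rangle^b\langle n\rangle^s\widetilde F(\tau,n)\big\|_{\ell^2_nL^2_\tau},\qquad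 \|F\|_{X^B_{s,b}}=\big\|\langle|\tau|-\gamma_L(n)\rangle^b\langle n\rangle^s\widetilde F(\tau,n)\big\|_{\ell^2_nL^2_\tau}.$$ *)

(* Defs.v *)
From HB Require Import structures.
From mathcomp Require Import all_boot all_order all_algebra.
From mathcomp Require Import complex.
From mathcomp Require Import all_classical all_reals all_analysis.

Set Implicit Arguments.
Unset Strict Implicit.
Unset Printing Implicit Defensive.

Import Order.TTheory GRing.Theory Num.Theory.
Import numFieldNormedType.Exports.

Local Open Scope classical_set_scope.
Local Open Scope ring_scope.

Section Fourier.
Context {R : realType}.
Local Notation leb := (@lebesgue_measure R).

Definition expi (theta : R) : R[i] := Complex (cos theta) (sin theta).

Definition cintegrable (D : set R) (f : R -> R[i]) : Prop :=
  leb.-integrable D (fun x => (complex.Re (f x))%:E) /\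
  leb.-integrable D (fun x => (complex.Im (f x))%:E).

Definition cintegral (D : set R) (f : R -> R[i]) : R[i] :=
  Complex (\int[leb]_(x in D) complex.Re (f x))%R
          (\int[leb]_(x in D) complex.Im (f x))%R.

Definition fourier_coef (L : R) (f : R -> R[i]) (n : int) : R[i] :=
  real_complex R L^-1 *
  cintegral `[0, L] (fun x => expi (- (2 * pi * n%:~R * x / L)) * f x).

Definition fourier_transform (f : R -> R[i]) (tau : R) : R[i] :=
  cintegral setT (fun t => expi (- (t * tau)) * f t).

(* F x t with x the space variable. With the sign convention exp (- i t tau) a
   free Schroedinger wave exp (i (k x - k^2 t)) lives on tau = - k^2, as weightS
   requires; the missing 1 / (2 pi) only rescales all the norms. *)
Definition st_fourier (L : R) (F : R -> R -> R[i]) (tau : R) (n : int) : R[i] :=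
  fourier_transform (fun t => fourier_coef L (F ^~ t) n) tau.

Definition smooth (f : R -> R) : Prop :=
  forall (k : nat) (x : R), derivable (derive1n k f) x 1.

Definition schwartz (f : R -> R) : Prop :=
  smooth f /\
  forall m k : nat, exists M : R, forall x : R, `|x ^+ m * derive1n k f x| <= M.

Definition csmooth (f : R -> R[i]) : Prop :=
  smooth (fun x => complex.Re (f x)) /\ smooth (fun x => complex.Im (f x)).

Definition cschwartz (f : R -> R[i]) : Prop :=
  schwartz (fun x => complex.Re (f x)) /\ schwartz (fun x => complex.Im (f x)).

(* Functions on [0, L] are given by their L-periodic extension to the line.
   The last clause is what makes st_fourier meaningful: smoothness and decay in
   each variable separately do not make the integral over t converge. *)
Definition Yspace (L : R) : set (R -> R -> R[i]) :=
  [set F | [/\ forall t, periodic (F ^~ t) L,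
               forall x, cschwartz (F x),
               forall t, csmooth (F ^~ t) &
               forall n, cintegrable setT (fun t => fourier_coef L (F ^~ t) n)]].

Definition japanese (x : R) : R := 1 + `|x|.

Definition gammaL (L : R) (n : int) : R :=
  (2 * pi / L) ^+ 2 * Num.sqrt (n%:~R ^+ 2 + n%:~R ^+ 4).

Definition weightS (L s b : R) (tau : R) (n : int) : R :=
  japanese (tau + (2 * pi * n%:~R / L) ^+ 2) `^ b * japanese n%:~R `^ s.

Definition weightB (L s b : R) (tau : R) (n : int) : R :=
  japanese (`|tau| - gammaL L n) `^ b * japanese n%:~R `^ s.

Definition wnorm (L : R) (w : R -> int -> R) (F : R -> R -> R[i]) : \bar R :=
  ((\esum_(n in [set: int])
      \int[leb]_tau ((w tau n * Normc.normc (st_fourier L F tau n)) ^+ 2)%:E)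
   `^ 2^-1)%E.

Definition cauchy_seq (L : R) (w : R -> int -> R) (F : nat -> R -> R -> R[i]) :
    Prop :=
  (forall k, Yspace L (F k) /\ (wnorm L w (F k) < +oo)%E) /\
  forall e : R, 0 < e -> exists K : nat, forall j k : nat,
    (K <= j)%N -> (K <= k)%N ->
    (wnorm L w (fun x t => F j x t - F k x t)%R < e%:E)%E.

Definition cauchy_class (L : R) (w : R -> int -> R) (F : nat -> R -> R -> R[i]) :
    set (nat -> R -> R -> R[i]) :=
  [set G | cauchy_seq L w G /\
           wnorm L w (fun x t => F k x t - G k x t)%R @[k --> \oo] --> 0%E].

(* Cantor completion: an element is a class of equivalent Cauchy sequences. *)
Record completion (L : R) (w : R -> int -> R) := Completion {
  reps : set (nat -> R -> R -> R[i]);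
  repsP : exists2 F, cauchy_seq L w F & reps = cauchy_class L w F }.

Definition representative (L : R) (w : R -> int -> R) (u : completion L w) :
    nat -> R -> R -> R[i] :=
  sval (cid2 (repsP u)).

Definition cnorm (L : R) (w : R -> int -> R) (u : completion L w) : \bar R :=
  limn (fun k => wnorm L w (representative u k)).

Definition XS (L s b : R) := completion L (weightS L s b).
Definition XB (L s b : R) := completion L (weightB L s b).

(* The operation op, defined on functions, extended by density: z = op u v. *)
Definition extends_to (op : R[i] -> R[i] -> R[i]) (L : R)
    (w1 w2 w3 : R -> int -> R) (u : completion L w1) (v : completion L w2)
    (z : completion L w3) : Prop :=
  forall F G, reps u F -> reps v G -> reps z (fun k x t => op (F k x t) (G k x t)).

End Fourier.

(* Main.v *)
Require Import Defs.
From HB Require Import structures.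
From mathcomp Require Import all_boot all_order all_algebra.
From mathcomp Require Import complex ring lra.
From mathcomp Require Import all_classical all_reals all_analysis.
From mathcomp Require Import measurable_realfun.

(** Write <x> for 1 + |x|, and let F^ be the space-time transform of F.
    The core is an estimate for functions (product_bound): if F and G lie in
    Yspace and have finite norms in X^S_{s,b} and X^B_{s,b}, then F G lies in
    Yspace, and its norm for any weight bounded by <n>^s, in particular for the
    weights of exponent - a, is at most a constant times the product of the
    two norms. This gives (i). For (ii) take G to be the conjugate of u2:
    conjugation reflects the transform in both variables, and the Boussinesq
    weight, which is even in both, is dominated by a multiple of the
    Schroedinger weight (conj_bound). A bounded biadditive operation then extends to the
    completions (bilinear_extension).

    For the estimate itself, the transform of F G is dominated by the
    convolution of |F^| and |G^| (product_spectrum). As <n> <= <m> <n - m>, the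
    spatial weights are distributed over the factors, and it remains to bound
    in L^2 a convolution of k1 f and k2 g, where f and g are the weighted
    transforms and k1, k2 are the modulation brackets to the power - b. When
    the output frequency n is not 0, Cauchy-Schwarz reduces this to a bound,
    uniform in n and tau, for the sum over m of
      \int <sigma + c m^2>^(-2b) <|tau - sigma| - gamma(n - m)>^(-2b) dsigma
    with c = (2 pi / L)^2 (resonance_bound). Now gamma(k) differs from c k^2 by
    a bounded amount, so the second bracket compares with one of
    <tau - sigma + c (n - m)^2>, <tau - sigma - c (n - m)^2>. Since 2b > 1, the
    integral is at most a constant times
    <tau + c m^2 + c (n - m)^2>^(-2b) or <tau + c m^2 - c (n - m)^2>^(-2b).
    As functions of m the arguments are a quadratic polynomial with leading
    coefficient 2c, and an affine function with slope 2 c n; both series are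
    bounded uniformly. When n = 0 the affine function is constant and the
    series diverges; there Cauchy-Schwarz is applied with the L^2 masses of the
    pieces f(m, .) as weights, which are summable (bilinear_zconv).

    The domination by a convolution is where analysis enters. The n-th Fourier
    coefficient of F G is the limit of the Cesaro means of the sums of
    F_m G_{n-m}, by Fejer's theorem in space (fourier_coefM). In time, b > 1/2
    makes each F_m^ integrable, so Fourier inversion (fourier_inversion)
    expresses the transform of F_m G_{n-m} as a convolution, and Plancherel's
    inequality (plancherel_le) makes the sum of |F_m| |G_{n-m}| integrable,
    which justifies the passage to the limit. *)

Set Implicit Arguments.
Unset Strict Implicit.
Unset Printing Implicit Defensive.

Import Order.TTheory GRing.Theory Num.Theory.
Import numFieldNormedType.Exports.

Local Open Scope classical_set_scope.
Local Open Scope ring_scope.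

(** * Complex-valued functions: modulus, measurability, integrals *)

Section ComplexModulus.
Context {R : realType}.
Implicit Types z w : R[i].

Definition cmod z : R := Normc.normc z.

Lemma cmodE z : cmod z = Num.sqrt (complex.Re z ^+ 2 + complex.Im z ^+ 2).
Proof. by case: z. Qed.

Lemma cmod_ge0 z : 0 <= cmod z.
Proof. by rewrite cmodE sqrtr_ge0. Qed.

Lemma cmodM z w : cmod (z * w) = cmod z * cmod w.
Proof. exact: Normc.normcM. Qed.

Lemma cmodD z w : cmod (z + w) <= cmod z + cmod w.
Proof. exact: le_normcD. Qed.

Lemma cmodN z : cmod (- z) = cmod z.
Proof. exact: normcN. Qed.

Lemma cmodB z w : cmod (z - w) <= cmod z + cmod w.
Proof. by rewrite (le_trans (cmodD _ _))// cmodN. Qed.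

Lemma cmodBC z w : cmod (z - w) = cmod (w - z).
Proof. by rewrite -cmodN opprB. Qed.

Lemma cmod0 : cmod 0 = 0.
Proof. exact: Normc.normc0. Qed.

Lemma cmod1 : cmod 1 = 1.
Proof. exact: Normc.normc1. Qed.

Lemma cmod_sqr z : cmod z ^+ 2 = complex.Re z ^+ 2 + complex.Im z ^+ 2.
Proof. by rewrite cmodE sqr_sqrtr// addr_ge0// sqr_ge0. Qed.

Lemma cmodJ z : cmod (conjc z) = cmod z.
Proof. by case: z => x y; rewrite !cmodE /= sqrrN. Qed.

Lemma cmod_real (x : R) : cmod (real_complex R x) = `|x|.
Proof. by rewrite cmodE /= expr0n addr0 sqrtr_sqr. Qed.

Lemma Re_le_cmod z : `|complex.Re z| <= cmod z.
Proof.
by rewrite cmodE -sqrtr_sqr ler_wsqrtr// lerDl sqr_ge0.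
Qed.

Lemma Im_le_cmod z : `|complex.Im z| <= cmod z.
Proof.
by rewrite cmodE -sqrtr_sqr ler_wsqrtr// lerDr sqr_ge0.
Qed.

Lemma cmod_le z : cmod z <= `|complex.Re z| + `|complex.Im z|.
Proof.
have h : 0 <= `|complex.Re z| + `|complex.Im z| by rewrite addr_ge0.
rewrite cmodE -[leRHS](ger0_norm h) -sqrtr_sqr ler_wsqrtr//.
rewrite sqrrD !real_normK ?num_real// lerD2r lerDl.
by rewrite mulrn_wge0// mulr_ge0.
Qed.

Lemma cplxP z w : complex.Re z = complex.Re w -> complex.Im z = complex.Im w -> z = w.
Proof. by case: z => x y; case: w => x' y' /= -> ->. Qed.

Lemma ReM z w : complex.Re (z * w) =
  complex.Re z * complex.Re w - complex.Im z * complex.Im w.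
Proof. by case: z => x y; case: w. Qed.

Lemma ImM z w : complex.Im (z * w) =
  complex.Re z * complex.Im w + complex.Im z * complex.Re w.
Proof. by case: z => x y; case: w. Qed.

Lemma Re_realM (x : R) z : complex.Re (real_complex R x * z) = x * complex.Re z.
Proof. by case: z => u v /=; rewrite mul0r subr0. Qed.

Lemma ReD z w : complex.Re (z + w) = complex.Re z + complex.Re w.
Proof. by case: z => x y; case: w. Qed.

Lemma ImD z w : complex.Im (z + w) = complex.Im z + complex.Im w.
Proof. by case: z => x y; case: w. Qed.

Lemma ReN z : complex.Re (- z) = - complex.Re z.
Proof. by case: z. Qed.

Lemma ImN z : complex.Im (- z) = - complex.Im z.
Proof. by case: z. Qed.

Lemma cmod_sum I (r : seq I) (P : pred I) (F : I -> R[i]) :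
  cmod (\sum_(i <- r | P i) F i) <= \sum_(i <- r | P i) cmod (F i).
Proof.
apply: (big_ind2 (fun z x => cmod z <= x)) => //; first by rewrite cmod0.
by move=> z x w y hz hw; rewrite (le_trans (cmodD _ _))// lerD.
Qed.

Lemma expiD (x y : R) : expi (x + y) = expi x * expi y.
Proof.
apply: cplxP; rewrite ?ReM ?ImM /= ?cosD ?sinD//; ring.
Qed.

Lemma expi0 : expi (0 : R) = 1.
Proof. by rewrite /expi cos0 sin0. Qed.

Lemma cmod_expi (x : R) : cmod (expi x) = 1.
Proof. by rewrite cmodE /= cos2Dsin2 sqrtr1. Qed.

Lemma conjc_expi (x : R) : conjc (expi x) = expi (- x).
Proof. by rewrite /expi /= cosN sinN. Qed.

Lemma conjcM z w : conjc (z * w) = conjc z * conjc w.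
Proof. exact: rmorphM. Qed.

Lemma conjcD z w : conjc (z + w) = conjc z + conjc w.
Proof. exact: rmorphD. Qed.

Lemma conjcB z w : conjc (z - w) = conjc z - conjc w.
Proof. exact: rmorphB. Qed.

End ComplexModulus.

Arguments cmod {R} z : simpl never.

Section ComplexIntegral.
Context {R : realType}.

Definition cmeasurable d (T : measurableType d) (D : set T) (f : T -> R[i]) : Prop :=
  measurable_fun D (fun x => complex.Re (f x)) /\
  measurable_fun D (fun x => complex.Im (f x)).

Section meas.
Context d (T : measurableType d).
Implicit Types (D : set T) (f g : T -> R[i]).

Lemma cmeasurableM D f g :
  cmeasurable D f -> cmeasurable D g -> cmeasurable D (fun x => f x * g x).
Proof.
move=> [f1 f2] [g1 g2]; split.
  by under eq_fun do rewrite ReM; apply: measurable_funB; exact: measurable_funM.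
by under eq_fun do rewrite ImM; apply: measurable_funD; exact: measurable_funM.
Qed.

Lemma cmeasurable_cst D (c : R[i]) : cmeasurable D (cst c).
Proof. by split; exact: measurable_cst. Qed.

Lemma cmeasurable_cmod D f : cmeasurable D f -> measurable_fun D (fun x => cmod (f x)).
Proof.
move=> [f1 f2]; under eq_fun do rewrite cmodE.
apply: (@measurableT_comp _ _ _ _ _ _ (@Num.sqrt R)).
  apply: continuous_measurable_fun; exact: sqrt_continuous.
by apply: measurable_funD; exact: measurable_funX.
Qed.

End meas.

Local Notation leb := (@lebesgue_measure R).
Implicit Types (D : set R) (f g : R -> R[i]).

Lemma cintegrable_cmeasurable D f : cintegrable D f -> cmeasurable D f.
Proof.
by move=> [/integrableP[/measurable_EFinP f1 _] /integrableP[/measurable_EFinP f2 _]].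
Qed.

Lemma cintegrableP D f : measurable D ->
  cintegrable D f <->
  cmeasurable D f /\ (\int[leb]_(x in D) (cmod (f x))%:E < +oo)%E.
Proof.
move=> mD; split => [fi|[mf fi]].
  have mf := cintegrable_cmeasurable fi; split => //.
  have : leb.-integrable D (fun x => (`|complex.Re (f x)| + `|complex.Im (f x)|)%:E).
    under eq_fun do rewrite EFinD.
    by case: fi => f1 f2; apply: integrableD => //; exact: integrable_norm.
  move=> /integrableP[_]; apply: le_lt_trans.
  apply: ge0_le_integral => //.
    by move=> x _; rewrite lee_fin cmod_ge0.
  - exact/measurable_EFinP/cmeasurable_cmod.
  - by apply/measurable_EFinP; apply: measurableT_comp => //; apply: measurable_funD; apply: measurableT_comp => //; case: mf.
  - by move=> x _ /=; rewrite lee_fin (le_trans (cmod_le _))// ler_norm.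
case: (mf) => f1 f2.
split; apply/integrableP; split; try exact/measurable_EFinP.
  apply: le_lt_trans fi; apply: ge0_le_integral => //.
  - by apply/measurable_EFinP; apply: measurableT_comp.
  - exact/measurable_EFinP/cmeasurable_cmod.
  - by move=> x _; rewrite /= lee_fin Re_le_cmod.
apply: le_lt_trans fi; apply: ge0_le_integral => //.
- by apply/measurable_EFinP; apply: measurableT_comp.
- exact/measurable_EFinP/cmeasurable_cmod.
- by move=> x _; rewrite /= lee_fin Im_le_cmod.
Qed.

Lemma cintegrable_cmod D f : measurable D -> cintegrable D f ->
  leb.-integrable D (fun x => (cmod (f x))%:E).
Proof.
move=> mD /(cintegrableP _ mD)[mf fi]; apply/integrableP; split.
  exact/measurable_EFinP/cmeasurable_cmod.
by under eq_integral do rewrite abse_EFin ger0_norm ?cmod_ge0//.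
Qed.

Lemma cintegrable_dom D f (h : R -> R) : measurable D -> cmeasurable D f ->
  leb.-integrable D (EFin \o h) -> (forall x, D x -> cmod (f x) <= h x) ->
  cintegrable D f.
Proof.
move=> mD mf hi fh; apply/cintegrableP => //; split => //.
case/integrableP: hi => mh; apply: le_lt_trans; apply: ge0_le_integral => //.
  by move=> x _; rewrite lee_fin cmod_ge0.
- exact/measurable_EFinP/cmeasurable_cmod.
- exact: measurableT_comp.
- by move=> x Dx /=; rewrite lee_fin (le_trans (fh _ Dx))// ler_norm.
Qed.

Lemma cintegrableD D f g : measurable D -> cintegrable D f -> cintegrable D g ->
  cintegrable D (fun x => f x + g x).
Proof.
move=> mD [f1 f2] [g1 g2]; split.
  by under eq_fun do rewrite ReD EFinD; exact: integrableD.
by under eq_fun do rewrite ImD EFinD; exact: integrableD.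
Qed.

Lemma cintegrableMb D f g (M : R) : measurable D -> cmeasurable D g ->
  (forall x, D x -> cmod (g x) <= M) -> cintegrable D f ->
  cintegrable D (fun x => g x * f x).
Proof.
move=> mD mg gM fi; apply: (@cintegrable_dom _ _ (fun x => M * cmod (f x))) => //.
- by apply: cmeasurableM => //; exact: cintegrable_cmeasurable.
- rewrite (_ : _ \o _ = (fun x => M%:E * (cmod (f x))%:E)%E); last first.
    by apply/funext => x /=; rewrite EFinM.
  by apply: integrableZl => //; exact: cintegrable_cmod.
- by move=> x Dx; rewrite cmodM ler_wpM2r ?cmod_ge0// gM.
Qed.

Lemma cintegrableZ D (c : R[i]) f : measurable D -> cintegrable D f ->
  cintegrable D (fun x => c * f x).
Proof.
by move=> mD; apply: (@cintegrableMb _ _ (cst c) (cmod c)) => //; exact: cmeasurable_cst.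
Qed.

Lemma cintegrableN D f : measurable D -> cintegrable D f ->
  cintegrable D (fun x => - f x).
Proof.
move=> mD fi; have := cintegrableZ (-1) mD fi.
by under eq_fun do rewrite mulN1r.
Qed.

Lemma cintegrableJ D f : cintegrable D f -> cintegrable D (fun x => conjc (f x)).
Proof.
move=> [f1 f2]; split.
  by rewrite (_ : (fun x => _) = (fun x => (complex.Re (f x))%:E))//; apply/funext => x; case: (f x).
rewrite (_ : (fun x => _) = (fun x => - (complex.Im (f x))%:E)%E); last by apply/funext => x; case: (f x).
exact: integrableN.
Qed.

Lemma cintegrable0 D : measurable D -> cintegrable D (fun=> 0).
Proof. by move=> mD; split; exact: integrable0. Qed.

Lemma cintegrable_sum D I (r : seq I) (f : I -> R -> R[i]) : measurable D ->
  (forall i, cintegrable D (f i)) -> cintegrable D (fun x => \sum_(i <- r) f i x).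
Proof.
move=> mD fi; elim: r => [|i r IH].
  by under eq_fun do rewrite big_nil; exact: cintegrable0.
by under eq_fun do rewrite big_cons; exact: cintegrableD.
Qed.

Lemma eq_cintegral D f g : (forall x, D x -> f x = g x) ->
  cintegral D f = cintegral D g.
Proof.
move=> fg; rewrite /cintegral; congr Complex;
  by apply: eq_Rintegral => x; rewrite inE => /fg ->.
Qed.

Lemma cintegralD D f g : measurable D -> cintegrable D f -> cintegrable D g ->
  cintegral D (fun x => f x + g x) = cintegral D f + cintegral D g.
Proof.
move=> mD [f1 f2] [g1 g2]; apply: cplxP; rewrite ?ReD ?ImD /=.
  by under eq_Rintegral do rewrite ReD; rewrite RintegralD.
by under eq_Rintegral do rewrite ImD; rewrite RintegralD.
Qed.

Lemma cintegralZ D (c : R[i]) f : measurable D -> cintegrable D f ->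
  cintegral D (fun x => c * f x) = c * cintegral D f.
Proof.
move=> mD [f1 f2]; have h (k : R) (g : R -> R) : leb.-integrable D (EFin \o g) ->
  leb.-integrable D (EFin \o (fun x => k * g x)).
  move=> ig; rewrite (_ : _ \o _ = (fun x => k%:E * (g x)%:E)%E); first exact: integrableZl.
  by apply/funext => x /=; rewrite EFinM.
apply: cplxP; rewrite ?ReM ?ImM /=.
  under eq_Rintegral do rewrite ReM.
  by rewrite RintegralB ?RintegralZl//; exact: h.
under eq_Rintegral do rewrite ImM.
by rewrite RintegralD ?RintegralZl//; exact: h.
Qed.

Lemma cintegralN D f : measurable D -> cintegrable D f ->
  cintegral D (fun x => - f x) = - cintegral D f.
Proof.
move=> mD fi; rewrite -mulN1r -cintegralZ//; apply: eq_cintegral => x _.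
by rewrite mulN1r.
Qed.

Lemma cintegralB D f g : measurable D -> cintegrable D f -> cintegrable D g ->
  cintegral D (fun x => f x - g x) = cintegral D f - cintegral D g.
Proof.
by move=> mD fi gi; rewrite cintegralD ?cintegralN//; exact: cintegrableN.
Qed.

Lemma cintegral_sum D I (r : seq I) (f : I -> R -> R[i]) : measurable D ->
  (forall i, cintegrable D (f i)) ->
  cintegral D (fun x => \sum_(i <- r) f i x) = \sum_(i <- r) cintegral D (f i).
Proof.
move=> mD fi; elim: r => [|i r IH].
  rewrite big_nil (eq_cintegral (g := fun=> 0 * 0)); last by move=> x _; rewrite big_nil mulr0.
  rewrite cintegralZ// ?mul0r//.
  exact: cintegrable0.
rewrite big_cons -IH -cintegralD//; last exact: cintegrable_sum.
by apply: eq_cintegral => x _; rewrite big_cons.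
Qed.

Lemma cintegralJ D f : measurable D -> cintegrable D f ->
  cintegral D (fun x => conjc (f x)) = conjc (cintegral D f).
Proof.
move=> mD [f1 f2]; apply: cplxP => /=.
  by apply: eq_Rintegral => x _; case: (f x).
rewrite -mulN1r -RintegralZl//; apply: eq_Rintegral => x _; rewrite mulN1r.
by case: (f x).
Qed.

(** The modulus of an integral is read off after a rotation that makes the
    integral a nonnegative real. *)
Lemma cmod_cintegral D f : measurable D -> cintegrable D f ->
  cmod (cintegral D f) <= \int[leb]_(x in D) cmod (f x).
Proof.
move=> mD fi; set z := cintegral D f.
have [z0|z0] := eqVneq (cmod z) 0.
  by rewrite z0; apply: Rintegral_ge0 => x _; exact: cmod_ge0.
pose c := conjc z / real_complex R (cmod z).
have c1 : cmod c = 1.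
  rewrite /c cmodM cmodJ -[cmod (_^-1)]/(Normc.normc _) Normc.normcV.
  by rewrite -/(cmod _) cmod_real ger0_norm ?cmod_ge0// mulfV.
have cz : complex.Re (c * z) = cmod z.
  have -> : c * z = real_complex R (cmod z).
    rewrite /c mulrAC; have -> : conjc z * z = real_complex R (cmod z ^+ 2).
      rewrite cmod_sqr; case: (z) => x y; apply: cplxP => /=; ring.
    have -> : real_complex R (cmod z ^+ 2) = real_complex R (cmod z) * real_complex R (cmod z).
      by apply: cplxP => /=; ring.
    rewrite mulfK//; apply/eqP => /(congr1 (@complex.Re R)) /= /eqP.
    by rewrite (negbTE z0).
  by [].
rewrite -cz /z -cintegralZ//= .
have [h1 _] := cintegrableZ c mD fi.
apply: (@le_Rintegral _ _ _ leb D _ _ mD h1).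
  exact: cintegrable_cmod.
move=> x _ /=; rewrite (le_trans (ler_norm _))// (le_trans (Re_le_cmod _))//.
by rewrite cmodM c1 mul1r.
Qed.

Lemma EFin_cmod_cintegral D f : measurable D -> cintegrable D f ->
  ((cmod (cintegral D f))%:E <= \int[leb]_(x in D) (cmod (f x))%:E)%E.
Proof.
move=> mD fi; rewrite -[leRHS]fineK; last first.
  by apply: integrable_fin_num => //; exact: cintegrable_cmod.
by rewrite lee_fin cmod_cintegral.
Qed.

Lemma ae_imply (P Q : R -> Prop) : {ae leb, forall x, P x} ->
  (forall x, P x -> Q x) -> {ae leb, forall x, Q x}.
Proof.
by case=> N [mN N0 sN] PQ; exists N; split => // x /= h; apply: sN => /= /PQ.
Qed.

Lemma ae_eq_cintegral D f g : measurable D -> cmeasurable D f -> cmeasurable D g ->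
  {ae leb, forall x, D x -> f x = g x} -> cintegral D f = cintegral D g.
Proof.
move=> mD [f1 f2] [g1 g2] fg; apply: cplxP => /=; rewrite /Rintegral; congr fine.
  apply: ae_eq_integral => //; try exact/measurable_EFinP.
  by case: fg => N [mN N0 sN]; exists N; split => // x /= h; apply: sN => /= h'; apply: h => Dx; rewrite h'.
apply: ae_eq_integral => //; try exact/measurable_EFinP.
by case: fg => N [mN N0 sN]; exists N; split => // x /= h; apply: sN => /= h'; apply: h => Dx; rewrite h'.
Qed.

(** Phrased with the modulus, so that all limits are limits of real sequences. *)
Definition ccvg (z : nat -> R[i]) (l : R[i]) : Prop :=
  cmod (z n - l) @[n --> \oo] --> 0.

Lemma ccvg_ReIm (z : nat -> R[i]) l : ccvg z l ->
  complex.Re (z n) @[n --> \oo] --> complex.Re l /\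
  complex.Im (z n) @[n --> \oo] --> complex.Im l.
Proof.
move=> zl; split; apply/subr_cvg0/norm_cvg0P.
  apply: (@squeeze_cvgr _ _ _ _ (cst 0) (fun n => cmod (z n - l))) => //; last exact: cvg_cst.
  by near=> n; rewrite /= normr_ge0/= -ReN -ReD Re_le_cmod.
apply: (@squeeze_cvgr _ _ _ _ (cst 0) (fun n => cmod (z n - l))) => //; last exact: cvg_cst.
by near=> n; rewrite /= normr_ge0/= -ImN -ImD Im_le_cmod.
Unshelve. all: by end_near. Qed.

Lemma ReIm_ccvg (z : nat -> R[i]) l :
  complex.Re (z n) @[n --> \oo] --> complex.Re l ->
  complex.Im (z n) @[n --> \oo] --> complex.Im l -> ccvg z l.
Proof.
move=> /subr_cvg0 h1 /subr_cvg0 h2; rewrite /ccvg.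
have h := cvgD (cvg_norm h1) (cvg_norm h2); rewrite normr0 addr0 in h.
apply: (squeeze_cvgr _ (cvg_cst 0) (h _ _ _)).
near=> n; rewrite /= cmod_ge0/=.
by rewrite (le_trans (cmod_le _))// ReD ImD ReN ImN.
Unshelve. all: by end_near. Qed.

Lemma ccvg_unique (z : nat -> R[i]) l l' : ccvg z l -> ccvg z l' -> l = l'.
Proof.
move=> /ccvg_ReIm[a b] /ccvg_ReIm[a' b']; apply: cplxP.
  exact: (cvg_unique _ a a').
exact: (cvg_unique _ b b').
Qed.

Lemma ccvg_real (u : nat -> R) l : u @ \oo --> l ->
  ccvg (fun n => real_complex R (u n)) (real_complex R l).
Proof. by move=> ul; apply: ReIm_ccvg => //=; exact: cvg_cst. Qed.

Lemma ccvgMl (c : R[i]) (u : nat -> R[i]) l : ccvg u l -> ccvg (fun n => c * u n) (c * l).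
Proof.
move=> ul; rewrite /ccvg; under eq_fun do rewrite -mulrBr cmodM.
rewrite -(mulr0 (cmod c)); apply: cvgM => //; exact: cvg_cst.
Qed.

Lemma ccvg_cmod_le (z : nat -> R[i]) l (B : R) :
  ccvg z l -> (forall n, cmod (z n) <= B) -> cmod l <= B.
Proof.
move=> zl zB; apply/ler_addgt0Pr => e e0.
move/cvgrPdist_lt : zl => /(_ e e0) [N _ /(_ N (leqnn N))].
rewrite sub0r normrN ger0_norm ?cmod_ge0// => h.
rewrite -[l](subKr (z N)) (le_trans (cmodB _ _))// lerD// ltW//.
Qed.

Lemma dominated_ccvg D (f_ : nat -> R -> R[i]) f (h : R -> R) : measurable D ->
  (forall n, cmeasurable D (f_ n)) -> cmeasurable D f ->
  {ae leb, forall x, D x -> ccvg (f_ ^~ x) (f x)} ->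
  leb.-integrable D (EFin \o h) ->
  {ae leb, forall x, forall n, D x -> cmod (f_ n x) <= h x} ->
  cintegrable D f /\ ccvg (fun n => cintegral D (f_ n)) (cintegral D f).
Proof.
move=> mD mf_ mf f_f hi f_h.
have [i1 _ c1] := @dominated_convergence _ _ _ leb D mD
  (fun n x => (complex.Re (f_ n x))%:E) (fun x => (complex.Re (f x))%:E) (EFin \o h)
  (fun n => (measurable_EFinP _ _).2 (mf_ n).1) ((measurable_EFinP _ _).2 mf.1)
  ltac:(by apply: (ae_imply f_f) => x hx Dx; apply: cvg_EFin; [exact: nearW|exact: (ccvg_ReIm (hx Dx)).1]) hi
  ltac:(by apply: (ae_imply f_h) => x hx n Dx /=; rewrite lee_fin (le_trans (Re_le_cmod _))// hx).
have [i2 _ c2] := @dominated_convergence _ _ _ leb D mD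
  (fun n x => (complex.Im (f_ n x))%:E) (fun x => (complex.Im (f x))%:E) (EFin \o h)
  (fun n => (measurable_EFinP _ _).2 (mf_ n).2) ((measurable_EFinP _ _).2 mf.2)
  ltac:(by apply: (ae_imply f_f) => x hx Dx; apply: cvg_EFin; [exact: nearW|exact: (ccvg_ReIm (hx Dx)).2]) hi
  ltac:(by apply: (ae_imply f_h) => x hx n Dx /=; rewrite lee_fin (le_trans (Im_le_cmod _))// hx).
split; first by [].
by apply: ReIm_ccvg => /=; apply: fine_cvg; rewrite fineK//; exact: integrable_fin_num.
Qed.

End ComplexIntegral.

(** * Sums over the integers *)

Section IntegerSums.
Context {R : realType}.
Local Open Scope ereal_scope.
Implicit Types (f g : int -> \bar R).

(** The enumeration 0, -1, 1, -2, 2, and so on: its first 2 N + 1 terms are the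
    integers of absolute value at most N, which gives the symmetric partial sums
    of Fourier series. *)
Definition zig (k : nat) : int := if odd k then Negz k./2 else Posz k./2.

Lemma zig_bij : set_bij [set: nat] [set: int] zig.
Proof.
split => //.
- move=> i j _ _; rewrite /zig => h.
  rewrite -(odd_double_half i) -(odd_double_half j); move: h.
  by case: (odd i); case: (odd j) => // -[->].
- move=> [n|n] _ /=.
  by exists n.*2 => //; rewrite /zig odd_double doubleK.
by exists n.*2.+1 => //; rewrite /zig /= odd_double /= uphalf_double.
Qed.

Lemma zsum_series f : (forall n, 0 <= f n) ->
  \esum_(n in [set: int]) f n = \sum_(k <oo) f (zig k).
Proof.
by move=> f0; rewrite (@reindex_esum _ _ _ _ _ zig f zig_bij) nneseries_esumT.
Qed.

Lemma zsum_shift f (m : int) :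
  \esum_(n in [set: int]) f (n - m)%R = \esum_(n in [set: int]) f n.
Proof.
rewrite [RHS](@reindex_esum _ _ _ setT setT (fun n => n - m)%R)//.
split => // [i j _ _ /addIr //|i _].
by exists (i + m)%R => //; rewrite addrK.
Qed.

Lemma zsum_opp f : \esum_(n in [set: int]) f (- n)%R = \esum_(n in [set: int]) f n.
Proof.
by rewrite [RHS](@reindex_esum _ _ _ setT setT -%R).
Qed.

Lemma zsum_sub f (m : int) :
  \esum_(n in [set: int]) f (m - n)%R = \esum_(n in [set: int]) f n.
Proof.
rewrite -zsum_opp -[RHS](zsum_shift _ (- m)%R).
by apply: eq_esum => n _; rewrite !opprK addrC.
Qed.

Lemma zsumD f g : (forall n, 0 <= f n) -> (forall n, 0 <= g n) ->
  \esum_(n in [set: int]) (f n + g n) =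
  (\esum_(n in [set: int]) f n) + \esum_(n in [set: int]) g n.
Proof. by move=> f0 g0; rewrite esumD. Qed.

Lemma zsumZ f (c : R) : (0 <= c)%R -> (forall n, 0 <= f n) ->
  \esum_(n in [set: int]) (c%:E * f n) = c%:E * \esum_(n in [set: int]) f n.
Proof.
move=> c0 f0; rewrite !zsum_series ?nneseriesZl//.
by move=> n; apply: mule_ge0.
Qed.

Lemma zsumZe f (c : \bar R) : 0 <= c -> (forall n, 0 <= f n) ->
  \esum_(n in [set: int]) (c * f n) = c * \esum_(n in [set: int]) f n.
Proof.
move=> c0 f0; have fs0 : 0 <= \esum_(n in [set: int]) f n by apply: esum_ge0.
case: c c0 => [c c0||//]; first exact: zsumZ.
move=> _; have [S0|S0] := eqVneq (\esum_(n in [set: int]) f n) 0.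
  rewrite S0 mule0 esum1// => n _.
  have : f n <= 0.
    rewrite -S0; apply: esum_ge; exists [set n]; last by rewrite fsbig_set1.
    by split => //; exact: finite_set1.
  by move=> h; rewrite (_ : f n = 0) ?mule0//; apply/eqP; rewrite eq_le h f0.
rewrite gt0_mulye ?lt0e ?S0//.
apply/eqP; rewrite eq_le leey/= leNgt; apply/negP => h.
move/negP : S0; apply; apply/eqP; apply: esum1 => n _.
have : +oo * f n < +oo.
  apply: le_lt_trans h; apply: esum_ge; exists [set n]; last by rewrite fsbig_set1.
  by split => //; exact: finite_set1.
have := f0 n; rewrite le_eqVlt => /predU1P[<-//|fn]; rewrite gt0_mulye//.
Qed.

Lemma zsum_ge f (n : int) : (forall n, 0 <= f n) -> f n <= \esum_(n in [set: int]) f n.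
Proof.
move=> f0; apply: esum_ge; exists [set n]; last by rewrite fsbig_set1.
by split => //; exact: finite_set1.
Qed.

Lemma zsum_exchange (a : int -> int -> \bar R) : (forall i j, 0 <= a i j) ->
  \esum_(i in [set: int]) \esum_(j in [set: int]) a i j =
  \esum_(j in [set: int]) \esum_(i in [set: int]) a i j.
Proof.
move=> a0; rewrite !esum_esum//.
rewrite (@reindex_esum _ _ _ (setT `*`` (fun=> setT)) _ (fun k : int * int => (k.2, k.1)))//.
split => // [[i j] [i' j'] _ _ [-> ->]//|[i j] _].
by exists (j, i).
Qed.

Section integrals.
Context d (T : measurableType d) (mu : {measure set T -> \bar R}).

Lemma measurable_zsum (f : int -> T -> \bar R) :
  (forall n, measurable_fun setT (f n)) -> (forall n x, 0 <= f n x) ->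
  measurable_fun setT (fun x => \esum_(n in [set: int]) f n x).
Proof.
move=> mf f0; under eq_fun do rewrite zsum_series//.
by apply: ge0_emeasurable_sum.
Qed.

Lemma integral_zsum (f : int -> T -> \bar R) :
  (forall n, measurable_fun setT (f n)) -> (forall n x, 0 <= f n x) ->
  \int[mu]_x (\esum_(n in [set: int]) f n x) =
  \esum_(n in [set: int]) \int[mu]_x f n x.
Proof.
move=> mf f0; under eq_integral do rewrite zsum_series//.
rewrite zsum_series ?integral_nneseries// => n.
exact: integral_ge0.
Qed.

(** The optimal parameter is l = z / K. *)
Lemma amgm_sqr (z y : \bar R) (K : R) : (0 < K)%R -> 0 <= z -> 0 <= y ->
  (forall l : R, (0 < l)%R -> z + z <= l%:E * K%:E + (l^-1)%:E * y) ->
  z * z <= K%:E * y.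
Proof.
move=> K0 z0 y0 h.
case: y y0 h => [y||//] y0 h; last by rewrite gt0_muley ?lte_fin// leey.
have := h 1%R ltr01; rewrite invr1 !mul1e; case: z z0 h => [z||//] z0 h; last by rewrite leye_eq.
move=> _.
have [->|zneq] := eqVneq z 0%R; first by rewrite mul0e -EFinM lee_fin mulr_ge0 ?(ltW K0).
have {}z0 : (0 < z)%R by rewrite lt_neqAle eq_sym zneq -lee_fin.
have /h : (0 < z / K)%R by rewrite divr_gt0.
rewrite -!EFinM -!EFinD !lee_fin mulfVK ?gt_eqF// lerD2l invf_div.
by rewrite mulrAC ler_pdivlMr.
Qed.

(** Cauchy-Schwarz: sum and integrate 2 f h <= l f^2 + h^2 / l, then optimize
    in l. *)
Lemma zsum_integral_CS (f h : int -> T -> R) (K : R) :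
  (forall n, measurable_fun setT (f n)) -> (forall n, measurable_fun setT (h n)) ->
  (forall n x, (0 <= f n x)%R) -> (forall n x, (0 <= h n x)%R) -> (0 < K)%R ->
  \esum_(n in [set: int]) \int[mu]_x ((f n x) ^+ 2)%:E <= K%:E ->
  (\esum_(n in [set: int]) \int[mu]_x (f n x * h n x)%:E) *
  (\esum_(n in [set: int]) \int[mu]_x (f n x * h n x)%:E) <=
  K%:E * \esum_(n in [set: int]) \int[mu]_x ((h n x) ^+ 2)%:E.
Proof.
move=> mf mh f0 h0 K0 fK.
have mf2 n : measurable_fun setT (fun x => ((f n x) ^+ 2)%:E).
  by apply/measurable_EFinP; apply: measurable_funX.
have mh2 n : measurable_fun setT (fun x => ((h n x) ^+ 2)%:E).
  by apply/measurable_EFinP; apply: measurable_funX.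
have mfh n : measurable_fun setT (fun x => (f n x * h n x)%:E).
  by apply/measurable_EFinP; apply: measurable_funM.
have ifh n : 0 <= \int[mu]_x (f n x * h n x)%:E.
  by apply: integral_ge0 => x _; rewrite lee_fin mulr_ge0.
have if2 n : 0 <= \int[mu]_x ((f n x) ^+ 2)%:E.
  by apply: integral_ge0 => x _; rewrite lee_fin sqr_ge0.
have ih2 n : 0 <= \int[mu]_x ((h n x) ^+ 2)%:E.
  by apply: integral_ge0 => x _; rewrite lee_fin sqr_ge0.
apply: amgm_sqr => //; try exact: esum_ge0.
move=> l l0; have l0' := ltW l0; have li0' : (0 <= l^-1)%R by rewrite invr_ge0.
apply: (@le_trans _ _ (l%:E * (\esum_(n in [set: int]) \int[mu]_x ((f n x) ^+ 2)%:E) +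
   (l^-1)%:E * \esum_(n in [set: int]) \int[mu]_x ((h n x) ^+ 2)%:E)); last first.
  by rewrite leeD2r// lee_wpmul2l// lee_fin.
rewrite -!zsumZ// -!zsumD//; last 2 first.
- by move=> n; apply: mule_ge0.
- by move=> n; apply: mule_ge0.
apply: le_esum => n _.
rewrite -!ge0_integralZl_EFin//; last 2 first.
- by move=> x _; rewrite lee_fin sqr_ge0.
- by move=> x _; rewrite lee_fin sqr_ge0.
have z1 x : (0 <= f n x * h n x)%R by rewrite mulr_ge0.
rewrite -!ge0_integralD//=; last 6 first.
- by move=> x _; rewrite -EFinM lee_fin mulr_ge0// sqr_ge0.
- exact: measurable_funeM.
- by move=> x _; rewrite -EFinM lee_fin mulr_ge0// sqr_ge0.
- exact: measurable_funeM.
- by move=> x _; rewrite lee_fin.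
- by move=> x _; rewrite lee_fin.
apply: ge0_le_integral => //.
- by move=> x _; rewrite -EFinD lee_fin addr_ge0.
- exact: emeasurable_funD.
- by apply: emeasurable_funD; exact: measurable_funeM.
move=> x _; rewrite -!EFinM -!EFinD lee_fin.
have := sqr_ge0 (l * f n x - h n x); rewrite -(pmulr_rge0 _ (_ : 0 < l^-1)%R) ?invr_gt0//.
rewrite -subr_ge0; congr (0 <= _)%R; field; exact: lt0r_neq0.
Qed.

End integrals.

Local Notation leb := (@lebesgue_measure R).

(** Lebesgue measure is determined by its values on half-open intervals, whose
    lengths are preserved by translation. *)
Lemma ge0_integral_translate (f : R -> \bar R) (c : R) :
  measurable_fun setT f -> (forall x, 0 <= f x) ->
  \int[leb]_x f (x - c)%R = \int[leb]_x f x.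
Proof.
move=> mf f0; pose phi := (fun x : measurableTypeR R => (x - c)%R : measurableTypeR R).
have mphi : measurable_fun setT phi by apply: measurable_funB.
rewrite [RHS](@eq_measure_integral _ _ R setT (pushforward leb phi) leb).
  by rewrite ge0_integral_pushforward.
move=> A mA _; apply: lebesgue_measure_unique => //= _ [[a b]] _ <-.
rewrite /pushforward.
have -> : phi @^-1` `]a, b]%classic = `](a + c)%R, (b + c)%R]%classic.
  by apply/seteqP; split => x /=; rewrite !in_itv/= /phi ltrBrDr lerBlDr.
rewrite !lebesgue_measure_itv/= !lte_fin ltrD2r.
by case: ifP => // _; rewrite -!EFinB; congr EFin; ring.
Qed.

Lemma ge0_integral_reflect (f : R -> \bar R) :
  measurable_fun setT f -> (forall x, 0 <= f x) ->
  \int[leb]_x f (- x)%R = \int[leb]_x f x.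
Proof.
move=> mf f0; pose phi := (fun x : measurableTypeR R => (- x)%R : measurableTypeR R).
have mphi : measurable_fun setT phi by exact: measurableT_comp.
rewrite [RHS](@eq_measure_integral _ _ R setT (pushforward leb phi) leb).
  by rewrite ge0_integral_pushforward.
by move=> A mA _; exact/esym/lebesgue_measureN.
Qed.

End IntegerSums.

(** * Fubini for bounded kernels *)

Section ComplexFubini.
Context {R : realType}.
Local Notation leb := (@lebesgue_measure R).

Lemma measurable_integral_snd (f : R * R -> \bar R) :
  measurable_fun setT f -> (forall z, (0 <= f z)%E) ->
  measurable_fun setT (fun x : R => \int[leb]_y f (x, y))%E.
Proof. by move=> mf f0; exact: (@measurable_fun_fubini_tonelli_F _ _ _ _ R leb f). Qed.

Lemma integral_exchange (f : R * R -> \bar R) :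
  measurable_fun setT f -> (forall z, (0 <= f z)%E) ->
  (\int[leb]_x \int[leb]_y f (x, y) = \int[leb]_y \int[leb]_x f (x, y))%E.
Proof. by move=> mf f0; exact: (@fubini_tonelli _ _ _ _ R leb leb f). Qed.

Section kernel.
Variables (K : R * R -> R[i]) (a b : R -> R[i]) (M : R).
Hypotheses (mK : cmeasurable setT K) (KM : forall z, cmod (K z) <= M).
Hypotheses (ia : cintegrable setT a) (ib : cintegrable setT b).

Let h (z : R * R) : R[i] := a z.1 * (K z * b z.2).

Let mh : cmeasurable setT h.
Proof.
have [a1 a2] := cintegrable_cmeasurable ia.
have [b1 b2] := cintegrable_cmeasurable ib.
apply: cmeasurableM; last apply: cmeasurableM => //.
  by split; [exact: (measurableT_comp a1 measurable_fst)|exact: (measurableT_comp a2 measurable_fst)].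
by split; [exact: (measurableT_comp b1 measurable_snd)|exact: (measurableT_comp b2 measurable_snd)].
Qed.

Let hM z : cmod (h z) <= M * (cmod (a z.1) * cmod (b z.2)).
Proof.
rewrite /h !cmodM mulrCA; apply: ler_wpM2r => //.
by rewrite mulr_ge0// cmod_ge0.
Qed.

Let M0 : 0 <= M.
Proof. exact: le_trans (cmod_ge0 _) (KM (0, 0)). Qed.

Let mKx x : cmeasurable setT (fun y => K (x, y)).
Proof.
by case: mK => k1 k2; split; apply: (measurableT_comp (f := fun z => _ (K z))) => //;
  exact: measurable_pair1.
Qed.

Let mKy y : cmeasurable setT (fun x => K (x, y)).
Proof.
by case: mK => k1 k2; split; apply: (measurableT_comp (f := fun z => _ (K z))) => //;
  exact: measurable_pair2.
Qed.

Let ihx x : cintegrable setT (fun y => K (x, y) * b y).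
Proof. exact: (@cintegrableMb _ _ _ _ M). Qed.

Let ihy y : cintegrable setT (fun x => K (x, y) * a x).
Proof. exact: (@cintegrableMb _ _ _ _ M). Qed.

Let ihx' x : cintegrable setT (fun y => h (x, y)).
Proof. exact: (cintegrableZ (a x) measurableT (ihx x)). Qed.

Let hE x y : h (x, y) = b y * (K (x, y) * a x).
Proof. by rewrite /h /= mulrC -mulrA mulrCA. Qed.

Let ihy' y : cintegrable setT (fun x => h (x, y)).
Proof. by under eq_fun do rewrite hE; apply: cintegrableZ. Qed.

Let ih12 : (\int[leb]_x \int[leb]_y (cmod (h (x, y)))%:E < +oo)%E.
Proof.
have mcb : measurable_fun setT (fun y => (cmod (b y))%:E).
  by apply/measurable_EFinP/cmeasurable_cmod; exact: cintegrable_cmeasurable.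
have mca : measurable_fun setT (fun y => (cmod (a y))%:E).
  by apply/measurable_EFinP/cmeasurable_cmod; exact: cintegrable_cmeasurable.
have Ba : (\int[leb]_y (cmod (a y))%:E < +oo)%E by apply: ((cintegrableP _ _).1 ia).2.
have Bb : (\int[leb]_y (cmod (b y))%:E < +oo)%E by apply: ((cintegrableP _ _).1 ib).2.
have Bb0 : (0 <= \int[leb]_y (cmod (b y))%:E)%E.
  by apply: integral_ge0 => y _; rewrite lee_fin cmod_ge0.
have Ba0 : (0 <= \int[leb]_y (cmod (a y))%:E)%E.
  by apply: integral_ge0 => y _; rewrite lee_fin cmod_ge0.
have mch : measurable_fun setT (fun z => (cmod (h z))%:E).
  by apply/measurable_EFinP; apply: cmeasurable_cmod.
apply: (@le_lt_trans _ _ (\int[leb]_x (M%:E * (\int[leb]_y (cmod (b y))%:E) * (cmod (a x))%:E))%E).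
  apply: ge0_le_integral => //.
  - by move=> x _; apply: integral_ge0 => y _; rewrite lee_fin cmod_ge0.
  - apply: (@measurable_integral_snd (fun z => (cmod (h z))%:E)) => //.
    by move=> z; rewrite lee_fin cmod_ge0.
  - exact: measurable_funeM.
  - move=> x _.
    rewrite -muleA [(_ * (cmod (a x))%:E)%E]muleC muleA -EFinM.
    rewrite -ge0_integralZl_EFin//; last 2 first.
    + by move=> y _; rewrite lee_fin cmod_ge0.
    + by rewrite mulr_ge0// cmod_ge0.
    apply: ge0_le_integral => //.
    + by move=> y _; rewrite lee_fin cmod_ge0.
    + by apply/measurable_EFinP/cmeasurable_cmod/cintegrable_cmeasurable.
    + exact: measurable_funeM.
    + by move=> y _; rewrite -EFinM lee_fin (le_trans (hM _))// mulrA.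
rewrite ge0_integralZl//.
- by apply: lte_mul_pinfty => //; [exact: mule_ge0| rewrite fin_numM// ge0_fin_numE].
- by move=> x _; rewrite lee_fin cmod_ge0.
- exact: mule_ge0.
Qed.

Let prodi (p : R[i] -> R) : (forall z, `|p z| <= cmod z) ->
  measurable_fun setT (p \o h) ->
  (leb \x leb)%E.-integrable setT (fun z => (p (h z))%:E).
Proof.
move=> pM mp; apply/integrable12ltyP; first exact/measurable_EFinP.
apply: le_lt_trans ih12; apply: ge0_le_integral => //.
- by move=> x _; apply: integral_ge0.
- apply: (@measurable_integral_snd (fun z => `|(p (h z))%:E|%E)) => //.
  by apply/measurable_EFinP; apply: (measurableT_comp (f := @Num.norm _ R)).
- apply: (@measurable_integral_snd (fun z => (cmod (h z))%:E)) => //.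
    by apply/measurable_EFinP; apply: cmeasurable_cmod.
  by move=> z; rewrite lee_fin cmod_ge0.
- move=> x _; apply: ge0_le_integral => //.
  + apply/measurable_EFinP; apply: measurableT_comp => //.
    by apply: (measurableT_comp mp); exact: measurable_pair1.
  + by apply/measurable_EFinP/cmeasurable_cmod/cintegrable_cmeasurable.
  + by move=> y _; rewrite abse_EFin lee_fin.
Qed.

Let iRe := prodi (@Re_le_cmod R) mh.1.
Let iIm := prodi (@Im_le_cmod R) mh.2.

Lemma cintegrable_kernel :
  cintegrable setT (fun x => a x * cintegral setT (fun y => K (x, y) * b y)).
Proof.
have E x : a x * cintegral setT (fun y => K (x, y) * b y) = cintegral setT (fun y => h (x, y)).
  by rewrite -cintegralZ.
under eq_fun do rewrite E; split => /=.
  apply: eq_integrable (integrable_fubini_F iRe) => //= x _.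
  by rewrite /fubini_F fineK//; apply: integrable_fin_num => //; case: (ihx' x).
apply: eq_integrable (integrable_fubini_F iIm) => //= x _.
by rewrite /fubini_F fineK//; apply: integrable_fin_num => //; case: (ihx' x).
Qed.

(** The modulus of the double integrand is dominated by a product of two
    integrable functions of one variable. *)
Lemma cFubini_kernel :
  cintegral setT (fun x => a x * cintegral setT (fun y => K (x, y) * b y)) =
  cintegral setT (fun y => b y * cintegral setT (fun x => K (x, y) * a x)).
Proof.
transitivity (cintegral setT (fun x => cintegral setT (fun y => h (x, y)))).
  by apply: eq_cintegral => x _; rewrite -cintegralZ.
transitivity (cintegral setT (fun y => cintegral setT (fun x => h (x, y)))); last first.
  apply: eq_cintegral => y _; rewrite -cintegralZ//.
  by apply: eq_cintegral => x _; rewrite hE.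
apply: cplxP => /=.
  rewrite /Rintegral; apply: (congr1 fine).
  transitivity (\int[leb]_x \int[leb]_y (complex.Re (h (x, y)))%:E)%E.
    apply: eq_integral => x _; rewrite fineK//.
    by apply: integrable_fin_num => //; case: (ihx' x).
  transitivity (\int[leb]_y \int[leb]_x (complex.Re (h (x, y)))%:E)%E.
    exact: (Fubini iRe).
  apply: eq_integral => y _; rewrite fineK//.
  by apply: integrable_fin_num => //; case: (ihy' y).
rewrite /Rintegral; apply: (congr1 fine).
transitivity (\int[leb]_x \int[leb]_y (complex.Im (h (x, y)))%:E)%E.
  apply: eq_integral => x _; rewrite fineK//.
  by apply: integrable_fin_num => //; case: (ihx' x).
transitivity (\int[leb]_y \int[leb]_x (complex.Im (h (x, y)))%:E)%E.
  exact: (Fubini iIm).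
apply: eq_integral => y _; rewrite fineK//.
by apply: integrable_fin_num => //; case: (ihy' y).
Qed.

End kernel.

Lemma cmeasurable_expi d (T : measurableType d) (g : T -> R) :
  measurable_fun setT g -> cmeasurable setT (fun x => expi (g x)).
Proof.
move=> mg; split.
  by apply: (measurableT_comp (f := @cos R)) => //; apply: continuous_measurable_fun; exact: continuous_cos.
by apply: (measurableT_comp (f := @sin R)) => //; apply: continuous_measurable_fun; exact: continuous_sin.
Qed.

Lemma cintegrable_expi D (g : R -> R) (f : R -> R[i]) : measurable D ->
  measurable_fun setT g -> cintegrable D f -> cintegrable D (fun x => expi (g x) * f x).
Proof.
move=> mD mg fi; apply: (@cintegrableMb _ _ _ _ 1) => //.
  have [m1 m2] := cmeasurable_expi mg.
  by split; [exact: measurable_funS m1|exact: measurable_funS m2].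
by move=> x _; rewrite cmod_expi.
Qed.

(** The oscillating integrals of an integrable function depend continuously
    on the frequency, by dominated convergence. *)
Lemma cmeasurable_ft (f : R -> R[i]) : cintegrable setT f ->
  cmeasurable setT (fun x : R => cintegral setT (fun y => expi (x * y) * f y)).
Proof.
move=> fi; have [f1 f2] := fi.
have i12 : leb.-integrable setT (EFin \o (fun y => cmod (f y))).
  exact: cintegrable_cmod.
have ie x : cintegrable setT (fun y => expi (x * y) * f y).
  by apply: cintegrable_expi => //; exact: measurable_funM.
have cont (p : R[i] -> R) : (forall z, `|p z| <= cmod z) ->
    (forall x, leb.-integrable setT (EFin \o (fun y => p (expi (x * y) * f y)))) ->
    (forall y, continuous (fun x : R => p (expi (x * y) * f y))) ->
    measurable_fun setT (fun x : R => \int[leb]_y p (expi (x * y) * f y)).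
  move=> pM ip cp; apply: continuous_measurable_fun => x.
  have := @continuity_under_integral R _ _ leb (fun x y => p (expi (x * y) * f y)) setT
    measurableT (x - 1) (x + 1) (fun x _ => ip x) _ _ i12 _ x.
  apply.
  - by apply: aeW => y _ x0 _; exact: cp.
  - move=> x0 _; apply: aeW => y _; rewrite (le_trans (pM _))//.
    by rewrite cmodM cmod_expi mul1r.
  - by rewrite inE /= in_itv/= ltrBlDr ltrDl ltr01.
have cc y : continuous (fun x : R => cos (x * y)).
  by move=> x; apply: continuous_comp; [exact: mulrr_continuous|exact: continuous_cos].
have cs y : continuous (fun x : R => sin (x * y)).
  by move=> x; apply: continuous_comp; [exact: mulrr_continuous|exact: continuous_sin].
split => /=.
  apply: (cont (@complex.Re R) (@Re_le_cmod R)); first by move=> x; case: (ie x).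
  move=> y; under eq_fun do rewrite ReM /=.
  by move=> x; apply: cvgB; (apply: cvgM; last exact: cvg_cst); [exact: cc|exact: cs].
apply: (cont (@complex.Im R) (@Im_le_cmod R)); first by move=> x; case: (ie x).
move=> y; under eq_fun do rewrite ImM /=.
by move=> x; apply: cvgD; (apply: cvgM; last exact: cvg_cst); [exact: cc|exact: cs].
Qed.

End ComplexFubini.

(** * The Poisson kernel *)

Section PoissonKernel.
Context {R : realType}.
Local Notation leb := (@lebesgue_measure R).

Lemma is_derive_continuous (f F : R -> R) :
  (forall x : R, is_derive x 1 F (f x)) -> continuous F.
Proof.
by move=> dF x; apply/differentiable_continuous/derivable1_diffP; case: (dF x).
Qed.

Lemma FTC2_is_derive (f F : R -> R) a b : a < b ->
  (forall x : R, is_derive x 1 F (f x)) -> continuous f ->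
  \int[leb]_(x in `[a, b]) f x = F b - F a.
Proof.
move=> ab dF cf; have cF := is_derive_continuous dF.
rewrite /Rintegral (@continuous_FTC2 _ f F) //.
- exact: continuous_subspaceT.
- split; first by move=> x _; case: (dF x).
  + exact/cvg_at_right_filter/cF.
  + exact/cvg_at_left_filter/cF.
- by move=> x _; rewrite derive1E; case: (dF x).
Qed.

Lemma ge0_FTC2y_is_derive (f F : R -> R) a l :
  (forall x : R, is_derive x 1 F (f x)) -> continuous f -> (forall x, 0 <= f x) ->
  F x @[x --> +oo] --> l ->
  (\int[leb]_(x in `[a, +oo[) (f x)%:E = l%:E - (F a)%:E)%E.
Proof.
move=> dF cf f0 Fl; have cF := is_derive_continuous dF.
apply: ge0_continuous_FTC2y => //.
- exact: continuous_subspaceT.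
- exact/cvg_at_right_filter/cF.
- by move=> x _; rewrite derive1E; case: (dF x).
Qed.

Variable e : R.
Hypothesis e0 : 0 < e.

Lemma Abel_damping_continuous : continuous (fun x : R => expR (- (e * `|x|))).
Proof.
move=> x; apply: continuous_comp; last exact: continuous_expR.
apply: cvgN; apply: cvgM; first exact: cvg_cst.
exact: norm_continuous.
Qed.

Let P (u x : R) := expR (- (e * x)) * (1 + cos (u * x)).
Let F (u x : R) := expR (- (e * x)) *
  (- e^-1 + (u * sin (u * x) - e * cos (u * x)) / (e ^+ 2 + u ^+ 2)).

Let den u : e ^+ 2 + u ^+ 2 != 0.
Proof. by rewrite gt_eqF// ltr_wpDr ?sqr_ge0// exprn_gt0. Qed.

Let dF (u x : R) : is_derive x 1 (F u) (P u x).
Proof.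
have dlin (k : R) : is_derive x 1 (fun x : R => k * x) k.
  have := is_deriveZ k (is_derive_id x (1 : R)).
  by rewrite /GRing.scale/= mulr1.
have dneg : is_derive x 1 (fun x : R => - (e * x)) (- e).
  exact: is_deriveN.
have d1 : is_derive x 1 (fun x : R => expR (- (e * x))) (- e * expR (- (e * x))).
  by rewrite mulrC; exact: (@is_derive1_comp _ expR (fun x => - (e * x))).
have d2 : is_derive x 1 (fun x : R => sin (u * x)) (u * cos (u * x)).
  by rewrite mulrC; exact: (@is_derive1_comp _ sin (fun x => u * x)).
have d3 : is_derive x 1 (fun x : R => cos (u * x)) (u * - sin (u * x)).
  by rewrite mulrC; exact: (@is_derive1_comp _ cos (fun x => u * x)).
rewrite /F; apply: is_derive_eq.
rewrite /P /GRing.scale /=; field; by rewrite (gt_eqF e0) (den u).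
Qed.

Let cP u : continuous (P u).
Proof.
move=> x; apply: cvgM; last first.
  apply: cvgD; first exact: cvg_cst.
  by apply: continuous_comp; [exact: mulrl_continuous|exact: continuous_cos].
apply: continuous_comp; last exact: continuous_expR.
by apply: cvgN; exact: mulrl_continuous.
Qed.

Let F_oo u : F u x @[x --> +oo] --> 0.
Proof.
pose C := e^-1 + (`|u| + e) / (e ^+ 2 + u ^+ 2).
have C0 : forall x, `| - e^-1 + (u * sin (u * x) - e * cos (u * x)) / (e ^+ 2 + u ^+ 2)| <= C.
  move=> x; rewrite (le_trans (ler_normD _ _))// lerD//.
    by rewrite normrN gtr0_norm// invr_gt0.
  rewrite normrM normfV [`|_ + u ^+ 2|]ger0_norm ?addr_ge0 ?sqr_ge0//.
  rewrite ler_wpM2r ?invr_ge0 ?addr_ge0 ?sqr_ge0//.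
  rewrite (le_trans (ler_normB _ _))// !normrM lerD//.
    by rewrite ler_piMr// ler_norml sin_geN1 sin_le1.
  by rewrite (gtr0_norm e0) ler_piMr ?(ltW e0)// ler_norml cos_geN1 cos_le1.
have E0 : expR (- (e * x)) @[x --> +oo] --> 0.
  apply: (@cvg_comp _ _ _ (fun x => e * x) (fun x => expR (- x))); last exact: cvgr_expR.
  exact: gt0_cvgMry.
apply/norm_cvg0P.
have EC : expR (- (e * x)) * C @[x --> +oo] --> 0.
  by rewrite -(mul0r C); apply: cvgM => //; exact: cvg_cst.
apply: (squeeze_cvgr _ (cvg_cst 0) EC); near=> x.
rewrite normr_ge0/= /F normrM ger0_norm ?expR_ge0// ler_wpM2l ?expR_ge0//.
Unshelve. all: by end_near. Qed.

(** Adding 1 to the cosine makes the integrand nonnegative, so that a primitive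
    and its limit at infinity give the integral at once; the case u = 0 then
    yields the integrability of the damping factor. *)
Lemma Abel_cos_nonneg u :
  (\int[leb]_x (expR (- (e * `|x|)) * (1 + cos (u * x)))%:E =
   (2 * (e^-1 + e / (e ^+ 2 + u ^+ 2)))%:E)%E.
Proof.
have cabs : continuous (fun x : R => expR (- (e * `|x|)) * (1 + cos (u * x))).
  move=> x; apply: cvgM; first exact: Abel_damping_continuous.
  apply: cvgD; first exact: cvg_cst.
  by apply: continuous_comp; [exact: mulrl_continuous|exact: continuous_cos].
have c0 x : 0 <= 1 + cos (u * x) by rewrite -lerBlDl sub0r cos_geN1.
rewrite ge0_symfun_integralT//; last first.
- by move=> x /=; rewrite normrN mulrN cosN.
rewrite -set_itvcy EFinM; congr (_ * _)%E.
transitivity (\int[leb]_(x in `[0%R, +oo[) (P u x)%:E)%E.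
  apply: eq_integral => x.
  by rewrite inE/= in_itv/= andbT => x0; rewrite ger0_norm.
rewrite (ge0_FTC2y_is_derive 0 (dF u) (@cP u) _ (@F_oo u)).
  rewrite /F !mulr0 sin0 cos0 oppr0 expR0 -EFinB; congr EFin.
  by field; rewrite (gt_eqF e0) (den u).
by move=> x; rewrite /P mulr_ge0 ?expR_ge0.
Qed.

Lemma Abel_integrable : leb.-integrable setT (EFin \o (fun x : R => expR (- (e * `|x|)))).
Proof.
have mE : measurable_fun setT (fun x : R => expR (- (e * `|x|))).
  by apply: continuous_measurable_fun; exact: Abel_damping_continuous.
apply/integrableP; split; first exact/measurable_EFinP.
have := Abel_cos_nonneg 0.
have -> : (\int[leb]_x (expR (- (e * `|x|)) * (1 + cos (0 * x)))%:E =
   \int[leb]_x (2%:E * (expR (- (e * `|x|)))%:E))%E.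
  by apply: eq_integral => x _; rewrite mul0r cos0 -EFinM mulrC.
rewrite ge0_integralZl_EFin//; last first.
  exact/measurable_EFinP.
move=> h; under eq_integral do rewrite /= ger0_norm ?expR_ge0//.
rewrite ltey; apply/eqP => hy; move: h; rewrite hy gt0_muley ?lte_fin//.
Qed.

Let mE : measurable_fun setT (fun x : R => expR (- (e * `|x|))).
Proof. by apply: continuous_measurable_fun; exact: Abel_damping_continuous. Qed.

Let iEb (g : R -> R) : measurable_fun setT g -> (forall x, `|g x| <= 1) ->
  leb.-integrable setT (EFin \o (fun x : R => expR (- (e * `|x|)) * g x)).
Proof.
move=> mg g1; apply: (le_integrable _ _ _ Abel_integrable) => //.
  by apply/measurable_EFinP; exact: measurable_funM.
by move=> x _ /=; rewrite lee_fin normrM ler_piMr.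
Qed.

Lemma Abel_cos u : \int[leb]_x (expR (- (e * `|x|)) * cos (u * x)) =
  2 * e / (e ^+ 2 + u ^+ 2).
Proof.
have mc v : measurable_fun setT (fun x : R => cos (v * x)).
  apply: continuous_measurable_fun => x.
  by apply: continuous_comp; [exact: mulrl_continuous|exact: continuous_cos].
have c1 v x : `|cos (v * x)| <= 1 :> R by rewrite ler_norml cos_geN1 cos_le1.
have h v : \int[leb]_x (expR (- (e * `|x|))) + \int[leb]_x (expR (- (e * `|x|)) * cos (v * x))
    = 2 * (e^-1 + e / (e ^+ 2 + v ^+ 2)).
  rewrite -RintegralD//; [|exact: Abel_integrable|exact: iEb].
  rewrite -[RHS]/(fine (_%:E)) -Abel_cos_nonneg; congr fine.
  by apply: eq_integral => x _; rewrite mulrDr mulr1.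
have := h 0; under [X in _ + X]eq_Rintegral do rewrite mul0r cos0 mulr1.
move=> h0; have := h u; move: h0.
set I := \int[leb]_x _ => h0; have -> : I = 2 / e.
  have : 2 * I = 2 * (2 / e).
    rewrite mulr_natl mulr2n h0; field; exact: lt0r_neq0.
  by apply: mulfI.
move=> /(congr1 (fun z => z - 2 / e)); rewrite addrAC subrr add0r => ->.
by field; rewrite (gt_eqF e0) (den u).
Qed.

(** The sine part is odd; 1 + sin replaces sin because the reflection formula is
    for nonnegative functions. *)
Lemma Abel_sin u : \int[leb]_x (expR (- (e * `|x|)) * sin (u * x)) = 0.
Proof.
have ms : measurable_fun setT (fun x : R => sin (u * x)).
  apply: continuous_measurable_fun => x.
  by apply: continuous_comp; [exact: mulrl_continuous|exact: continuous_sin].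
have s1 x : `|sin (u * x)| <= 1 :> R by rewrite ler_norml sin_geN1 sin_le1.
have m1 : measurable_fun setT (fun x : R => (expR (- (e * `|x|)) * (1 + sin (u * x)))%:E).
  by apply/measurable_EFinP; apply: measurable_funM => //; apply: measurable_funD.
have := @ge0_integral_reflect R _ m1 _.
move=> /(_ _)/(congr1 fine); set A := fine _; set B := fine _ => AB.
have {AB} AB : A = B.
  by apply: AB => x; rewrite lee_fin mulr_ge0 ?expR_ge0// -lerBlDl sub0r sin_geN1.
have EA : A = \int[leb]_x (expR (- (e * `|x|))) - \int[leb]_x (expR (- (e * `|x|)) * sin (u * x)).
  rewrite -RintegralB//; [|exact: Abel_integrable|exact: iEb].
  by congr fine; apply: eq_integral => x _; rewrite normrN mulrN sinN mulrDr mulr1 mulrN.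
have EB : B = \int[leb]_x (expR (- (e * `|x|))) + \int[leb]_x (expR (- (e * `|x|)) * sin (u * x)).
  rewrite -RintegralD//; [|exact: Abel_integrable|exact: iEb].
  by congr fine; apply: eq_integral => x _; rewrite mulrDr mulr1.
have key (I S : R) : I - S = I + S -> S = 0 by move=> /addrI /esym /eqP; rewrite -subr_eq0 opprK -mulr2n mulrn_eq0/= => /eqP.
by move: AB; rewrite EA EB; exact: key.
Qed.

(** The right-hand side is the Poisson kernel. *)
Lemma Abel_expi u :
  cintegral setT (fun x => expi (u * x) * real_complex R (expR (- (e * `|x|)))) =
  real_complex R (2 * e / (e ^+ 2 + u ^+ 2)).
Proof.
apply: cplxP => /=.
  rewrite -Abel_cos; apply: eq_Rintegral => x _; ring.
rewrite -[RHS](Abel_sin u); apply: eq_Rintegral => x _; ring.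
Qed.

Lemma cintegrable_Abel :
  cintegrable setT (fun x => real_complex R (expR (- (e * `|x|)))).
Proof. by split => /=; [exact: Abel_integrable|exact: integrable0]. Qed.

(** An arctangent is a primitive of the Poisson kernel. As e tends to 0 the
    mass of the interval tends to 2 pi or 0 according as y is inside or outside. *)
Lemma Poisson_itv y a b : a < b ->
  \int[leb]_(t in `[a, b]) (2 * e / (e ^+ 2 + (t - y) ^+ 2)) =
  2 * (atan ((b - y) / e) - atan ((a - y) / e)).
Proof.
move=> ab; pose G t := 2 * atan ((t - y) / e).
rewrite mulrBr -/(G b) -/(G a); apply: (FTC2_is_derive ab) => [t|t].
  have dl : is_derive t 1 (fun t : R => (t - y) / e) e^-1.
    apply: is_derive_eq; rewrite /GRing.scale/=; ring.
  have d2 : is_derive t 1 (fun t => atan ((t - y) / e)) ((1 + ((t - y) / e) ^+ 2)^-1 * e^-1).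
    exact: (@is_derive1_comp _ atan (fun t => (t - y) / e)).
  rewrite /G; apply: is_derive_eq; rewrite /GRing.scale/=.
  have h1 : 1 + ((t - y) / e) ^+ 2 != 0 by rewrite gt_eqF// ltr_wpDr ?sqr_ge0.
  have h2 := den (t - y).
  have -> : e ^+ 2 + (t - y) ^+ 2 = e ^+ 2 * (1 + ((t - y) / e) ^+ 2).
    by field; rewrite (gt_eqF e0).
  by move: h1; set w := 1 + _ => h1; field; rewrite (gt_eqF e0) h1.
apply: cvgM; first exact: cvg_cst.
apply: cvgV; first exact: den.
apply: cvgD; first exact: cvg_cst.
apply: (@cvg_comp _ _ _ (fun t => t - y) (fun z => z ^+ 2)); last exact: exprn_continuous.
by apply: cvgB; [exact: cvg_id|exact: cvg_cst].
Qed.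

End PoissonKernel.

(** * Fourier inversion and transforms of products on the line *)

Section Inversion.
Context {R : realType}.
Local Notation leb := (@lebesgue_measure R).

(** The primitive of g vanishes identically, and by Lebesgue differentiation g is
    almost everywhere its derivative. *)
Lemma itv_integral_eq0_ae (g : R -> R) :
  (forall a b, leb.-integrable `[a, b] (EFin \o g)) -> measurable_fun setT g ->
  (forall a b, a < b -> \int[leb]_(x in `[a, b]) g x = 0) ->
  {ae leb, forall x, g x = 0}.
Proof.
move=> ig mg g0.
have lg : locally_integrable setT g.
  split => //; first exact: openT.
  move=> K _ cK; have [M [_ KM]] := compact_bounded cK.
  have /integrableP[/= _] := ig (- (`|M| + 1)) (`|M| + 1).
  apply: le_lt_trans; apply: ge0_subset_integral => //.
  - exact: compact_measurable.
  - apply/measurable_EFinP; apply: measurableT_comp => //.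
    exact: measurable_funS mg.
  - move=> x Kx /=; rewrite in_itv/= -ler_norml.
    by apply: (KM (`|M| + 1)) => //; rewrite (le_lt_trans (ler_norm _))// ltrDl.
have h n : {ae leb, forall x, - (n%:R) < x -> g x = 0}.
  have /= H := @FTC1 R g (BLeft (- n%:R)) (fun y => ig _ _) lg.
  apply: (ae_imply H) => x /= hx nx; have [] := hx nx.
  set G := (X in derivable X _ _) => _ <-.
  have GE : G = cst 0.
    apply/funext => y; rewrite /G /=; case: (ltrgtP (- n%:R) y) => ny.
    - exact: g0.
    - by rewrite set_itv_ge ?Rintegral_set0// bnd_simp -ltNge.
    - by rewrite -ny set_itv1 Rintegral_set1.
  by rewrite -/G GE derive1_cst.
apply: (ae_imply (@ae_foralln _ _ _ leb _ h)) => x hx.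
apply: (hx (Num.bound `|x|)).
rewrite ltrNl (le_lt_trans (ler_norm _))// normrN.
exact: archi_boundP.
Qed.

Lemma itv_cintegral_ae (g h : R -> R[i]) :
  (forall a b, cintegrable `[a, b] g) -> cmeasurable setT g ->
  (forall a b, cintegrable `[a, b] h) -> cmeasurable setT h ->
  (forall a b, a < b -> cintegral `[a, b] g = cintegral `[a, b] h) ->
  {ae leb, forall x, g x = h x}.
Proof.
move=> ig [mg1 mg2] ih [mh1 mh2] gh.
have E1 : {ae leb, forall x, complex.Re (g x) - complex.Re (h x) = 0}.
  apply: (itv_integral_eq0_ae (g := fun x => complex.Re (g x) - complex.Re (h x))) => [a b||a b ab].
  - have [g1 _] := ig a b; have [h1 _] := ih a b.
    by apply: eq_integrable (integrableB _ g1 h1).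
  - exact: measurable_funB.
  - have [g1 _] := ig a b; have [h1 _] := ih a b.
    rewrite RintegralB//; apply/eqP; rewrite subr_eq0; apply/eqP.
    exact: (congr1 (@complex.Re R) (gh a b ab)).
have E2 : {ae leb, forall x, complex.Im (g x) - complex.Im (h x) = 0}.
  apply: (itv_integral_eq0_ae (g := fun x => complex.Im (g x) - complex.Im (h x))) => [a b||a b ab].
  - have [_ g1] := ig a b; have [_ h1] := ih a b.
    by apply: eq_integrable (integrableB _ g1 h1).
  - exact: measurable_funB.
  - have [_ g1] := ig a b; have [_ h1] := ih a b.
    rewrite RintegralB//; apply/eqP; rewrite subr_eq0; apply/eqP.
    exact: (congr1 (@complex.Im R) (gh a b ab)).
have E n : {ae leb, forall x, if n == 0%N then complex.Re (g x) - complex.Re (h x) = 0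
    else complex.Im (g x) - complex.Im (h x) = 0} by case: n.
apply: (ae_imply (@ae_foralln _ _ _ leb _ E)) => x hx.
by apply: cplxP; apply/eqP; rewrite -subr_eq0; apply/eqP; [exact: (hx 0%N)|exact: (hx 1%N)].
Qed.

Lemma cintegral_mkcond (a b : R) (g : R -> R[i]) :
  cintegral `[a, b] g =
  cintegral setT (fun x => real_complex R (\1_`[a, b]%classic x) * g x).
Proof.
apply: cplxP => /=; rewrite Rintegral_mkcond; apply: eq_Rintegral => x _.
  rewrite patchE ReM /= indicE mul0r subr0.
  by case: ifPn => _; rewrite ?mul1r ?mul0r.
rewrite patchE ImM /= indicE mul0r addr0.
by case: ifPn => _; rewrite ?mul1r ?mul0r.
Qed.

Lemma cintegrable_indic (a b : R) :
  cintegrable setT (fun x => real_complex R (\1_`[a, b]%classic x)).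
Proof.
split => /=; last exact: integrable0.
by apply: integrable_indic_itv.
Qed.

Lemma cintegrable_bounded (a b M : R) (g : R -> R[i]) :
  cmeasurable setT g -> (forall x, cmod (g x) <= M) -> cintegrable `[a, b] g.
Proof.
move=> [m1 m2] gM; apply: (@cintegrable_dom _ _ _ (cst M)) => //.
  by split; [exact: measurable_funS m1|exact: measurable_funS m2].
apply: continuous_compact_integrable; first exact: segment_compact.
by apply: continuous_subspaceT => x; exact: cst_continuous.
Qed.

Lemma cintegrable_sub (A : set R) (g : R -> R[i]) : measurable A ->
  cintegrable setT g -> cintegrable A g.
Proof.
by move=> mA [g1 g2]; split; [exact: integrableS g1|exact: integrableS g2].
Qed.

Lemma cmeasurable_comp d (T : measurableType d) (g : R -> R[i]) (p : T -> R) :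
  cmeasurable setT g -> measurable_fun setT p -> cmeasurable setT (fun x => g (p x)).
Proof.
by move=> [m1 m2] mp; split; [exact: (measurableT_comp m1 mp)|exact: (measurableT_comp m2 mp)].
Qed.

Lemma cmeasurable_fourier_transform (f : R -> R[i]) : cintegrable setT f ->
  cmeasurable setT (fourier_transform f).
Proof.
move=> fi; have mopp : measurable_fun setT (fun x : R => - x) by exact: measurableT_comp.
have := cmeasurable_comp (cmeasurable_ft fi) mopp.
rewrite (_ : (fun x : R => _) = fourier_transform f)//; apply/funext => x.
by rewrite /fourier_transform; apply: eq_cintegral => y _; congr (expi _ * _); rewrite mulNr mulrC.
Qed.

Lemma cmod_fourier_transform (f : R -> R[i]) tau : cintegrable setT f ->
  cmod (fourier_transform f tau) <= \int[leb]_x cmod (f x).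
Proof.
move=> fi; rewrite (le_trans (cmod_cintegral _ _))//.
  apply: cintegrable_expi => //; apply: measurableT_comp => //.
  exact: measurable_funM.
by under eq_Rintegral do rewrite cmodM cmod_expi mul1r.
Qed.

Lemma cvg_atan_scaled (c : R) : 0 < c -> atan (c / (n.+1%:R)^-1) @[n --> \oo] --> pi / 2.
Proof.
move=> c0; apply: (@cvg_comp _ _ _ (fun n : nat => c / (n.+1%:R)^-1) atan); last exact: cvgy_atan.
have -> : (fun n : nat => c / n.+1%:R^-1) = (fun n : nat => c * n.+1%:R).
  by apply/funext => n; rewrite invrK.
apply/cvgryPge => A; near=> n.
rewrite -ler_pdivrMl// (@le_trans _ _ n%:R)// ?ler_nat//.
near: n; exact: nbhs_infty_ger.
Unshelve. all: by end_near. Qed.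

Lemma cvg_atan_scaled_neg (c : R) : c < 0 -> atan (c / (n.+1%:R)^-1) @[n --> \oo] --> - (pi / 2).
Proof.
move=> c0; have c0' : 0 < - c by rewrite oppr_gt0.
under eq_fun do rewrite -[c in atan (c / _)]opprK mulNr atanN.
by apply: cvgN; exact: cvg_atan_scaled.
Qed.

Lemma cintegrable_fourier_kernel (f : R -> R[i]) (tau : R) : cintegrable setT f ->
  cintegrable setT (fun t => expi (- (t * tau)) * f t).
Proof.
by apply: cintegrable_expi => //; apply: measurableT_comp => //; exact: measurable_funM.
Qed.

Lemma fourier_transformB (f g : R -> R[i]) tau : cintegrable setT f -> cintegrable setT g ->
  fourier_transform (fun t => f t - g t) tau = fourier_transform f tau - fourier_transform g tau.
Proof.
move=> fi gi; rewrite /fourier_transform -cintegralB//; try exact: cintegrable_fourier_kernel.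
by apply: eq_cintegral => t _; rewrite mulrBr.
Qed.

Lemma fourier_transformZ c (f : R -> R[i]) tau : cintegrable setT f ->
  fourier_transform (fun t => c * f t) tau = c * fourier_transform f tau.
Proof.
move=> fi; rewrite /fourier_transform -cintegralZ//; last exact: cintegrable_fourier_kernel.
by apply: eq_cintegral => t _; rewrite mulrCA.
Qed.

Lemma fourier_transform_sum I (r : seq I) (f : I -> R -> R[i]) tau :
  (forall i, cintegrable setT (f i)) ->
  fourier_transform (fun t => \sum_(i <- r) f i t) tau =
  \sum_(i <- r) fourier_transform (f i) tau.
Proof.
move=> fi; rewrite /fourier_transform -cintegral_sum//; last first.
  by move=> i; exact: cintegrable_fourier_kernel.
by apply: eq_cintegral => t _; rewrite mulr_sumr.
Qed.

Lemma fourier_transformJ (f : R -> R[i]) tau : cintegrable setT f ->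
  fourier_transform (fun t => conjc (f t)) tau = conjc (fourier_transform f (- tau)).
Proof.
move=> fi; rewrite /fourier_transform -cintegralJ//; last exact: cintegrable_fourier_kernel.
by apply: eq_cintegral => t _; rewrite conjcM conjc_expi mulrN opprK.
Qed.

Section inversion.
Variable f : R -> R[i].
Hypothesis fi : cintegrable setT f.
Let fh := fourier_transform f.
Hypothesis fhi : cintegrable setT fh.

(* h is the inverse transform up to the factor 2 pi, and A n is its Abel mean at
   scale eps n, damped by E n; Q n is the corresponding Poisson kernel. *)
Let h t := cintegral setT (fun x => expi (t * x) * fh x).
Let eps (n : nat) : R := (n.+1%:R)^-1.
Let eps0 n : 0 < eps n. Proof. by rewrite invr_gt0. Qed.
Let E n (x : R) := real_complex R (expR (- (eps n * `|x|))).
Let A n t := cintegral setT (fun x => expi (t * x) * (E n x * fh x)).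
Let Q n (z : R) : R := 2 * eps n / (eps n ^+ 2 + z ^+ 2).

Let mh : cmeasurable setT h. Proof. exact: cmeasurable_ft. Qed.

Let E1 n x : cmod (E n x) <= 1.
Proof.
by rewrite cmod_real ger0_norm ?expR_ge0// -expR0 ler_expR oppr_le0 mulr_ge0// ltW.
Qed.

Let mE n : cmeasurable setT (E n).
Proof. by case: (cintegrable_cmeasurable (cintegrable_Abel (eps0 n))). Qed.

Let iEfh n : cintegrable setT (fun x => E n x * fh x).
Proof. by apply: (@cintegrableMb _ _ _ _ 1). Qed.

Let Q_le n z : cmod (real_complex R (Q n z)) <= 2 / eps n.
Proof.
have e0 := eps0 n.
have d0 : 0 < eps n ^+ 2 + z ^+ 2 by rewrite ltr_wpDr ?sqr_ge0// exprn_gt0.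
rewrite cmod_real ger0_norm /Q; last by rewrite divr_ge0 ?(ltW d0)// mulr_ge0// ltW.
rewrite ler_pdivrMr// -mulrA ler_pM2l// ler_pdivlMl// -expr2 lerDl sqr_ge0//.
Qed.

Let mQ d (T : measurableType d) n (p : T -> R) : measurable_fun setT p ->
  cmeasurable setT (fun x => real_complex R (Q n (p x))).
Proof.
move=> mp; split => /=; last exact: measurable_cst.
apply: (measurableT_comp (f := Q n)) => //; apply: continuous_measurable_fun => z.
apply: cvgM; first exact: cvg_cst.
have d0 y : 0 < eps n ^+ 2 + y ^+ 2 by rewrite ltr_wpDr ?sqr_ge0// exprn_gt0.
apply: cvgV; first by rewrite gt_eqF.
by apply: cvgD; [exact: cvg_cst|exact: exprn_continuous].
Qed.

(* Abel means of the inverse transform are convolutions with the Poisson kernel. *)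
Let AE n t : A n t = cintegral setT (fun y => real_complex R (Q n (t - y)) * f y).
Proof.
pose K (z : R * R) := expi (- (z.2 * z.1)).
have mK : cmeasurable setT K.
  apply: cmeasurable_expi; apply: measurableT_comp => //.
  by apply: measurable_funM; [exact: measurable_snd|exact: measurable_fst].
have K1 z : cmod (K z) <= 1 by rewrite cmod_expi.
have ia : cintegrable setT (fun x => expi (t * x) * E n x).
  by apply: cintegrable_expi => //; exact: cintegrable_Abel.
transitivity (cintegral setT (fun x => (expi (t * x) * E n x) * cintegral setT (fun y => K (x, y) * f y))).
  by apply: eq_cintegral => x _; rewrite mulrA.
rewrite (cFubini_kernel mK K1 ia fi); apply: eq_cintegral => y _.
rewrite mulrC; congr (_ * _).
rewrite /Q -Abel_expi//; apply: eq_cintegral => x _.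
rewrite mulrA -expiD; congr (expi _ * _); rewrite /=; ring.
Qed.

(* Fubini, then the mass of the interval for the Poisson kernel. *)
Let A_itv n a b : a < b -> cintegral `[a, b] (A n) =
  cintegral setT (fun y => f y *
    real_complex R (2 * (atan ((b - y) / eps n) - atan ((a - y) / eps n)))).
Proof.
move=> ab; rewrite cintegral_mkcond.
pose K (z : R * R) := real_complex R (Q n (z.1 - z.2)).
have mK : cmeasurable setT K.
  by apply: mQ; apply: measurable_funB; [exact: measurable_fst|exact: measurable_snd].
have := cFubini_kernel mK (fun z => Q_le n _) (cintegrable_indic a b) fi.
rewrite (@eq_cintegral _ _ _ (fun x => real_complex R (\1_`[a, b]%classic x) * A n x)); last first.
  by move=> x _; rewrite AE.
move=> ->; apply: eq_cintegral => y _; congr (_ * _).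
rewrite -Poisson_itv//.
transitivity (cintegral `[a, b] (fun x => K (x, y))).
  by rewrite cintegral_mkcond; apply: eq_cintegral => x _; rewrite mulrC.
apply: cplxP => //=.
by rewrite /Rintegral integral0_eq.
Qed.

Let A_cvg t : ccvg (A ^~ t) (h t).
Proof.
apply: (@dominated_ccvg R setT (fun n x => expi (t * x) * (E n x * fh x)) _ (fun x => cmod (fh x)) measurableT _ _ _ _ _).2.
- move=> n; apply: cintegrable_cmeasurable; exact: cintegrable_expi.
- apply: cintegrable_cmeasurable; exact: cintegrable_expi.
- apply: aeW => x _; have -> : (fun n => expi (t * x) * (E n x * fh x)) = (fun n => expi (t * x) * fh x * E n x).
    by apply/funext => n; rewrite mulrCA mulrC.
  rewrite -[X in ccvg _ X]mulr1; apply: ccvgMl; rewrite -[1]/(real_complex R 1).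
  apply: ccvg_real; rewrite -expR0; apply: continuous_cvg; first exact: continuous_expR.
  rewrite -oppr0; apply: cvgN; rewrite -(mul0r `|x|); apply: cvgM; last exact: cvg_cst.
  exact: cvg_harmonic.
- exact: cintegrable_cmod.
- by apply: aeW => x n _; rewrite !cmodM cmod_expi mul1r ler_piMl ?cmod_ge0.
Qed.

Let A_le n t : cmod (A n t) <= \int[leb]_x cmod (fh x).
Proof.
rewrite (le_trans (cmod_cintegral _ _))//.
  by apply: cintegrable_expi => //; exact: measurable_funM.
apply: le_Rintegral => //.
- apply: cintegrable_cmod => //; apply: cintegrable_expi => //; exact: measurable_funM.
- exact: cintegrable_cmod.
- by move=> x _; rewrite !cmodM cmod_expi mul1r ler_piMl ?cmod_ge0.
Qed.

Let h_le t : cmod (h t) <= \int[leb]_x cmod (fh x).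
Proof.
rewrite (le_trans (cmod_cintegral _ _))//.
  by apply: cintegrable_expi => //; exact: measurable_funM.
by under eq_Rintegral do rewrite cmodM cmod_expi mul1r.
Qed.

Let mA n : cmeasurable setT (A n). Proof. exact: cmeasurable_ft. Qed.

Let lim1 a b : ccvg (fun n => cintegral `[a, b] (A n)) (cintegral `[a, b] h).
Proof.
have msub g : cmeasurable setT g -> cmeasurable (`[a, b]%classic : set R) g.
  by move=> [m1 m2]; split; [exact: measurable_funS m1|exact: measurable_funS m2].
apply: (@dominated_ccvg R `[a, b] A h (cst (\int[leb]_x cmod (fh x))) _ _ _ _ _ _).2 => //.
- by move=> n; exact: msub.
- exact: msub.
- by apply: aeW => x _; exact: A_cvg.
- apply: continuous_compact_integrable; first exact: segment_compact.
  by apply: continuous_subspaceT => x; exact: cst_continuous.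
- by apply: aeW => x n _; exact: A_le.
Qed.

(* The arctangents tend to 2 pi times the indicator function of the interval,
   except at its end points. *)
Let lim2 a b : a < b ->
  ccvg (fun n => cintegral setT (fun y => f y *
    real_complex R (2 * (atan ((b - y) / eps n) - atan ((a - y) / eps n)))))
  (cintegral setT (fun y => f y * real_complex R (2 * pi * \1_`[a, b]%classic y))).
Proof.
move=> ab.
have mat n c : measurable_fun setT (fun y : R => atan ((c - y) / eps n)).
  apply: (measurableT_comp (f := @atan R)).
    by apply: continuous_measurable_fun => z; exact: continuous_atan.
  by apply: measurable_funM => //; exact: measurable_funB.
have mf := cintegrable_cmeasurable fi.
have bat (z : R) : `|atan z| <= pi / 2.
  by rewrite ler_norml (ltW (atan_gtNpi2 _)) (ltW (atan_ltpi2 _)).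
apply: (@dominated_ccvg R setT _ _ (fun y => 2 * pi * cmod (f y)) measurableT _ _ _ _ _).2.
- move=> n; apply: cmeasurableM => //; split => /=; last exact: measurable_cst.
  by apply: measurable_funM => //; exact: measurable_funB.
- apply: cmeasurableM => //; split => /=; last exact: measurable_cst.
  by apply: measurable_funM => //; exact: measurable_indic.
- have N : {ae leb, forall y, y <> a /\ y <> b}.
    exists ([set a] `|` [set b]); split.
    + exact: measurableU.
    + by rewrite null_set_setU//; exact: lebesgue_measure_set1.
    + by move=> y /= /not_andP[|] /contrapT ->; [left|right].
  apply: (ae_imply N) => y [ya yb] _; apply: ccvgMl; apply: ccvg_real.
  rewrite indicE mem_setE in_itv/= -mulrA; apply: cvgM; first exact: cvg_cst.
  have [ay|ay|/esym/ya[]] := ltrgtP a y; last first.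
    have ay' : a - y > 0 by rewrite subr_gt0.
    have by' : b - y > 0 by rewrite subr_gt0 (lt_trans ay).
    rewrite /= mulr0 -(subrr (pi / 2)).
    by apply: cvgB; exact: cvg_atan_scaled.
  have ay' : a - y < 0 by rewrite subr_lt0.
  have [yb'|yb'|/yb[]] := ltrgtP y b.
    rewrite /= mulr1 [X in _ --> X](_ : _ = pi / 2 - (- (pi / 2))); last by field.
    apply: cvgB; last exact: cvg_atan_scaled_neg.
    by apply: cvg_atan_scaled; rewrite subr_gt0.
  rewrite /= mulr0 -(subrr (- (pi / 2))).
  by apply: cvgB; apply: cvg_atan_scaled_neg => //; rewrite subr_lt0.
- rewrite (_ : _ \o _ = (fun y => (2 * pi)%:E * (cmod (f y))%:E)%E); last first.
    by apply/funext => y; rewrite /= EFinM.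
  by apply: integrableZl => //; exact: cintegrable_cmod.
- apply: aeW => y n _; rewrite cmodM mulrC ler_wpM2r ?cmod_ge0// cmod_real.
  rewrite normrM ger0_norm// ler_pM2l// (le_trans (ler_normB _ _))//.
  by rewrite [leRHS](splitr pi) lerD.
Qed.

(** Fourier inversion: both sides have the same integral over every bounded
    interval, as is seen by integrating the Abel means explicitly. *)
Theorem fourier_inversion :
  {ae leb, forall t, f t = real_complex R (2 * pi)^-1 *
     cintegral setT (fun x => expi (t * x) * fourier_transform f x)}.
Proof.
have p0 : 2 * pi != 0 :> R by rewrite mulf_neq0// gt_eqF// pi_gt0.
have mh' : cmeasurable setT (fun t => real_complex R (2 * pi)^-1 * h t).
  by apply: cmeasurableM => //; exact: cmeasurable_cst.
apply: (itv_cintegral_ae (h := fun t => real_complex R (2 * pi)^-1 * h t)) => //.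
- by move=> a b; exact: cintegrable_sub.
- exact: cintegrable_cmeasurable.
- move=> a b; apply: (@cintegrable_bounded _ _ ((2 * pi)^-1 * \int[leb]_x cmod (fh x))) => // x.
  rewrite cmodM cmod_real ger0_norm ?invr_ge0 ?mulr_ge0 ?pi_ge0//.
  by rewrite ler_wpM2l// invr_ge0 mulr_ge0// pi_ge0.
move=> a b ab.
have ih : cintegrable `[a, b] h by exact: cintegrable_bounded.
have L2 := lim2 ab.
have L1 := lim1 a b.
have := ccvg_unique L1; under eq_fun do rewrite (A_itv _ ab).
move=> /(_ _ L2) hE.
rewrite cintegralZ// hE cintegral_mkcond.
have i1 : cintegrable setT (fun x => real_complex R (\1_`[a, b]%classic x) * f x).
  apply: (@cintegrableMb _ _ _ _ 1) => //.
    exact: cintegrable_cmeasurable (cintegrable_indic a b).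
  by move=> x _; rewrite cmod_real indicE; case: (_ \in _); rewrite ?normr1 ?normr0.
transitivity (real_complex R (2 * pi)^-1 * (real_complex R (2 * pi) *
    cintegral setT (fun x => real_complex R (\1_`[a, b]%classic x) * f x))).
  rewrite mulrA [X in X * _](_ : _ = 1) ?mul1r//.
  by rewrite -rmorphM mulVf ?rmorph1.
congr (_ * _); rewrite -cintegralZ//; apply: eq_cintegral => x _.
by rewrite (rmorphM (real_complex R) (2 * pi)) mulrA [RHS]mulrC.
Qed.

Let hE : {ae leb, forall t, f t = real_complex R (2 * pi)^-1 * h t} := fourier_inversion.

Let pi20 : 0 <= (2 * pi)^-1 :> R.
Proof. by rewrite invr_ge0 mulr_ge0// pi_ge0. Qed.

Let mh' : cmeasurable setT (fun t => real_complex R (2 * pi)^-1 * h t).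
Proof. by apply: cmeasurableM => //; exact: cmeasurable_cst. Qed.

Let ihg g : cintegrable setT g ->
  cintegrable setT (fun t => (real_complex R (2 * pi)^-1 * h t) * g t).
Proof.
apply: (@cintegrableMb _ _ _ _ ((2 * pi)^-1 * \int[leb]_x cmod (fh x))) => // x _.
by rewrite cmodM cmod_real ger0_norm// ler_wpM2l.
Qed.

Lemma ae_eq_cintegrable (g1 g2 : R -> R[i]) : cmeasurable setT g1 ->
  {ae leb, forall t, g1 t = g2 t} -> cintegrable setT g2 -> cintegrable setT g1.
Proof.
move=> m1 g12 /(cintegrableP _ measurableT)[m2 i2]; apply/cintegrableP => //; split=> //.
rewrite (_ : (\int[leb]_x _)%E = (\int[leb]_x (cmod (g2 x))%:E)%E)//.
apply: ge0_ae_eq_integral => //.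
- exact/measurable_EFinP/cmeasurable_cmod.
- exact/measurable_EFinP/cmeasurable_cmod.
- by move=> x _; rewrite lee_fin cmod_ge0.
- by move=> x _; rewrite lee_fin cmod_ge0.
- by apply: (ae_imply g12) => x -> .
Qed.

(** By inversion f is almost everywhere equal to a bounded function. *)
Lemma cintegrable_fourierM g : cintegrable setT g -> cintegrable setT (fun t => f t * g t).
Proof.
move=> gi; apply: (ae_eq_cintegrable _ _ (ihg gi)).
  by apply: cmeasurableM; exact: cintegrable_cmeasurable.
by apply: (ae_imply hE) => t ->.
Qed.

(** Insert the inversion formula for f and exchange the integrals. *)
Lemma fourier_transformM g tau : cintegrable setT g ->
  fourier_transform (fun t => f t * g t) tau =
  real_complex R (2 * pi)^-1 *
  cintegral setT (fun x => fourier_transform g (tau - x) * fh x).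
Proof.
move=> gi; have fgi := cintegrable_fourierM gi.
have mlin (c : R) : measurable_fun setT (fun t : R => - (t * c)).
  by apply: measurableT_comp => //; exact: measurable_funM.
pose K (z : R * R) := expi (z.1 * z.2).
have mK : cmeasurable setT K.
  apply: cmeasurable_expi; apply: measurable_funM; [exact: measurable_fst|exact: measurable_snd].
have K1 z : cmod (K z) <= 1 by rewrite cmod_expi.
have ia : cintegrable setT (fun t => real_complex R (2 * pi)^-1 * (expi (- (t * tau)) * g t)).
  by apply: cintegrableZ => //; exact: cintegrable_expi.
transitivity (cintegral setT (fun t => (real_complex R (2 * pi)^-1 * (expi (- (t * tau)) * g t)) *
   cintegral setT (fun x => K (t, x) * fh x))).
  apply: ae_eq_cintegral => //.
  - by apply: cintegrable_cmeasurable; exact: cintegrable_expi.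
  - by apply: cintegrable_cmeasurable; exact: (cintegrable_kernel mK K1).
  - apply: (ae_imply hE) => t -> _; rewrite -/(h t).
    rewrite mulrA [X in X * g t]mulrCA; rewrite -!mulrA; congr (_ * (_ * _)); exact: mulrC.
rewrite (cFubini_kernel mK K1 ia fhi) -cintegralZ//; last first.
  have igm x : cintegrable setT (fun t => expi (- (t * (tau - x))) * g t).
    exact: cintegrable_expi.
  apply: (@cintegrableMb _ _ _ _ (\int[leb]_x cmod (g x))) => //.
    apply: (cmeasurable_comp (cmeasurable_fourier_transform gi)).
    exact: measurable_funB.
  by move=> x _; exact: cmod_fourier_transform.
apply: eq_cintegral => x _; rewrite [RHS]mulrA [RHS]mulrC; congr (_ * _).
rewrite -cintegralZ//; last exact: cintegrable_expi.
apply: eq_cintegral => t _; rewrite mulrCA; congr (_ * _).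
rewrite mulrA -expiD; congr (expi _ * _); rewrite /=; ring.
Qed.

Lemma cmod_fourier_transformM g tau : cintegrable setT g ->
  ((cmod (fourier_transform (fun t => f t * g t)%R tau))%:E <=
  ((2 * pi)^-1)%:E *
  \int[leb]_x (cmod (fh x) * cmod (fourier_transform g (tau - x)))%:E)%E.
Proof.
move=> gi; rewrite fourier_transformM// cmodM cmod_real ger0_norm// EFinM.
apply: lee_wpmul2l => //.
have igf : cintegrable setT (fun x => fourier_transform g (tau - x) * fh x).
  apply: (@cintegrableMb _ _ _ _ (\int[leb]_x cmod (g x))) => //.
    apply: (cmeasurable_comp (cmeasurable_fourier_transform gi)).
    exact: measurable_funB.
  by move=> x _; exact: cmod_fourier_transform.
rewrite (le_trans (EFin_cmod_cintegral _ igf))// le_eqVlt; apply/orP; left; apply/eqP.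
by apply: eq_integral => x _; rewrite cmodM mulrC.
Qed.

(** Half of the Plancherel identity, obtained from the product formula applied
    to a function and its conjugate at frequency 0. *)
Lemma plancherel_le :
  (\int[leb]_t (cmod (f t) ^+ 2)%:E <=
  ((2 * pi)^-1)%:E * \int[leb]_x (cmod (fh x) ^+ 2)%:E)%E.
Proof.
have fJi := cintegrableJ fi.
have fJt x : fourier_transform (fun t => conjc (f t)) x = conjc (fh (- x)).
  exact: fourier_transformJ.
have := cmod_fourier_transformM 0 fJi.
under [X in (_ <= _ * X)%E]eq_integral do rewrite fJt cmodJ sub0r opprK -expr2.
apply: le_trans.
have -> : fourier_transform (fun t => f t * conjc (f t)) 0 =
    cintegral setT (fun t => real_complex R (cmod (f t) ^+ 2)).
  apply: eq_cintegral => t _; rewrite mulr0 oppr0 expi0 mul1r cmod_sqr.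
  by case: (f t) => x y; apply: cplxP => /=; ring.
have : cintegrable setT (fun t => real_complex R (cmod (f t) ^+ 2)).
  have := cintegrable_fourierM fJi; rewrite (_ : (fun t => f t * _) = (fun t => real_complex R (cmod (f t) ^+ 2)))//.
  apply/funext => t; rewrite cmod_sqr.
  by case: (f t) => x y; apply: cplxP => /=; ring.
move=> [i1 _].
have -> : (\int[leb]_t (cmod (f t) ^+ 2)%:E = (\int[leb]_t (cmod (f t) ^+ 2))%:E)%E.
  by rewrite /Rintegral fineK//; exact: integrable_fin_num.
rewrite lee_fin (le_trans _ (Re_le_cmod _))// /= ger0_norm//.
by apply: Rintegral_ge0 => t _; rewrite sqr_ge0.
Qed.

End inversion.
End Inversion.

(** * Fejer means and Fourier coefficients of products *)

Section Chord.
Context {R : realType}.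
Implicit Types x y : R.

Lemma cos_le_homo x y : 0 <= x -> x <= y -> y <= pi / 2 -> cos y <= cos x.
Proof.
move=> x0 xy yp; have p0 := pi_gt0 R.
have yp' : y <= pi by rewrite (le_trans yp)// ler_pdivrMr// mulr_natr mulr2n lerDl ltW.
by rewrite leNgt ltr_cos ?in_itv/= ?x0 ?yp' ?(le_trans xy)// ?(le_trans x0)// -leNgt.
Qed.

(** The mean value theorem, the cosine being decreasing on this interval. *)
Lemma mulr_cos_le_sin x : 0 <= x -> x <= pi / 2 -> x * cos x <= sin x.
Proof.
move=> x0 xp; have [c cxy E] : exists2 c, c \in `[0, x] & sin x - sin 0 = cos c * (x - 0).
  apply: (MVT_segment (f := @sin R) (df := cos) x0).
  by apply: continuous_subspaceT; exact: continuous_sin.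
rewrite sin0 !subr0 in E; rewrite E mulrC ler_wpM2r//.
by move: cxy; rewrite in_itv/= => /andP[c0 cx]; exact: cos_le_homo.
Qed.

Lemma cmod_expi_sub1 x : cmod (expi x - 1) = 2 * `|sin (x / 2)|.
Proof.
apply/eqP; rewrite -(@eqrXn2 _ 2)// ?cmod_ge0// ?mulr_ge0//; apply/eqP.
rewrite cmod_sqr ReD ImD ReN ImN /= oppr0 addr0 exprMn real_normK ?num_real//.
have E : cos x = 1 - 2 * sin (x / 2) ^+ 2.
  have -> : cos x = cos (x / 2 *+ 2) by rewrite -mulr_natr mulfVK.
  rewrite cos_mulr2n; have := cos2Dsin2 (x / 2) => h.
  have -> : cos (x / 2) ^+ 2 = 1 - sin (x / 2) ^+ 2 by apply/eqP; rewrite eq_sym subr_eq h.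
  by rewrite -mulr_natr; ring.
have -> : sin x ^+ 2 = 1 - cos x ^+ 2 by rewrite -(cos2Dsin2 x) addrC addKr.
rewrite E; ring.
Qed.

(** Away from the far end of the period the chord is comparable to the arc. *)
Lemma chord_ge (r x : R) : r < pi -> `|x| <= 2 * r ->
  `|x| * cos (r / 2) ^+ 2 <= cmod (expi x - 1).
Proof.
move=> rp xr; rewrite cmod_expi_sub1.
have p0 := pi_gt0 R.
have r0 : 0 <= r by rewrite -(@pmulr_rge0 _ 2)// (le_trans _ xr).
pose y := `|x| / 2 / 2.
have y0 : 0 <= y by rewrite !divr_ge0.
have yr : y <= r / 2 by rewrite ler_pM2r// ler_pdivrMr// mulrC.
have rp2 : r / 2 <= pi / 2 by rewrite ler_pM2r// ltW.
have yp := le_trans yr rp2.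
have c0 : 0 <= cos (r / 2) by apply: cos_ge0_pihalf; rewrite rp2 (le_trans _ (le_trans y0 yr))// oppr_le0 divr_ge0// ltW.
have -> : `|sin (x / 2)| = `|sin (y *+ 2)|.
  have -> : y *+ 2 = `|x| / 2 by rewrite -mulr_natr mulfVK.
  by have [x0|x0] := ger0P x => //; rewrite mulNr sinN normrN.
rewrite sin_mulr2n.
have h1 := mulr_cos_le_sin y0 yp.
have h2 := cos_le_homo y0 yr rp2.
have cy0 := le_trans c0 h2.
have xy : `|x| = 4 * y by rewrite /y; field.
have s0 : 0 <= sin y by rewrite (le_trans _ h1)// mulr_ge0.
rewrite [`|_ *+ 2|]ger0_norm; last by rewrite mulrn_wge0// mulr_ge0.
rewrite xy -[cos y * sin y *+ 2]mulr_natr.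
have : y * cos (r / 2) ^+ 2 <= cos y * sin y.
  rewrite (le_trans (_ : _ <= cos y * (y * cos y)))//; last by rewrite ler_wpM2l.
  by rewrite [leRHS]mulrCA ler_wpM2l// -expr2 lerXn2r// nnegrE.
move=> h; rewrite (_ : 4 * y * cos (r / 2) ^+ 2 = 4 * (y * cos (r / 2) ^+ 2)); last by ring.
rewrite (_ : 2 * (cos y * sin y * 2) = 4 * (cos y * sin y)); last by ring.
by rewrite ler_wpM2l.
Qed.

Lemma expi_2pi (n : int) : expi (2 * pi * n%:~R) = 1 :> R[i].
Proof.
have h (k : nat) : expi (2 * pi * k%:R) = 1 :> R[i].
  elim: k => [|k IH]; first by rewrite mulr0 expi0.
  rewrite -(natr1 k) mulrDr expiD IH mul1r mulr1 /expi.
  have -> : 2 * pi = 0 + pi *+ 2 :> R by rewrite add0r mulr_natl.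
  by rewrite cosD2pi sinD2pi cos0 sin0.
case: n => n; first exact: h.
by rewrite NegzE mulrNz mulrN -conjc_expi -pmulrn h conjc1.
Qed.

Lemma dist_le_max x x0 y : 0 <= x -> x <= y -> `|x - x0| <= Num.max x0 (y - x0).
Proof.
move=> x1 xy; rewrite le_max; have [xx|xx] := leP x x0.
  by apply/orP; left; rewrite ler0_norm; lra.
by apply/orP; right; rewrite ger0_norm; lra.
Qed.

End Chord.

Section Fejer.
Context {R : realType}.

Definition cesaro_mean (z : nat -> R[i]) (M : nat) : R[i] :=
  real_complex R M.+1%:R^-1 * \sum_(0 <= N < M.+1) \sum_(0 <= k < N.*2.+1) z k.

Lemma cmod_cesaro_mean (z : nat -> R[i]) (B : R) M :
  (forall N, \sum_(0 <= k < N) cmod (z k) <= B) -> cmod (cesaro_mean z M) <= B.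
Proof.
move=> zB; rewrite cmodM cmod_real ger0_norm ?invr_ge0// ler_pdivrMl//.
rewrite (le_trans (cmod_sum _ _ _))// (le_trans (y := \sum_(0 <= N < M.+1) B))//.
  by apply: ler_sum => N _; rewrite (le_trans (cmod_sum _ _ _)).
by rewrite sumr_const_nat subn0 mulr_natl.
Qed.

Local Notation leb := (@lebesgue_measure R).
Variable L : R.
Hypothesis L0 : 0 < L.

Definition wave (n : int) (x : R) : R[i] := expi (2 * pi * n%:~R * x / L).

Lemma wave0 x : wave 0 x = 1.
Proof. by rewrite /wave mulr0 !mul0r expi0. Qed.

Lemma waveD n m x : wave (n + m) x = wave n x * wave m x.
Proof. by rewrite /wave -expiD intrD; congr expi; ring. Qed.

Lemma waveDx n x y : wave n (x + y) = wave n x * wave n y.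
Proof. by rewrite /wave -expiD; congr expi; ring. Qed.

Lemma wave_conj n x : conjc (wave n x) = wave (- n) x.
Proof. by rewrite /wave conjc_expi mulrNz; congr expi; ring. Qed.

Lemma waveNx n x : wave n (- x) = wave (- n) x.
Proof. by rewrite /wave mulrNz; congr expi; ring. Qed.

Lemma cmod_wave n x : cmod (wave n x) = 1.
Proof. exact: cmod_expi. Qed.

Lemma fourier_coefE f n :
  fourier_coef L f n = real_complex R L^-1 * cintegral `[0, L] (fun x => wave (- n) x * f x).
Proof.
rewrite /fourier_coef; congr (_ * _); apply: eq_cintegral => x _; congr (expi _ * _).
by rewrite mulrNz; ring.
Qed.

Definition ccontinuous (f : R -> R[i]) : Prop :=
  continuous (fun x => complex.Re (f x)) /\ continuous (fun x => complex.Im (f x)).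

Lemma ccontinuousM f g : ccontinuous f -> ccontinuous g ->
  ccontinuous (fun x => f x * g x).
Proof.
move=> [f1 f2] [g1 g2]; split.
  under eq_fun do rewrite ReM.
  by move=> x; apply: cvgB; apply: cvgM; [exact: f1|exact: g1|exact: f2|exact: g2].
under eq_fun do rewrite ImM.
by move=> x; apply: cvgD; apply: cvgM; [exact: f1|exact: g2|exact: f2|exact: g1].
Qed.

Lemma ccontinuousD f g : ccontinuous f -> ccontinuous g ->
  ccontinuous (fun x => f x + g x).
Proof.
move=> [f1 f2] [g1 g2]; split.
  under eq_fun do rewrite ReD.
  by move=> x; apply: cvgD; [exact: f1|exact: g1].
under eq_fun do rewrite ImD.
by move=> x; apply: cvgD; [exact: f2|exact: g2].
Qed.

Lemma ccontinuous_cst c : ccontinuous (cst c).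
Proof. by split=> x; exact: cvg_cst. Qed.

Lemma ccontinuous_sum I (r : seq I) (f : I -> R -> R[i]) :
  (forall i, ccontinuous (f i)) -> ccontinuous (fun x => \sum_(i <- r) f i x).
Proof.
move=> cf; elim: r => [|i r IH].
  by under eq_fun do rewrite big_nil; exact: ccontinuous_cst.
by under eq_fun do rewrite big_cons; exact: ccontinuousD.
Qed.

Lemma ccontinuous_expi (p : R -> R) : continuous p -> ccontinuous (fun x => expi (p x)).
Proof.
move=> cp; split => x.
  by apply: (continuous_comp (f := p) (g := cos)); [exact: cp|exact: continuous_cos].
by apply: (continuous_comp (f := p) (g := sin)); [exact: cp|exact: continuous_sin].
Qed.

Lemma ccontinuous_wave n : ccontinuous (wave n).
Proof.
apply: ccontinuous_expi => x; apply: cvgM; last exact: cvg_cst.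
by apply: cvgM; [exact: cvg_cst|exact: cvg_id].
Qed.

Lemma ccontinuous_comp_sub f x0 : ccontinuous f -> ccontinuous (fun x => f (x0 - x)).
Proof.
have cs : continuous (fun x : R => x0 - x) by move=> x; apply: cvgB; [exact: cvg_cst|exact: cvg_id].
move=> [f1 f2]; split => x.
  by apply: (continuous_comp (f := fun x => x0 - x) (g := fun x => complex.Re (f x))); [exact: cs|exact: f1].
by apply: (continuous_comp (f := fun x => x0 - x) (g := fun x => complex.Im (f x))); [exact: cs|exact: f2].
Qed.

Lemma ccontinuous_cintegrable f a b : ccontinuous f -> cintegrable `[a, b] f.
Proof.
move=> [f1 f2]; split; apply: continuous_compact_integrable;
  by [exact: segment_compact|exact: continuous_subspaceT].
Qed.

Lemma ccontinuous_bounded f : ccontinuous f ->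
  exists2 B, 0 <= B & forall x, x \in `[0, L] -> cmod (f x) <= B.
Proof.
move=> [f1 f2].
have h (p : R -> R) : continuous p -> exists2 B, 0 <= B & forall x, x \in `[0, L] -> `|p x| <= B.
  move=> cp; have ca : continuous (fun x => `|p x|).
    by move=> x; apply: (continuous_comp (f := p)); [exact: cp|exact: norm_continuous].
  have [c _ cM] := EVT_max (ltW L0) (continuous_subspaceT (A := `[0, L]) ca).
  by exists `|p c|.
have [B1 B10 b1] := h _ f1; have [B2 B20 b2] := h _ f2.
exists (B1 + B2); first exact: addr_ge0.
by move=> x x0; rewrite (le_trans (cmod_le _))// lerD// ?b1 ?b2.
Qed.

Lemma integral_wave n : n != 0 -> cintegral `[0, L] (wave n) = 0.
Proof.
move=> n0; have p0 := pi_gt0 R.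
pose k : R := 2 * pi * n%:~R / L.
have k0 : k != 0.
  by rewrite /k !mulf_neq0// ?invr_eq0 ?(gt_eqF L0)// ?(gt_eqF p0)// intr_eq0.
have wE x : wave n x = expi (k * x) by rewrite /wave /k; congr expi; ring.
have dlin (x : R) : is_derive x 1 (fun x : R => k * x) k.
  by have := is_deriveZ k (is_derive_id x (1 : R)); rewrite /GRing.scale/= mulr1.
have kL : k * L = 2 * pi * n%:~R by rewrite /k mulfVK// gt_eqF.
have [c1 c2] := @ccontinuous_expi ( *%R k) (@mulrl_continuous _ k).
have e1 := expi_2pi (R := R) n; rewrite -kL in e1.
rewrite (@eq_cintegral _ _ _ (fun x => expi (k * x))); last by move=> x _; exact: wE.
apply: cplxP => /=.
  have D (x : R) : is_derive x 1 (fun x => k^-1 * sin (k * x)) (cos (k * x)).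
    have := is_deriveZ k^-1 (is_derive1_comp (is_derive_sin (k * x)) (dlin x)).
    by rewrite /GRing.scale/= mulrCA mulVf// mulr1.
  rewrite (FTC2_is_derive L0 D c1).
  have /= -> := congr1 (@complex.Im R) e1.
  by rewrite !mulr0 sin0 mulr0 subrr.
have D (x : R) : is_derive x 1 (fun x => - k^-1 * cos (k * x)) (sin (k * x)).
  have := is_deriveZ (- k^-1) (is_derive1_comp (is_derive_cos (k * x)) (dlin x)).
  by rewrite /GRing.scale/= (_ : - k^-1 * _ = sin (k * x))//; field.
rewrite (FTC2_is_derive L0 D c2).
have /= -> := congr1 (@complex.Re R) e1.
by rewrite !mulr0 cos0 subrr.
Qed.

Definition dirichlet (N : nat) (x : R) : R[i] :=
  \sum_(0 <= k < N.*2.+1) wave (zig k) x.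

Definition fejer (M : nat) (x : R) : R :=
  cmod (\sum_(0 <= j < M) wave j%:Z x) ^+ 2 / M%:R.

Lemma dirichletS N x : dirichlet N.+1 x =
  dirichlet N x + (wave (- N.+1%:Z) x + wave N.+1%:Z x).
Proof.
rewrite /dirichlet doubleS !big_nat_recr//= addrA; congr (_ + wave _ x + wave _ x).
  by rewrite /zig /= odd_double /= uphalf_double NegzE.
by rewrite /zig -doubleS odd_double doubleK.
Qed.

Lemma dirichletE N x : dirichlet N x =
  1 + (wave (- N%:Z) x * (\sum_(0 <= j < N) wave j%:Z x)
  + wave N%:Z x * conjc (\sum_(0 <= j < N) wave j%:Z x)).
Proof.
elim: N => [|N IH].
  by rewrite /dirichlet big_nat1 /zig /= wave0 !big_geq// conjc0 !mulr0 !addr0.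
have S (c : int) : \sum_(0 <= j < N.+1) wave j%:Z x =
    1 + wave 1 x * \sum_(0 <= j < N) wave j%:Z x.
  rewrite big_nat_recl// wave0; congr (_ + _).
  by rewrite big_distrr; apply: eq_bigr => j _ /=; rewrite -waveD -addn1 PoszD addrC.
rewrite dirichletS IH (S 0) conjcD conjcM conjc1 wave_conj.
have -> : (N.+1%:Z = N%:Z + 1)%R by rewrite -addn1 PoszD.
set B := \sum_(0 <= _ < N) _.
rewrite opprD !waveD.
have w1 : wave (-1) x * wave 1 x = 1 by rewrite -waveD addNr wave0.
move: (wave (-1) x) (wave 1 x) w1 (wave (- N%:Z) x) (wave N%:Z x) (conjc B) => u v uv p q b.
rewrite -!addrA; congr (1 + _).
rewrite !mulrDr !mulr1 -!mulrA [u * (v * B)]mulrA uv mul1r.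
by rewrite [v * (u * b)]mulrA [v * u]mulrC uv mul1r; ring.
Qed.

(** The squared modulus of a geometric sum, expanded one term at a time, collects
    the Dirichlet kernels; this form shows that the kernel is nonnegative. *)
Lemma fejerE M x : real_complex R (fejer M x) =
  real_complex R M%:R^-1 * \sum_(0 <= N < M) dirichlet N x.
Proof.
rewrite /fejer mulrC (rmorphM (real_complex R)) /=; congr (_ * _).
have sqE z : real_complex R (cmod z ^+ 2) = z * conjc z.
  by rewrite cmod_sqr; case: z => u v; apply: cplxP => /=; ring.
rewrite sqE; elim: M => [|M IH]; first by rewrite !big_geq// mul0r.
rewrite !big_nat_recr//= -IH dirichletE conjcD wave_conj.
set B := \sum_(0 <= _ < M) _.
have w1 : wave (- M%:Z) x * wave M%:Z x = 1 by rewrite -waveD addNr wave0.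
rewrite mulrDr !mulrDl -addrA; congr (_ + _).
by rewrite [wave M%:Z x * wave _ x]mulrC w1 [B * _]mulrC; ring.
Qed.

Lemma fejer_ge0 M x : 0 <= fejer M x.
Proof. by rewrite divr_ge0// sqr_ge0. Qed.

Lemma geometric_wave M x :
  cmod (\sum_(0 <= j < M) wave j%:Z x) * cmod (wave 1 x - 1) <= 2.
Proof.
rewrite -cmodM; have -> : (\sum_(0 <= j < M) wave j%:Z x) * (wave 1 x - 1) = wave M%:Z x - 1.
  elim: M => [|M IH]; first by rewrite big_geq// mul0r wave0 subrr.
  rewrite big_nat_recr//= mulrDl IH mulrBr mulr1 -waveD -addn1 PoszD.
  by rewrite addrC subrKA.
by rewrite (le_trans (cmodB _ _))// cmod_wave cmod1.
Qed.

Lemma cmod_sum_wave M x : cmod (\sum_(0 <= j < M) wave j%:Z x) <= M%:R.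
Proof.
rewrite (le_trans (cmod_sum _ _ _))//.
under eq_bigr do rewrite cmod_wave.
by rewrite sumr_const_nat subn0.
Qed.

(** Of the two factors of the square, one is estimated by its number of terms and
    one by the geometric formula: this bound, uniform in M, provides the
    dominating function in Fejer's theorem, and fejer_decay the pointwise limit. *)
Lemma fejer_le M x : fejer M x * cmod (wave 1 x - 1) <= 2.
Proof.
case: M => [|M]; first by rewrite /fejer invr0 mulr0 mul0r.
rewrite /fejer expr2 -mulrA mulrAC -!mulrA [leLHS]mulrA.
have := geometric_wave M.+1 x; have := cmod_sum_wave M.+1 x.
set A := cmod _; set B := cmod _ => AM AB.
have A0 : 0 <= A := cmod_ge0 _.
rewrite (_ : _ * _ = (A / M.+1%:R) * (A * B)); last by ring.
rewrite -[leRHS]mul1r ler_pM// ?divr_ge0// ?mulr_ge0 ?cmod_ge0//.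
by rewrite ler_pdivrMr// mul1r.
Qed.

Lemma fejer_decay M x : fejer M x * cmod (wave 1 x - 1) ^+ 2 <= 4 / M%:R.
Proof.
rewrite /fejer mulrAC -exprMn ler_wpM2r ?invr_ge0//.
have := geometric_wave M x; set z := _ * _ => z2.
rewrite (_ : 4 = 2 ^+ 2); last by ring.
by rewrite lerXn2r// nnegrE// mulr_ge0// cmod_ge0.
Qed.

Lemma ccontinuous_fejer M : ccontinuous (fun x => real_complex R (fejer M x)).
Proof.
under [X in ccontinuous X]eq_fun do rewrite fejerE.
apply: ccontinuousM; first exact: ccontinuous_cst.
apply: ccontinuous_sum => N; apply: ccontinuous_sum => k.
exact: ccontinuous_wave.
Qed.

Lemma wave_sub n x0 x : wave n (x0 - x) = wave n x0 * wave (- n) x.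
Proof. by rewrite waveDx waveNx. Qed.

Definition cesaro_sum (f : R -> R[i]) (M : nat) (x : R) : R[i] :=
  real_complex R M%:R^-1 * \sum_(0 <= N < M) \sum_(0 <= k < N.*2.+1)
    fourier_coef L f (zig k) * wave (zig k) x.

Lemma cesaro_sumE f M x0 : ccontinuous f -> cesaro_sum f M x0 =
  real_complex R L^-1 *
  cintegral `[0, L] (fun x => real_complex R (fejer M (x0 - x)) * f x).
Proof.
move=> cf; have iw n : cintegrable `[0, L] (fun x => wave n (x0 - x) * f x).
  apply: ccontinuous_cintegrable; apply: ccontinuousM => //.
  exact/(ccontinuous_comp_sub (f := wave n))/ccontinuous_wave.
rewrite (@eq_cintegral _ _ _ (fun x => real_complex R M%:R^-1 *
    \sum_(0 <= N < M) \sum_(0 <= k < N.*2.+1) wave (zig k) (x0 - x) * f x)); last first.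
  move=> x _; rewrite fejerE -mulrA; congr (_ * _); rewrite big_distrl.
  by apply: eq_bigr => N _; rewrite big_distrl.
rewrite cintegralZ//; last first.
  by apply: cintegrable_sum => // N; apply: cintegrable_sum.
rewrite mulrCA; congr (_ * _); rewrite cintegral_sum//; last first.
  by move=> N; apply: cintegrable_sum.
rewrite big_distrr; apply: eq_bigr => N _; rewrite cintegral_sum//.
rewrite big_distrr; apply: eq_bigr => k _.
rewrite fourier_coefE -mulrA; congr (_ * _); rewrite mulrC -cintegralZ//; last first.
  by apply: ccontinuous_cintegrable; apply: ccontinuousM => //; exact: ccontinuous_wave.
by apply: eq_cintegral => x _; rewrite wave_sub mulrA.
Qed.

Lemma fourier_coef_cst c n : fourier_coef L (cst c) n = if n == 0 then c else 0.
Proof.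
rewrite fourier_coefE.
rewrite (@eq_cintegral _ _ _ (fun x => c * wave (- n) x)); last by move=> x _; rewrite mulrC.
rewrite cintegralZ//; last by apply: ccontinuous_cintegrable; exact: ccontinuous_wave.
have [->|n0] := eqVneq n 0; last by rewrite integral_wave ?oppr_eq0// !mulr0.
rewrite (@eq_cintegral _ _ _ (fun=> 1)); last by move=> x _; rewrite oppr0 wave0.
have -> : cintegral `[0, L] (fun=> 1) = real_complex R L.
  apply: cplxP => /=; rewrite Rintegral_cst//= ?lebesgue_measure_itv/= ?lte_fin ?L0.
  - by rewrite -EFinB subr0 mul1r.
  - by rewrite -EFinB mul0r.
by rewrite mulrCA -rmorphM mulVf ?gt_eqF// rmorph1 mulr1.
Qed.

Lemma cesaro_sum_cst c M x : (0 < M)%N -> cesaro_sum (cst c) M x = c.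
Proof.
move=> M0; rewrite /cesaro_sum (eq_bigr (fun=> c)).
  rewrite sumr_const_nat subn0 -[c *+ M]mulr_natr mulrCA.
  have -> : M%:R = real_complex R M%:R by rewrite rmorph_nat.
  by rewrite -rmorphM mulVf ?rmorph1 ?mulr1// pnatr_eq0 -lt0n.
move=> N _; rewrite big_nat_recl// big1 ?addr0.
  by rewrite fourier_coef_cst /= wave0 mulr1.
move=> k _; rewrite fourier_coef_cst.
have [z0|] := eqVneq; last by rewrite mul0r.
have [_ inj _] := zig_bij.
have : k.+1 = 0%N by apply: inj; rewrite ?inE.
by [].
Qed.

(** The Fejer kernel is nonnegative with mean 1, so a Cesaro sum is an average of
    values of f. *)
Lemma cmod_cesaro_sum f M x B : ccontinuous f -> (0 < M)%N ->
  (forall y, y \in `[0, L] -> cmod (f y) <= B) -> cmod (cesaro_sum f M x) <= B.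
Proof.
move=> cf M0 fB.
have ifj g : ccontinuous g -> cintegrable `[0, L] (fun y => real_complex R (fejer M (x - y)) * g y).
  move=> cg; apply: ccontinuous_cintegrable; apply: ccontinuousM => //.
  exact: (ccontinuous_comp_sub (f := fun y => real_complex R (fejer M y))) (ccontinuous_fejer M).
have := congr1 (@complex.Re R) (cesaro_sum_cst (real_complex R B) x M0).
rewrite cesaro_sumE; last exact: ccontinuous_cst.
rewrite Re_realM [complex.Re (real_complex R B)]/= => <-; rewrite cesaro_sumE//.
rewrite cmodM cmod_real ger0_norm ?invr_ge0 ?(ltW L0)// ler_wpM2l ?invr_ge0 ?(ltW L0)//.
rewrite (le_trans (cmod_cintegral _ _))//; first exact: ifj.
have [i1 _] := ifj (cst (real_complex R B)) (ccontinuous_cst _).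
apply: (@le_Rintegral _ _ _ leb `[0, L] _ _ _ _ i1) => //.
  by apply: cintegrable_cmod => //; exact: ifj.
move=> y yL; rewrite cmodM cmod_real ger0_norm ?fejer_ge0// Re_realM /=.
by rewrite ler_wpM2l ?fejer_ge0// fB.
Qed.

(** Fejer's theorem for Lipschitz functions, at interior points: after
    subtracting the value at [x0], the Fejer integrand is bounded and tends to 0
    away from [x0]. *)
Lemma cesaro_sum_cvg f K x0 : ccontinuous f -> 0 < x0 < L ->
  (forall x, x \in `[0, L] -> cmod (f x - f x0) <= K * `|x - x0|) ->
  ccvg (fun M => cesaro_sum f M.+1 x0) (f x0).
Proof.
move=> cf /andP[x00 x0L] fK; have p0 := pi_gt0 R.
have cf1 : ccontinuous (fun x => f x - f x0).
  by apply: ccontinuousD => //; exact: ccontinuous_cst.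
have cfej M : ccontinuous (fun x => real_complex R (fejer M (x0 - x))).
  exact: (ccontinuous_comp_sub (f := fun y => real_complex R (fejer M y))) (ccontinuous_fejer M).
have iF M : cintegrable `[0, L] (fun x => real_complex R (fejer M (x0 - x)) * (f x - f x0)).
  by apply: ccontinuous_cintegrable; exact: ccontinuousM.
have E M : cesaro_sum f M.+1 x0 - f x0 = real_complex R L^-1 *
   cintegral `[0, L] (fun x => real_complex R (fejer M.+1 (x0 - x)) * (f x - f x0)).
  rewrite -{1}(@cesaro_sum_cst (f x0) M.+1 x0)// !cesaro_sumE//; last exact: ccontinuous_cst.
  rewrite -mulrBr -cintegralB//.
  - by congr (_ * _); apply: eq_cintegral => x _; rewrite mulrBr.
  - by apply: ccontinuous_cintegrable; exact: ccontinuousM.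
  - by apply: ccontinuous_cintegrable; apply: ccontinuousM => //; exact: ccontinuous_cst.
(* The angle 2 pi (x0 - x) / L is at most 2 r in absolute value for x in the
   period, and r < pi because x0 is interior. *)
pose r := Num.max x0 (L - x0) * (pi / L).
have rp : r < pi.
  rewrite /r mulrA -mulrAC -[ltRHS]mul1r ltr_pM2r// ltr_pdivrMr// mul1r gt_max x0L/=.
  by rewrite ltrBlDr ltrDl.
pose c := (2 * pi / L) * cos (r / 2) ^+ 2.
have r0 : 0 < r by rewrite mulr_gt0// ?divr_gt0// lt_max x00.
have c0 : 0 < c.
  apply: mulr_gt0; first by rewrite divr_gt0// mulr_gt0.
  apply: exprn_gt0; apply: cos_gt0_pihalf.
  rewrite ltr_pM2r// rp andbT; apply: (@lt_trans _ _ 0); last by rewrite divr_gt0.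
  by rewrite oppr_lt0 divr_gt0.
have ch x : x \in `[0, L] -> c * `|x - x0| <= cmod (wave 1 (x0 - x) - 1).
  rewrite in_itv/= => /andP[x1 xL].
  have := @chord_ge _ r (2 * pi * 1%:~R * (x0 - x) / L) rp.
  rewrite -/(wave 1 (x0 - x)).
  have -> : `|2 * pi * 1%:~R * (x0 - x) / L| = 2 * pi / L * `|x - x0|.
    rewrite (_ : _ / L = (2 * pi / L) * (x0 - x)); last by ring.
    by rewrite normrM ger0_norm ?divr_ge0 ?mulr_ge0 ?(ltW p0) ?(ltW L0)// distrC.
  rewrite (_ : c * _ = 2 * pi / L * `|x - x0| * cos (r / 2) ^+ 2); last by rewrite /c mulrAC.
  apply; rewrite (_ : 2 * pi / L * _ = 2 * (`|x - x0| * (pi / L))); last by ring.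
  rewrite /r ler_pM2l// ler_pM2r ?divr_gt0//.
  exact: dist_le_max.
rewrite /ccvg; have -> : (fun M => cmod (cesaro_sum f M.+1 x0 - f x0)) =
    (fun M => L^-1 * cmod (cintegral `[0, L] (fun x => real_complex R (fejer M.+1 (x0 - x)) * (f x - f x0)))).
  by apply/funext => M; rewrite E cmodM cmod_real ger0_norm// invr_ge0 ltW.
have Z : L^-1 * 0 = 0 by rewrite mulr0.
rewrite -[X in _ --> X]Z; apply: cvgM; first exact: cvg_cst.
have := @dominated_ccvg R `[0, L] (fun M x => real_complex R (fejer M.+1 (x0 - x)) * (f x - f x0))
  (fun=> 0) (cst (2 * K / c)) _ _ _ _ _ _.
case => //.
- by move=> M; exact: cintegrable_cmeasurable.
- apply: aeW => x xL; rewrite /ccvg; under eq_fun do rewrite subr0.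
  have [->|xx0] := eqVneq x x0.
    by under eq_fun do rewrite [f x0 - _]subrr mulr0 cmod0; exact: cvg_cst.
  have w0 : 0 < cmod (wave 1 (x0 - x) - 1).
    by rewrite (lt_le_trans _ (ch _ xL))// mulr_gt0// normr_gt0 subr_eq0.
  have C : (4 * cmod (f x - f x0) / cmod (wave 1 (x0 - x) - 1) ^+ 2) / M.+1%:R @[M --> \oo] --> 0.
    rewrite -(mulr0 (4 * cmod (f x - f x0) / cmod (wave 1 (x0 - x) - 1) ^+ 2)).
    by apply: cvgM; [exact: cvg_cst|exact: cvg_harmonic].
  apply: (squeeze_cvgr _ (cvg_cst 0) C); near=> M.
  rewrite cmod_ge0/= cmodM cmod_real ger0_norm ?fejer_ge0//.
  have := fejer_decay M.+1 (x0 - x); rewrite -ler_pdivlMr ?exprn_gt0// => h.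
  rewrite (le_trans (ler_wpM2r (cmod_ge0 _) h))// le_eqVlt; apply/orP; left; apply/eqP.
  by ring.
- apply: continuous_compact_integrable; first exact: segment_compact.
  by apply: continuous_subspaceT => x; exact: cst_continuous.
- apply: aeW => x M xL; rewrite cmodM cmod_real ger0_norm ?fejer_ge0//=.
  have [->|xx0] := eqVneq x x0.
    rewrite [f x0 - _]subrr cmod0 mulr0 divr_ge0 ?(ltW c0)// mulr_ge0//.
    have := fK 0 _; rewrite in_itv/= lexx (ltW L0) => /(_ isT) h.
    have := le_trans (cmod_ge0 _) h; rewrite sub0r normrN gtr0_norm// pmulr_lge0//.
  have w0 : 0 < `|x - x0| by rewrite normr_gt0 subr_eq0.
  have h1 := ch _ xL; have h2 := fK _ xL; have h3 := fejer_le M.+1 (x0 - x).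
  have h4 : fejer M.+1 (x0 - x) * (c * `|x - x0|) <= 2.
    by rewrite (le_trans _ h3)// ler_wpM2l// fejer_ge0.
  have K0 : 0 <= K by rewrite -(pmulr_lge0 _ w0) (le_trans _ h2)// cmod_ge0.
  rewrite (le_trans (ler_wpM2l (fejer_ge0 _ _) h2))//.
  rewrite ler_pdivlMr// (_ : _ * c = K * (fejer M.+1 (x0 - x) * (c * `|x - x0|))); last by ring.
  by rewrite mulrC ler_wpM2r.
move=> _; rewrite /ccvg.
have -> : cintegral `[0, L] (fun=> (0 : R[i])) = 0.
  by apply: cplxP => /=; rewrite Rintegral_cst//= mul0r.
by under eq_fun do rewrite subr0.
Unshelve. all: by end_near. Qed.

(** Replace f by its Cesaro sums in the coefficient of f g: these sums are
    uniformly bounded, and converge to f except perhaps at the end points. *)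
Lemma fourier_coefM f g K n : ccontinuous f -> ccontinuous g ->
  (forall x y, x \in `[0, L] -> y \in `[0, L] -> cmod (f x - f y) <= K * `|x - y|) ->
  ccvg (cesaro_mean (fun k => fourier_coef L f (zig k) * fourier_coef L g (n - zig k)))
    (fourier_coef L (fun x => f x * g x) n).
Proof.
move=> cf cg fK; rewrite /cesaro_mean.
have [B B0 fB] := ccontinuous_bounded cf.
have iwg m : cintegrable `[0, L] (fun x => wave m x * g x).
  by apply: ccontinuous_cintegrable; apply: ccontinuousM => //; exact: ccontinuous_wave.
have E M : real_complex R M.+1%:R^-1 * \sum_(0 <= N < M.+1) \sum_(0 <= k < N.*2.+1)
         fourier_coef L f (zig k) * fourier_coef L g (n - zig k) =
    real_complex R L^-1 * cintegral `[0, L] (fun x => cesaro_sum f M.+1 x * (wave (- n) x * g x)).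
  have iz c m : cintegrable `[0, L] (fun x => c * (wave m x * g x)).
    exact: cintegrableZ.
  rewrite (@eq_cintegral _ _ (fun x => cesaro_sum f M.+1 x * _) (fun x => real_complex R M.+1%:R^-1 * \sum_(0 <= N < M.+1) \sum_(0 <= k < N.*2.+1)
     fourier_coef L f (zig k) * (wave (zig k - n) x * g x))); last first.
    move=> x _; rewrite /cesaro_sum -mulrA; congr (_ * _); rewrite big_distrl.
    apply: eq_bigr => N _; rewrite big_distrl; apply: eq_bigr => k _ /=.
    by rewrite -mulrA; congr (_ * _); rewrite mulrA waveD.
  rewrite cintegralZ//; last by apply: cintegrable_sum => // N; apply: cintegrable_sum.
  rewrite mulrCA; congr (_ * _); rewrite cintegral_sum//; last first.
    by move=> N; apply: cintegrable_sum.
  rewrite big_distrr; apply: eq_bigr => N _; rewrite cintegral_sum// big_distrr.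
  apply: eq_bigr => k _; rewrite cintegralZ//= [RHS]mulrCA; congr (_ * _).
  by rewrite fourier_coefE opprB.
have -> : (fun M => real_complex R M.+1%:R^-1 * \sum_(0 <= N < M.+1) \sum_(0 <= k < N.*2.+1)
         fourier_coef L f (zig k) * fourier_coef L g (n - zig k)) =
   (fun M => real_complex R L^-1 * cintegral `[0, L] (fun x => cesaro_sum f M.+1 x * (wave (- n) x * g x))).
  by apply/funext => M; exact: E.
rewrite fourier_coefE; apply: ccvgMl.
have ccs M : ccontinuous (cesaro_sum f M.+1).
  apply: ccontinuousM; first exact: ccontinuous_cst.
  apply: ccontinuous_sum => N; apply: ccontinuous_sum => k.
  by apply: ccontinuousM; [exact: ccontinuous_cst|exact: ccontinuous_wave].
have cwg : ccontinuous (fun x => wave (- n) x * g x).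
  by apply: ccontinuousM => //; exact: ccontinuous_wave.
have [Bg Bg0 gB] := ccontinuous_bounded cwg.
apply: (@dominated_ccvg R `[0, L] (fun M x => cesaro_sum f M.+1 x * (wave (- n) x * g x)) _ (cst (B * Bg)) _ _ _ _ _ _).2 => //.
- move=> M; apply: cintegrable_cmeasurable; apply: ccontinuous_cintegrable.
  exact: ccontinuousM.
- apply: cintegrable_cmeasurable; apply: ccontinuous_cintegrable.
  by apply: ccontinuousM; [exact: ccontinuous_wave|exact: ccontinuousM].
- have N : {ae leb, forall x : R, x <> 0 /\ x <> L}.
    exists ([set 0] `|` [set L]); split.
    + exact: measurableU.
    + by rewrite null_set_setU//; exact: lebesgue_measure_set1.
    + by move=> y /= /not_andP[|] /contrapT ->; [left|right].
  apply: (ae_imply N) => x [x0 xL]; rewrite /= in_itv/= => /andP[x0' xL'].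
  have xi : x \in `[0, L] by rewrite in_itv/= x0' xL'.
  have -> : (fun M => cesaro_sum f M.+1 x * (wave (- n) x * g x)) =
      (fun M => (wave (- n) x * g x) * cesaro_sum f M.+1 x).
    by apply/funext => M; rewrite mulrC.
  rewrite mulrCA [X in ccvg _ X]mulrC.
  apply: ccvgMl; apply: (@cesaro_sum_cvg f K) => //.
    by rewrite !lt_neqAle x0' xL' !andbT; apply/andP; split; apply/eqP => // /esym.
  by move=> y yi; exact: fK.
- apply: continuous_compact_integrable; first exact: segment_compact.
  by apply: continuous_subspaceT => x; exact: cst_continuous.
- apply: aeW => x M xL; rewrite /= cmodM ler_pM ?cmod_ge0//; last exact: gB.
  exact: cmod_cesaro_sum.
Qed.

End Fejer.

(** * Brackets and the resonance function *)

Section Bracket.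
Context {R : realType}.
Local Notation leb := (@lebesgue_measure R).
Implicit Types x y : R.

Lemma japanese_ge1 x : 1 <= japanese x.
Proof. by rewrite /japanese lerDl. Qed.

Lemma japanese_gt0 x : 0 < japanese x.
Proof. exact: lt_le_trans ltr01 (japanese_ge1 x). Qed.

Lemma japaneseN x : japanese (- x) = japanese x.
Proof. by rewrite /japanese normrN. Qed.

Lemma japaneseD_le x y : japanese (x + y) <= japanese x * japanese y.
Proof.
rewrite /japanese mulrDl mul1r mulrDr mulr1 -addrA lerD2l addrA.
by rewrite (le_trans (ler_normD _ _))// [leRHS](_ : _ = `|x| + `|y| + `|x| * `|y|) ?lerDl ?mulr_ge0//; ring.
Qed.

Variable p : R.
Hypothesis p1 : 1 < p.
Lemma powR_half : 2^-1 `^ (- p) = 2 `^ p :> R.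
Proof. by rewrite -[2^-1]powR_inv1// -powRrM mulrNN mul1r. Qed.

Let p0 : 0 < p. Proof. exact: lt_trans p1. Qed.

(** The integrable profile to which all the weights are compared. *)
Definition decay x : R := japanese x `^ (- p).

Lemma decay_ge0 x : 0 <= decay x.
Proof. exact: powR_ge0. Qed.

Lemma decayN x : decay (- x) = decay x.
Proof. by rewrite /decay japaneseN. Qed.

Lemma powRN_anti (u v : R) : 0 < u -> u <= v -> v `^ (- p) <= u `^ (- p).
Proof.
move=> u0 uv; rewrite !powRN lef_pV2 ?posrE ?powR_gt0//; last exact: lt_le_trans uv.
by apply: ge0_ler_powR => //; rewrite ?nnegrE ltW// (lt_le_trans u0).
Qed.

Lemma decay_le (d x y : R) : 0 < d -> d * japanese y <= japanese x ->
  decay x <= d `^ (- p) * decay y.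
Proof.
move=> d0 dyx; rewrite /decay -powRM ?(ltW d0) ?(ltW (japanese_gt0 y))//.
by apply: powRN_anti => //; rewrite mulr_gt0// japanese_gt0.
Qed.

Lemma decay_le1 x : decay x <= 1.
Proof.
rewrite /decay (_ : 1 = 1 `^ (- p)); last by rewrite powR1.
exact: powRN_anti (japanese_ge1 x).
Qed.

Lemma continuous_decay : continuous decay.
Proof.
move=> x; apply: (continuous_comp (f := @japanese R) (g := fun z => z `^ (- p))).
  by apply: cvgD; [exact: cvg_cst|exact: norm_continuous].
apply/differentiable_continuous/derivable1_diffP/derivable_powR.
by rewrite in_itv/= andbT japanese_gt0.
Qed.

Lemma measurable_decay : measurable_fun setT decay.
Proof. exact: continuous_measurable_fun continuous_decay. Qed.

Lemma measurable_decay_comp d (T : measurableType d) (f : T -> R) :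
  measurable_fun setT f -> measurable_fun setT (fun x : T => (decay (f x))%:E).
Proof.
by move=> mf; apply/measurable_EFinP; exact: (measurableT_comp measurable_decay mf).
Qed.

Lemma integral_decay_lty : (\int[leb]_x (decay x)%:E < +oo)%E.
Proof.
rewrite ge0_symfun_integralT//; last 3 first.
- exact: decay_ge0.
- exact: continuous_decay.
- by move=> x; rewrite /= decayN.
rewrite -set_itvcy.
have p10 : 0 < p - 1 by rewrite subr_gt0.
pose F x : R := - (p - 1)^-1 * (1 + x) `^ (- (p - 1)).
have cF x : 0 <= x -> is_derive x 1 F (decay x).
  move=> x0; have x10 : 0 < 1 + x by rewrite ltr_pwDl.
  have d1 : is_derive x 1 (fun z : R => 1 + z) 1.
    by have := is_deriveD (is_derive_cst (1 : R) x 1) (is_derive_id x (1 : R)); rewrite add0r.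
  have d2 := is_deriveZ (- (p - 1)^-1) (is_derive1_comp (is_derive1_powR (- (p - 1)) x10) d1).
  apply: (is_derive_eq d2); rewrite /GRing.scale/= mulr1.
  rewrite mulrA mulrNN mulVf ?gt_eqF// mul1r /decay /japanese ger0_norm//.
  by congr (_ `^ _); ring.
rewrite (@ge0_continuous_FTC2y _ decay F 0 0).
- by rewrite -EFinB -EFinM ltry.
- by move=> x _; exact: decay_ge0.
- exact/continuous_subspaceT/continuous_decay.
- apply/cvgrPdist_le => e e0.
  pose A := ((p - 1) * e) `^ (- (p - 1)^-1).
  have e1 : 0 < (p - 1) * e by rewrite mulr_gt0.
  near=> x.
  have x10 : 0 < 1 + x by rewrite ltr_pwDl.
  rewrite sub0r normrN /F normrM normrN [`|_ `^ _|]ger0_norm ?powR_ge0//.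
  rewrite gtr0_norm ?invr_gt0// ler_pdivrMl//.
  have A0 : 0 < A by rewrite powR_gt0.
  have -> : (p - 1) * e = A `^ (- (p - 1)).
    by rewrite /A -powRrM mulrNN mulVf ?gt_eqF// powRr1// ltW.
  rewrite !powRN lef_pV2 ?posrE ?powR_gt0//.
  apply: ge0_ler_powR; rewrite ?nnegrE ?ltW//.
  by apply: (@lt_trans _ _ x); [near: x; apply: nbhs_pinfty_gt; exact: num_real|rewrite ltrDr].
- by move=> x x0; case: (cF x (ltW x0)).
- apply: cvg_at_right_filter; apply/differentiable_continuous/derivable1_diffP.
  by case: (cF 0 (lexx 0)).
- move=> x; rewrite in_itv/= andbT => x0.
  by rewrite derive1E; case: (cF x (ltW x0)).
Unshelve. all: by end_near. Qed.

Definition mass : R := \int[leb]_x decay x.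

Lemma integral_decay : (\int[leb]_x (decay x)%:E = mass%:E)%E.
Proof.
rewrite /mass /Rintegral fineK// ge0_fin_numE ?integral_decay_lty//.
by apply: integral_ge0 => x _; rewrite lee_fin decay_ge0.
Qed.

Lemma integral_decayD (c : R) : (\int[leb]_x (decay (x + c))%:E = mass%:E)%E.
Proof.
rewrite -integral_decay -[RHS](@ge0_integral_translate _ _ (- c)).
- by apply: eq_integral => x _; rewrite opprK.
- exact: measurable_decay_comp.
- by move=> x; rewrite lee_fin decay_ge0.
Qed.

Lemma integral_decayB (c : R) : (\int[leb]_x (decay (c - x))%:E = mass%:E)%E.
Proof.
rewrite -(integral_decayD (- c)); apply: eq_integral => x _.
by rewrite -decayN opprB.
Qed.

Lemma mass_ge0 : 0 <= mass.
Proof. by apply: Rintegral_ge0 => x _; exact: decay_ge0. Qed.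

(** Two brackets cannot both be much smaller than the bracket of the sum. *)
Lemma decayM_le x y :
  decay x * decay y <= 2 `^ p * decay (x + y) * (decay x + decay y).
Proof.
have h u v : japanese v <= japanese u ->
    decay u * decay v <= 2 `^ p * decay (u + v) * (decay u + decay v).
  move=> vu; have uv : 2^-1 * japanese (u + v) <= japanese u.
    rewrite ler_pdivrMl// (_ : 2 * _ = japanese u + japanese u); last by rewrite mulr_natl mulr2n.
    rewrite (le_trans (_ : _ <= japanese u + japanese v))//; last by rewrite lerD2l.
    rewrite /japanese addrACA (le_trans (_ : _ <= 1 + (`|u| + `|v|)))//.
      by rewrite lerD2l ler_normD.
    by rewrite lerD2r lerDl.
  have := decay_le _ uv; rewrite invr_gt0 => /(_ (ltr0Sn _ _)).
  have -> : 2^-1 `^ (- p) = 2 `^ p :> R by exact: powR_half.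
  move=> h; rewrite (le_trans (ler_wpM2r (decay_ge0 v) h))//.
  by rewrite ler_wpM2l ?lerDr ?decay_ge0// mulr_ge0 ?powR_ge0 ?decay_ge0.
have [xy|/ltW xy] := leP (japanese x) (japanese y); last exact: h.
by rewrite mulrC addrC [decay x + _]addrC h.
Qed.

Lemma integral_decayM (a b t : R) :
  (\int[leb]_x (decay (x + a) * decay (t - x + b))%:E <=
   (2 `^ p * (mass + mass) * decay (t + a + b))%:E)%E.
Proof.
have md1 : measurable_fun setT (fun x => (decay (x + a))%:E).
  by apply: measurable_decay_comp; exact: measurable_funD.
have md2 : measurable_fun setT (fun x => (decay (t - x + b))%:E).
  by apply: measurable_decay_comp; apply: measurable_funD => //; exact: measurable_funB.
have c0 : 0 <= 2 `^ p * decay (t + a + b) by rewrite mulr_ge0 ?powR_ge0.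
apply: (@le_trans _ _ (\int[leb]_x ((2 `^ p * decay (t + a + b))%:E *
    ((decay (x + a))%:E + (decay (t - x + b))%:E)))%E).
  apply: ge0_le_integral => //.
  - by move=> x _; rewrite lee_fin mulr_ge0 ?decay_ge0.
  - by under eq_fun do rewrite EFinM; exact: emeasurable_funM.
  - by apply: measurable_funeM; exact: emeasurable_funD.
  - move=> x _; rewrite -EFinD -EFinM lee_fin.
    have -> : t + a + b = (x + a) + (t - x + b) by ring.
    exact: decayM_le.
rewrite ge0_integralZl_EFin//; last 2 first.
- by move=> x _; rewrite -EFinD lee_fin addr_ge0 ?decay_ge0.
- exact: emeasurable_funD.
rewrite ge0_integralD//; last 2 first.
- by move=> x _; rewrite lee_fin decay_ge0.
- by move=> x _; rewrite lee_fin decay_ge0.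
rewrite integral_decayD.
have -> : (\int[leb]_x (decay (t - x + b))%:E = mass%:E)%E.
  by rewrite -(integral_decayB (t + b)); apply: eq_integral => x _; congr (decay _)%:E; ring.
by rewrite -EFinD -EFinM lee_fin; rewrite mulrAC.
Qed.

(** Comparison of a sum with an integral: on an interval of length 1 the bracket
    varies by a factor at most 2. *)
Lemma zsum_decay (r : R) :
  (\esum_(m in [set: int]) (decay (m%:~R - r))%:E <= (2 `^ p * mass)%:E)%E.
Proof.
pose I (m : int) (x : R) : R := if Num.floor x == m then 1 else 0.
have mI m : measurable_fun setT (I m).
  rewrite (_ : I m = \1_(`[m%:~R, (m + 1)%:~R[%classic)); first exact: measurable_indic.
  apply/funext => x; rewrite indicE /I mem_setE in_itv/= floor_eq.
  by case: ifP.
have md x0 : measurable_fun setT (fun x => (decay (x + x0))%:E).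
  by apply: measurable_decay_comp; exact: measurable_funD.
have I0 m x : 0 <= I m x by rewrite /I; case: ifP.
rewrite EFinM -(integral_decayD (- r)) -ge0_integralZl_EFin//; last 2 first.
- by move=> x _; rewrite lee_fin decay_ge0.
- exact: md.
have mG m : measurable_fun setT (fun x => (I m x)%:E * ((2 `^ p)%:E * (decay (x + - r))%:E))%E.
  apply: emeasurable_funM; first by apply/measurable_EFinP; exact: mI.
  by apply: measurable_funeM; exact: md.
have G0 x : (0 <= (2 `^ p)%:E * (decay (x + - r))%:E)%E.
  by rewrite -EFinM lee_fin mulr_ge0 ?powR_ge0 ?decay_ge0.
have G1 m x : (0 <= (I m x)%:E * ((2 `^ p)%:E * (decay (x + - r))%:E))%E.
  by rewrite -!EFinM lee_fin !mulr_ge0 ?powR_ge0 ?decay_ge0 ?I0.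
apply: (@le_trans _ _ (\int[leb]_x (\esum_(m in [set: int]) ((I m x)%:E * ((2 `^ p)%:E * (decay (x + - r))%:E))%E))%E).
  rewrite integral_zsum//.
  apply: le_esum => m _.
  have Im1 : (\int[leb]_x (I m x)%:E = 1)%E.
    transitivity (\int[leb]_x (\1_(`[m%:~R, (m + 1)%:~R[%classic : set R) x)%:E)%E.
      by apply: eq_integral => x _; rewrite indicE /I mem_setE in_itv/= floor_eq; case: ifP.
    rewrite integral_indic// setIT /= lebesgue_measure_itv/= lte_fin ltr_int ltrDl ltr01.
    by rewrite -EFinB intrD addrC addKr.
  have -> : (decay (m%:~R - r))%:E = (\int[leb]_x ((decay (m%:~R - r))%:E * (I m x)%:E))%E.
    rewrite ge0_integralZl_EFin//.
    - by rewrite Im1 mule1.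
    - by move=> x _; rewrite lee_fin.
    - by apply/measurable_EFinP; exact: mI.
    - exact: decay_ge0.
  apply: ge0_le_integral => //.
  - by move=> x _; rewrite -EFinM lee_fin mulr_ge0 ?decay_ge0.
  - by apply: measurable_funeM; apply/measurable_EFinP; exact: mI.
  - exact: mG.
  move=> x _; rewrite -!EFinM lee_fin [leRHS]mulrC.
  rewrite /I; case: ifPn => [/eqP fx|_]; last by rewrite !mulr0.
  rewrite !mulr1.
  have : 2^-1 * japanese (x - r) <= japanese (m%:~R - r).
    have /andP[h1 h2] : (m%:~R <= x < (m + 1)%:~R) by rewrite -floor_eq fx.
    rewrite ler_pdivrMl// /japanese.
    have h : `|x - r| <= `|m%:~R - r| + 1.
      rewrite (_ : x - r = (m%:~R - r) + (x - m%:~R)); last by ring.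
      rewrite (le_trans (ler_normD _ _))// lerD2l ger0_norm ?subr_ge0//.
      by rewrite lerBlDl ltW// (lt_le_trans h2)// intrD.
    rewrite (le_trans (_ : _ <= 1 + (`|m%:~R - r| + 1)))// ?lerD2l//.
    by rewrite mulr_natl mulr2n -[leRHS]addrA !lerD2l lerDl.
  move=> h; have := decay_le _ h; rewrite invr_gt0 => /(_ (ltr0Sn _ _)).
  have -> : 2^-1 `^ (- p) = 2 `^ p :> R by exact: powR_half.
  by [].
apply: ge0_le_integral => //.
- by move=> x _; apply: esum_ge0 => m _; exact: G1.
- exact: measurable_zsum.
- by apply: measurable_funeM; exact: md.
move=> x _.
rewrite (_ : (\esum_(m in [set: int]) _)%E = (\esum_(m in [set Num.floor x]) ((2 `^ p)%:E * (decay (x + - r))%:E))%E).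
  by rewrite esum_set1.
rewrite [RHS]esum_mkcond; apply: eq_esum => m _; rewrite /I.
case: eqP => [<-|fm]; first by rewrite mul1e mem_set.
by rewrite mul0e memNset// => /= mE; exact: fm.
Qed.

(** Two centres are allowed, for the two roots of a quadratic resonance
    function. *)
Lemma zsum_decay_scaled (c d e : R) (f : int -> R) : 0 < d ->
  (forall m, d * japanese (m%:~R - c) <= japanese (f m) \/
             d * japanese (m%:~R - e) <= japanese (f m)) ->
  (\esum_(m in [set: int]) (decay (f m))%:E <=
   (d `^ (- p) * (2 `^ p * mass + 2 `^ p * mass))%:E)%E.
Proof.
move=> d0 h; have z c' m : (0 <= (decay (m%:~R - c'))%:E)%E by rewrite lee_fin decay_ge0.
apply: (@le_trans _ _ (\esum_(m in [set: int])
    ((d `^ (- p))%:E * ((decay (m%:~R - c))%:E + (decay (m%:~R - e))%:E)))%E).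
  apply: le_esum => m _; rewrite -EFinD -EFinM lee_fin mulrDr.
  have [/(decay_le d0) h'|/(decay_le d0) h'] := h m; rewrite (le_trans h')//.
    by rewrite lerDl mulr_ge0 ?powR_ge0 ?decay_ge0.
  by rewrite lerDr mulr_ge0 ?powR_ge0 ?decay_ge0.
rewrite zsumZ//; last 2 first.
- exact: powR_ge0.
- by move=> m; rewrite adde_ge0.
by rewrite zsumD// EFinM lee_wpmul2l ?lee_fin ?powR_ge0// EFinD leeD// zsum_decay.
Qed.

End Bracket.

Section Resonance.
Context {R : realType}.
Local Notation leb := (@lebesgue_measure R).
Variables (L p : R).
Hypotheses (L0 : 0 < L) (p1 : 1 < p).
Local Notation decay := (decay p).

(** The Schroedinger dispersion relation. *)
Definition symbol (n : int) : R := (2 * pi * n%:~R / L) ^+ 2.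

Let u : R := (2 * pi / L) ^+ 2.
Let u0 : 0 < u.
Proof. by rewrite exprn_gt0// divr_gt0// mulr_gt0// pi_gt0. Qed.

Lemma symbolE n : symbol n = u * n%:~R ^+ 2.
Proof. by rewrite /symbol /u; ring. Qed.

Lemma gammaLN n : gammaL L (- n) = gammaL L n.
Proof.
by rewrite /gammaL mulrNz sqrrN (_ : (- n%:~R) ^+ 4 = n%:~R ^+ 4 :> R)//; ring.
Qed.

(** Indeed n^2 <= sqrt (n^2 + n^4) <= n^2 + 1. *)
Lemma gammaL_near n : `|gammaL L n - symbol n| <= u.
Proof.
rewrite /gammaL symbolE -/u -mulrBr normrM (gtr0_norm u0) -[leRHS]mulr1 ler_pM2l//.
set x := n%:~R ^+ 2; have x0 : 0 <= x by exact: sqr_ge0.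
have -> : n%:~R ^+ 4 = x ^+ 2 :> R by rewrite /x -exprM.
have h1 : x <= Num.sqrt (x + x ^+ 2).
  by rewrite -[leLHS](ger0_norm x0) -sqrtr_sqr ler_wsqrtr// lerDr.
have h2 : Num.sqrt (x + x ^+ 2) <= x + 1.
  rewrite -[leRHS](@ger0_norm _ (x + 1)) ?addr_ge0// -sqrtr_sqr ler_wsqrtr//.
  by rewrite sqrrD mulr1 addrC expr1n -addrA lerD2l mulr2n -addrA lerDl addr_ge0.
by rewrite ger0_norm ?subr_ge0// lerBlDl.
Qed.

Let japanese_close x y : `|x - y| <= u -> japanese x <= (1 + u) * japanese y.
Proof.
move=> xy; rewrite /japanese (le_trans (_ : _ <= 1 + (`|x - y| + `|y|)))//.
  by rewrite lerD2l -[in leLHS](subrK y x) ler_normD.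
rewrite mulrDl mul1r mulrDr mulr1.
have h := normr_ge0 y; have h2 : 0 <= u * `|y| by rewrite mulr_ge0// ltW.
lra.
Qed.

(** As the symbol is nonnegative, its distance to |t| is at most its distance to
    t and to - t. *)
Lemma boussinesq_le t n :
  japanese (`|t| - gammaL L n) <= (1 + u) * japanese (t - symbol n) /\
  japanese (`|t| - gammaL L n) <= (1 + u) * japanese (t + symbol n).
Proof.
have s0 : 0 <= symbol n by exact: sqr_ge0.
have h : japanese (`|t| - gammaL L n) <= (1 + u) * japanese (`|t| - symbol n).
  apply: japanese_close; rewrite (_ : _ - _ = - (gammaL L n - symbol n)); last by ring.
  by rewrite normrN gammaL_near.
have u10 : 0 <= 1 + u by rewrite addr_ge0// ltW.
split; rewrite (le_trans h)// ler_wpM2l// /japanese lerD2l.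
  rewrite -{1}(ger0_norm s0) (le_trans (ler_dist_dist _ _))//.
rewrite -{1}(ger0_norm s0) -(normrN (symbol n)) (le_trans (ler_dist_dist _ _))//.
by rewrite opprK.
Qed.

(** The sign of t decides which alternative holds. *)
Lemma boussinesq_ge t n :
  japanese (t - symbol n) <= (1 + u) * japanese (`|t| - gammaL L n) \/
  japanese (t + symbol n) <= (1 + u) * japanese (`|t| - gammaL L n).
Proof.
have h : japanese (`|t| - symbol n) <= (1 + u) * japanese (`|t| - gammaL L n).
  apply: japanese_close; rewrite (_ : _ - _ = (gammaL L n - symbol n)); last by ring.
  exact: gammaL_near.
have [t0|t0] := ger0P t; [left|right].
  by move: h; rewrite ger0_norm.
by move: h; rewrite ltr0_norm// -(japaneseN (t + _)) opprD.
Qed.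

Let C : R := (1 + u)^-1 `^ (- p).

Lemma decay_boussinesq t n : decay (`|t| - gammaL L n) <=
  C * (decay (t - symbol n) + decay (t + symbol n)).
Proof.
have u10 : 0 < 1 + u by rewrite ltr_pwDl// ltW.
have ui : 0 < (1 + u)^-1 by rewrite invr_gt0.
rewrite mulrDr; have [h|h] := boussinesq_ge t n.
  rewrite (le_trans (decay_le p1 ui (y := t - symbol n) _))//.
    by rewrite ler_pdivrMl.
  by rewrite lerDl mulr_ge0 ?powR_ge0 ?decay_ge0.
rewrite (le_trans (decay_le p1 ui (y := t + symbol n) _))//.
  by rewrite ler_pdivrMl.
by rewrite lerDr mulr_ge0 ?powR_ge0 ?decay_ge0.
Qed.

Let md1 (f : R -> R) : measurable_fun setT f ->
  measurable_fun setT (fun x => (decay (f x))%:E).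
Proof. exact: measurable_decay_comp. Qed.

(* Opposite signs: the resonance function is affine in the summation index. *)
Let sum_opposite (n : int) (t : R) : n != 0 ->
  (\esum_(m in [set: int]) (decay (t + symbol m - symbol (n - m)))%:E <=
   (Num.min 1 (2 * u) `^ (- p) * (2 `^ p * mass p + 2 `^ p * mass p))%:E)%E.
Proof.
move=> n0; pose d := Num.min 1 (2 * u).
have d0 : 0 < d by rewrite lt_min ltr01 mulr_gt0.
have nR : n%:~R != 0 :> R by rewrite intr_eq0.
have u2 : 0 <= 2 * u by rewrite mulr_ge0// ltW.
pose r := - (t - symbol n) / (2 * u * n%:~R).
apply: (@zsum_decay_scaled _ p p1 r d r) => // m; left.
have -> : t + symbol m - symbol (n - m) = (2 * u * n%:~R) * (m%:~R - r).
  rewrite /r !symbolE intrB; field; by rewrite nR gt_eqF.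
rewrite /japanese normrM mulrDr mulr1 lerD//; first by rewrite ge_min lexx.
rewrite ler_wpM2r// normrM (ger0_norm u2).
rewrite ge_min; apply/orP; right; rewrite ler_peMr//.
by rewrite -intr_norm -[1]/(1%:~R) ler_int -gtz0_ge1 normr_gt0.
Qed.

(* Equal signs: the resonance function is a quadratic polynomial. *)
Let sum_equal (n : int) (t : R) :
  (\esum_(m in [set: int]) (decay (t + symbol m + symbol (n - m)))%:E <=
   ((Num.min 1 (u / 2) / 2) `^ (- p) * (2 `^ p * mass p + 2 `^ p * mass p))%:E)%E.
Proof.
pose d0 := Num.min 1 (u / 2).
have d00 : 0 < d0 by rewrite lt_min ltr01 divr_gt0.
pose A := t + u * n%:~R ^+ 2 / 2.
pose r := Num.sqrt (Num.max 0 (- A * 2 / u)).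
have r0 : 0 <= r by exact: sqrtr_ge0.
apply: (@zsum_decay_scaled _ p p1 ((n%:~R + r) / 2) _ ((n%:~R - r) / 2)) => [|m].
  by rewrite divr_gt0.
(* Complete the square: the resonance function is A + u / 2 * k ^+ 2, and r is
   the absolute value of its roots in k, or 0 if there are none. *)
pose k : R := 2 * m%:~R - n%:~R.
have -> : t + symbol m + symbol (n - m) = A + u / 2 * k ^+ 2.
  by rewrite /A /k !symbolE intrB; field.
have key : d0 / 2 * (1 + `| `|k| - r|) <= japanese (A + u / 2 * k ^+ 2).
  set y := `|k| - r.
  have y1 : 1 + `|y| <= 2 * (1 + y ^+ 2).
    rewrite -[y ^+ 2]real_normK ?num_real//; have := sqr_ge0 (`|y| - 1).
    by have := normr_ge0 y; nra.
  have y2 : d0 * (1 + y ^+ 2) <= 1 + u / 2 * y ^+ 2.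
    rewrite mulrDr mulr1 lerD//; first by rewrite ge_min lexx.
    by rewrite ler_wpM2r ?sqr_ge0// ge_min lexx orbT.
  have y3 : 1 + u / 2 * y ^+ 2 <= japanese (A + u / 2 * k ^+ 2).
    rewrite /japanese lerD2l.
    have [A0|A0] := leP 0 A.
      have -> : y = `|k|.
        rewrite /y /r max_l ?sqrtr0 ?subr0// !mulNr oppr_le0.
        by rewrite divr_ge0 ?(ltW u0)// mulr_ge0.
      rewrite real_normK ?num_real// ger0_norm ?lerDr//.
      by rewrite addr_ge0// mulr_ge0 ?sqr_ge0// divr_ge0// ltW.
    have rE : r ^+ 2 = - A * 2 / u.
      rewrite /r sqr_sqrtr; last by rewrite le_max lexx.
      rewrite max_r// !mulNr oppr_ge0 mulr_le0_ge0 ?invr_ge0 ?(ltW u0)//.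
      by rewrite mulr_le0_ge0// ltW.
    have -> : A = - (u / 2) * r ^+ 2 by rewrite rE; field; rewrite gt_eqF.
    rewrite -[k ^+ 2]real_normK ?num_real//.
    have -> : - (u / 2) * r ^+ 2 + u / 2 * `|k| ^+ 2 = u / 2 * (y * (`|k| + r)) by rewrite /y; ring.
    rewrite normrM (@ger0_norm _ (u / 2)) ?divr_ge0 ?(ltW u0)//.
    rewrite ler_wpM2l ?divr_ge0 ?(ltW u0)// normrM (@ger0_norm _ (`|k| + r)) ?addr_ge0//.
    rewrite -real_normK ?num_real// expr2 ler_wpM2l// /y.
    by rewrite (le_trans (ler_normB _ _))// normr_id (ger0_norm r0).
  rewrite (le_trans _ y3)// (le_trans _ y2)// -mulrA ler_wpM2l ?(ltW d00)//.
  by rewrite ler_pdivrMl.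
have half (z : R) : d0 / 2 * japanese (z / 2) <= d0 / 2 * (1 + `|z|).
  rewrite ler_wpM2l ?divr_ge0 ?(ltW d00)// /japanese lerD2l normrM.
  by rewrite ler_piMr// ger0_norm// invf_le1// ler1n.
have [k0|k0] := ger0P k; [left|right].
  rewrite (le_trans _ key)// (ger0_norm k0) (_ : _ - _ = (k - r) / 2) ?half//.
  by rewrite /k; field.
rewrite (le_trans _ key)// (ltr0_norm k0) (_ : _ - (_ / _) = (k + r) / 2).
  by rewrite (le_trans (half _))// -opprD normrN.
by rewrite /k; field.
Qed.

(** Integration in x, by integral_decayM, leaves the sum over m of the decay of
    a resonance function that is affine or quadratic in m. *)
Lemma resonance_bound : exists2 K : R, 0 < K &
  forall (n : int) (t : R), n != 0 ->
  (\esum_(m in [set: int]) \int[leb]_x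
     (decay (x + symbol m) * decay (`|t - x| - gammaL L (n - m)))%:E <= K%:E)%E.
Proof.
pose c1 := 2 `^ p * (mass p + mass p).
pose K1 := Num.min 1 (2 * u) `^ (- p) * (2 `^ p * mass p + 2 `^ p * mass p).
pose K2 := (Num.min 1 (u / 2) / 2) `^ (- p) * (2 `^ p * mass p + 2 `^ p * mass p).
have C0 : 0 <= C by exact: powR_ge0.
have ma0 : 0 <= mass p by exact: mass_ge0.
have c10 : 0 <= c1 by rewrite mulr_ge0 ?powR_ge0 ?addr_ge0.
have z0 : 0 <= 2 `^ p * mass p by rewrite mulr_ge0 ?powR_ge0.
have K10 : 0 <= K1 by rewrite mulr_ge0 ?powR_ge0 ?addr_ge0.
have K20 : 0 <= K2 by rewrite mulr_ge0 ?powR_ge0 ?addr_ge0.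
exists (C * (c1 * (K1 + K2)) + 1).
  by rewrite ltr_pwDr// !mulr_ge0// addr_ge0.
move=> n t n0.
have dd x : (0 <= (decay x)%:E)%E by rewrite lee_fin decay_ge0.
have dM x y : (0 <= (decay x * decay y)%:E)%E by rewrite lee_fin mulr_ge0 ?decay_ge0.
have mM (a b : R) : measurable_fun setT (fun x : R => (decay (x + a) * decay (t - x + b))%:E).
  under eq_fun do rewrite EFinM; apply: emeasurable_funM; apply: md1.
    exact: measurable_funD.
  by apply: measurable_funD => //; exact: measurable_funB.
apply: (@le_trans _ _ (\esum_(m in [set: int]) (C%:E * (c1%:E *
   ((decay (t + symbol m - symbol (n - m)))%:E + (decay (t + symbol m + symbol (n - m)))%:E))))%E).
  apply: le_esum => m _.
  apply: (@le_trans _ _ (\int[leb]_x (C%:E * ((decay (x + symbol m) * decay (t - x - symbol (n - m)))%:E +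
     (decay (x + symbol m) * decay (t - x + symbol (n - m)))%:E)))%E).
    apply: ge0_le_integral => //.
    - under eq_fun do rewrite EFinM; apply: emeasurable_funM; apply: md1.
        exact: measurable_funD.
      apply: measurable_funB => //; apply: measurableT_comp => //; exact: measurable_funB.
    - by apply: measurable_funeM; apply: emeasurable_funD; exact: mM.
    move=> x _; rewrite -EFinD -EFinM lee_fin -mulrDr mulrCA.
    by rewrite ler_wpM2l ?decay_ge0// decay_boussinesq.
  rewrite ge0_integralZl_EFin//; last 2 first.
  - by move=> x _; rewrite adde_ge0.
  - by apply: emeasurable_funD; exact: mM.
  rewrite lee_wpmul2l ?lee_fin// ge0_integralD//; [|exact: mM|exact: mM].
  rewrite ge0_muleDr//; apply: leeD; rewrite -EFinM.
    exact: integral_decayM.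
  exact: integral_decayM.
have dp x y : (0 <= (decay x)%:E + (decay y)%:E)%E by rewrite adde_ge0.
rewrite !zsumZ//; last by move=> m; apply: mule_ge0.
rewrite zsumD// EFinD !EFinM.
apply: (@le_trans _ _ (C%:E * (c1%:E * (K1 + K2)%:E))%E); last by rewrite leeDl.
rewrite lee_wpmul2l ?lee_fin// lee_wpmul2l ?lee_fin//.
by rewrite EFinD; apply: leeD; [exact: sum_opposite|exact: sum_equal].
Qed.

End Resonance.

(** * The bilinear estimate for convolutions *)

Section Convolution.
Context {R : realType}.
Local Notation leb := (@lebesgue_measure R).

(** Convolution on the product of the integers and the line, with values in
    [0, +oo]. *)
Definition zconv (f g : int -> R -> R) (n : int) (t : R) : \bar R :=
  (\esum_(m in [set: int]) \int[leb]_x (f m x * g (n - m) (t - x))%:E)%E.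

Definition energy (f : int -> R -> R) : \bar R :=
  (\esum_(m in [set: int]) \int[leb]_x ((f m x) ^+ 2)%:E)%E.

Definition nonneg_meas (f : int -> R -> R) : Prop :=
  (forall m, measurable_fun setT (f m)) /\ (forall m x, 0 <= f m x).

Lemma energy_ge0 f : (0 <= energy f)%E.
Proof.
by apply: esum_ge0 => m _; apply: integral_ge0 => x _; rewrite lee_fin sqr_ge0.
Qed.

Lemma nonneg_measM f g : nonneg_meas f -> nonneg_meas g ->
  nonneg_meas (fun m x => f m x * g m x).
Proof.
move=> [f1 f2] [g1 g2]; split => [m|m x]; first exact: measurable_funM.
by rewrite mulr_ge0.
Qed.

Section two.
Variables f g : int -> R -> R.
Hypotheses (hf : nonneg_meas f) (hg : nonneg_meas g).

Let mker m k : measurable_fun setT (fun z : R * R => (f m z.2 * g k (z.1 - z.2))%:E).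
Proof.
apply/measurable_EFinP; apply: measurable_funM.
  exact: (measurableT_comp (hf.1 m) measurable_snd).
by apply: (measurableT_comp (hg.1 k)); exact: measurable_funB.
Qed.

Let ker0 m k (z : R * R) : (0 <= (f m z.2 * g k (z.1 - z.2))%:E)%E.
Proof. by rewrite lee_fin mulr_ge0 ?hf.2 ?hg.2. Qed.

Lemma measurable_conv m k :
  measurable_fun setT (fun t : R => \int[leb]_x (f m x * g k (t - x)%R)%:E)%E.
Proof. exact: (measurable_integral_snd (mker m k) (ker0 m k)). Qed.

Lemma conv_ge0 m k t : (0 <= \int[leb]_x (f m x * g k (t - x))%:E)%E.
Proof. by apply: integral_ge0 => x _; exact: (ker0 m k (t, x)). Qed.

Lemma zconv_ge0 n t : (0 <= zconv f g n t)%E.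
Proof. by apply: esum_ge0 => m _; exact: conv_ge0. Qed.

Lemma measurable_zconv n : measurable_fun setT (zconv f g n).
Proof.
apply: measurable_zsum => [m|m t]; [exact: measurable_conv|exact: conv_ge0].
Qed.

Lemma integral_conv m k : (\int[leb]_t \int[leb]_x (f m x * g k (t - x))%:E =
  (\int[leb]_x (f m x)%:E) * \int[leb]_x (g k x)%:E)%E.
Proof.
have mg : measurable_fun setT (fun x => (g k x)%:E) by apply/measurable_EFinP; exact: hg.1.
have g0 x : (0 <= (g k x)%:E)%E by rewrite lee_fin hg.2.
have f0 x : (0 <= (f m x)%:E)%E by rewrite lee_fin hf.2.
rewrite (integral_exchange (mker m k) (ker0 m k)) /=.
transitivity (\int[leb]_x ((f m x)%:E * \int[leb]_t (g k t)%:E))%E.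
  apply: eq_integral => x _; under eq_integral do rewrite EFinM.
  rewrite ge0_integralZl_EFin ?hf.2//; last first.
    by apply/measurable_EFinP; apply: (measurableT_comp (hg.1 k)); exact: measurable_funB.
  by rewrite (ge0_integral_translate (f := fun t => (g k t)%:E)).
rewrite ge0_integralZr//.
  by apply/measurable_EFinP; exact: hf.1.
exact: integral_ge0.
Qed.

Lemma integral_zconv n : (\int[leb]_t zconv f g n t =
  \esum_(m in [set: int]) ((\int[leb]_x (f m x)%:E) * \int[leb]_x (g (n - m) x)%:E))%E.
Proof.
rewrite integral_zsum.
- by apply: eq_esum => m _; rewrite integral_conv.
- by move=> m; exact: measurable_conv.
- by move=> m t; exact: conv_ge0.
Qed.

(** Tonelli, and the invariance under translation of both factors. *)
Lemma zsum_integral_zconv :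
  (\esum_(n in [set: int]) \int[leb]_t zconv f g n t =
  (\esum_(m in [set: int]) \int[leb]_x (f m x)%:E) *
  \esum_(m in [set: int]) \int[leb]_x (g m x)%:E)%E.
Proof.
have f0 m : (0 <= \int[leb]_x (f m x)%:E)%E.
  by apply: integral_ge0 => x _; rewrite lee_fin hf.2.
have g0 m : (0 <= \int[leb]_x (g m x)%:E)%E.
  by apply: integral_ge0 => x _; rewrite lee_fin hg.2.
transitivity (\esum_(n in [set: int]) \esum_(m in [set: int])
    ((\int[leb]_x (f m x)%:E) * \int[leb]_x (g (n - m)%R x)%:E))%E.
  by apply: eq_esum => n _; exact: integral_zconv.
rewrite zsum_exchange; last by move=> i j; apply: mule_ge0.
have gs0 : (0 <= \esum_(m in [set: int]) \int[leb]_x (g m x)%:E)%E by apply: esum_ge0.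
rewrite muleC -zsumZe//; apply: eq_esum => m _.
rewrite zsumZe// muleC; congr (_ * _)%E.
exact: (zsum_shift (fun k => \int[leb]_x (g k x)%:E)%E m).
Qed.

End two.

End Convolution.

Section Bilinear.
Context {R : realType}.
Local Notation leb := (@lebesgue_measure R).
Variables (L b : R).
Hypotheses (L0 : 0 < L) (b2 : 2^-1 < b).

Let p : R := 2 * b.
Let p1 : 1 < p. Proof. by rewrite /p -ltr_pdivrMl// mulr1. Qed.

(** The inverses of the modulation weights. *)
Definition kerS (m : int) (x : R) : R := japanese (x + symbol L m) `^ (- b).
Definition kerB (m : int) (x : R) : R := japanese (`|x| - gammaL L m) `^ (- b).

Lemma bracket_sqr (x : R) : (japanese x `^ (- b)) ^+ 2 = decay p x.
Proof. by rewrite /decay /p -powR_mulrn ?powR_ge0// -powRrM; congr powR; ring. Qed.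

Lemma kerS_sqr m x : kerS m x ^+ 2 = decay p (x + symbol L m).
Proof. exact: bracket_sqr. Qed.

Lemma kerB_sqr m x : kerB m x ^+ 2 = decay p (`|x| - gammaL L m).
Proof. exact: bracket_sqr. Qed.

Let msqrt (f : R -> R) (h : R -> R) : (forall x, 0 <= f x) -> (forall x, f x ^+ 2 = h x) ->
  measurable_fun setT h -> measurable_fun setT f.
Proof.
move=> f0 fh mh; rewrite (_ : f = (fun x => Num.sqrt (h x))); last first.
  by apply/funext => x; rewrite -fh sqrtr_sqr ger0_norm.
by apply: measurableT_comp mh; apply: continuous_measurable_fun; exact: sqrt_continuous.
Qed.

Lemma nonneg_meas_kerS : nonneg_meas kerS.
Proof.
split=> [m|m x]; last exact: powR_ge0.
apply: (msqrt (fun x => powR_ge0 _ _) (kerS_sqr m)).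
by apply/measurable_EFinP; apply: measurable_decay_comp; exact: measurable_funD.
Qed.

Lemma nonneg_meas_kerB : nonneg_meas kerB.
Proof.
split=> [m|m x]; last exact: powR_ge0.
apply: (msqrt (fun x => powR_ge0 _ _) (kerB_sqr m)).
apply/measurable_EFinP; apply: measurable_decay_comp.
exact: measurable_funB.
Qed.

Let bracket_le1 (x : R) : japanese x `^ (- b) <= 1.
Proof.
rewrite -(@ler_pXn2r _ 2) ?nnegrE ?powR_ge0 ?ler01//.
by rewrite bracket_sqr expr1n decay_le1.
Qed.

Lemma kerS_le1 m x : kerS m x <= 1. Proof. exact: bracket_le1. Qed.
Lemma kerB_le1 m x : kerB m x <= 1. Proof. exact: bracket_le1. Qed.

Lemma integral_kerS_sqr m : (\int[leb]_x (kerS m x ^+ 2)%:E < +oo)%E.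
Proof. by under eq_integral do rewrite kerS_sqr; rewrite integral_decayD// ltry. Qed.

Lemma integral_kerB_sqr m : (\int[leb]_x (kerB m x ^+ 2)%:E < +oo)%E.
Proof.
under eq_integral do rewrite kerB_sqr.
pose C := (1 + (2 * pi / L) ^+ 2)^-1 `^ (- p).
have C0 : 0 <= C by exact: powR_ge0.
have md c : measurable_fun setT (fun x : R => (decay p (x + c))%:E).
  by apply: measurable_decay_comp; exact: measurable_funD.
have d0 (x : R) : (0 <= (decay p x)%:E)%E by rewrite lee_fin decay_ge0.
apply: (@le_lt_trans _ _ (\int[leb]_x (C%:E *
    ((decay p (x + - symbol L m))%:E + (decay p (x + symbol L m))%:E)))%E).
  apply: ge0_le_integral => //.
  - by apply: measurable_decay_comp; exact: measurable_funB.
  - by apply: measurable_funeM; apply: emeasurable_funD; exact: md.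
  - by move=> x _; rewrite -EFinD -EFinM lee_fin; exact: decay_boussinesq.
rewrite ge0_integralZl_EFin//; last 2 first.
- by move=> x _; rewrite adde_ge0.
- by apply: emeasurable_funD; exact: md.
rewrite ge0_integralD//; [|exact: md|exact: md].
by rewrite !integral_decayD// -EFinD -EFinM ltry.
Qed.

Definition wS (f : int -> R -> R) (m : int) (x : R) : R := kerS m x * f m x.
Definition wB (g : int -> R -> R) (m : int) (x : R) : R := kerB m x * g m x.

Let sq (f : int -> R -> R) : int -> R -> R := fun m x => f m x ^+ 2.

Let nsq f : nonneg_meas f -> nonneg_meas (sq f).
Proof.
by move=> [f1 f2]; split=> [m|m x]; [exact: measurable_funX|exact: sqr_ge0].
Qed.

Let mtrans (g : int -> R -> R) k (t : R) : nonneg_meas g ->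
  measurable_fun setT (fun x : R => g k (t - x)).
Proof. by move=> [g1 _]; apply: (measurableT_comp (g1 k)); exact: measurable_funB. Qed.

(* Output frequencies other than zero: Cauchy-Schwarz in the convolution
   variables leaves the sum bounded by resonance_bound. *)
Let bilinear_neq0 : exists2 K : R, 0 < K & forall f g, nonneg_meas f -> nonneg_meas g ->
  forall n t, n != 0 ->
  (zconv (wS f) (wB g) n t * zconv (wS f) (wB g) n t <=
   K%:E * zconv (sq f) (sq g) n t)%E.
Proof.
have [K K0 HK] := resonance_bound L0 p1; exists K => // f g hf hg n t n0.
have [ks1 ks2] := nonneg_meas_kerS; have [kb1 kb2] := nonneg_meas_kerB.
have h := @zsum_integral_CS R _ _ leb (fun m x => kerS m x * kerB (n - m) (t - x))
  (fun m x => f m x * g (n - m) (t - x)) K.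
have -> : zconv (wS f) (wB g) n t = (\esum_(m in [set: int]) \int[leb]_x
   ((kerS m x * kerB (n - m) (t - x)) * (f m x * g (n - m) (t - x)))%:E)%E.
  apply: eq_esum => m _; apply: eq_integral => x _; congr EFin.
  by rewrite /wS /wB; ring.
have -> : zconv (sq f) (sq g) n t = (\esum_(m in [set: int]) \int[leb]_x
   ((f m x * g (n - m) (t - x)) ^+ 2)%:E)%E.
  apply: eq_esum => m _; apply: eq_integral => x _; congr EFin.
  by rewrite /sq; ring.
apply: h => //.
- by move=> m; apply: measurable_funM; [exact: ks1|exact: (mtrans (n - m) t nonneg_meas_kerB)].
- by move=> m; apply: measurable_funM; [exact: hf.1|exact: mtrans].
- by move=> m x; rewrite mulr_ge0.
- by move=> m x; rewrite mulr_ge0 ?hf.2 ?hg.2.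
apply: le_trans (HK n t n0); apply: le_esum => m _.
rewrite le_eqVlt; apply/orP; left; apply/eqP; apply: eq_integral => x _; congr EFin.
by rewrite exprMn kerS_sqr kerB_sqr.
Qed.

(* At the output frequency 0 the two quadratic terms cancel, and the resonance
   function is constant in the summation index. The sum is made to converge by
   weights: the L^2 masses a m of the pieces of f. *)
Let bilinear_eq0 : exists2 K : R, 0 < K & forall f g A, nonneg_meas f -> nonneg_meas g ->
  0 < A -> (energy f <= A%:E)%E ->
  (\int[leb]_t (zconv (wS f) (wB g) 0 t * zconv (wS f) (wB g) 0 t) <=
   (K * A)%:E * energy g)%E.
Proof.
pose D : R := 2 `^ p * mass p.
have D0 : 0 <= D by rewrite mulr_ge0 ?powR_ge0 ?mass_ge0.
have m0 : 0 <= mass p by exact: mass_ge0.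
have M0 : 0 < mass p + 1 by rewrite ltr_wpDl.
exists ((mass p + 1) * (1 + D)); first by rewrite mulr_gt0// ltr_pwDl.
move=> f g A hf hg A0 fA.
have [ks1 ks2] := nonneg_meas_kerS; have [kb1 kb2] := nonneg_meas_kerB.
pose a m : R := fine (\int[leb]_x ((f m x) ^+ 2)%:E)%E.
have ia0 m : (0 <= \int[leb]_x ((f m x) ^+ 2)%:E)%E.
  by apply: integral_ge0 => x _; rewrite lee_fin sqr_ge0.
have aE m : (\int[leb]_x ((f m x) ^+ 2)%:E = (a m)%:E)%E.
  rewrite fineK// ge0_fin_numE// (le_lt_trans _ (ltry A))// (le_trans _ fA)//.
  exact: (zsum_ge (f := fun m => \int[leb]_x ((f m x) ^+ 2)%:E)%E).
have a0 m : 0 <= a m by rewrite fine_ge0.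
(* A summable positive sequence is added, so that a' can be divided by. *)
pose a' m : R := a m + A * decay p (m%:~R - 0).
have d0 (x : R) : 0 < decay p x by rewrite powR_gt0// japanese_gt0.
have a'0 m : 0 < a' m by rewrite ltr_wpDl// mulr_gt0.
have sa' : (\esum_(m in [set: int]) (a' m)%:E <= (A * (1 + D))%:E)%E.
  rewrite /a'; under eq_esum do rewrite EFinD EFinM.
  rewrite zsumD; last 2 first.
  - by move=> m; rewrite lee_fin.
  - by move=> m; rewrite -EFinM lee_fin mulr_ge0 ?(ltW A0) ?(ltW (d0 _)).
  rewrite zsumZ ?(ltW A0)//; last by move=> m; rewrite lee_fin ltW.
  rewrite mulrDr mulr1 EFinD leeD//.
    by under eq_esum do rewrite -aE.
  by rewrite EFinM lee_wpmul2l ?lee_fin ?(ltW A0)//; exact: zsum_decay.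
pose r m := Num.sqrt (a' m).
have r0 m : 0 < r m by rewrite sqrtr_gt0.
have r2 m : r m ^+ 2 = a' m by rewrite sqr_sqrtr// ltW.
pose f' m x := (r m)^-1 * f m x.
have hf' : nonneg_meas f'.
  split=> [m|m x]; first by apply: measurable_funM => //; exact: hf.1.
  by rewrite mulr_ge0 ?hf.2// invr_ge0 ltW.
have key t : (zconv (wS f) (wB g) 0 t * zconv (wS f) (wB g) 0 t <=
    ((mass p + 1) * (A * (1 + D)))%:E * zconv (sq f') (sq g) 0 t)%E.
  have h := @zsum_integral_CS R _ _ leb (fun m x => r m * (kerS m x * kerB (0 - m) (t - x)))
    (fun m x => f' m x * g (0 - m) (t - x)) ((mass p + 1) * (A * (1 + D))).
  have -> : zconv (wS f) (wB g) 0 t = (\esum_(m in [set: int]) \int[leb]_x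
     ((r m * (kerS m x * kerB (0 - m) (t - x))) * (f' m x * g (0 - m) (t - x)))%:E)%E.
    apply: eq_esum => m _; apply: eq_integral => x _; congr EFin.
    by rewrite /wS /wB /f'; field; rewrite gt_eqF.
  have -> : zconv (sq f') (sq g) 0 t = (\esum_(m in [set: int]) \int[leb]_x
     ((f' m x * g (0 - m) (t - x)) ^+ 2)%:E)%E.
    apply: eq_esum => m _; apply: eq_integral => x _; congr EFin.
    by rewrite /sq; ring.
  have mkk m : measurable_fun setT (fun x => kerS m x * kerB (0 - m) (t - x)).
    by apply: measurable_funM; [exact: ks1|exact: (mtrans (0 - m) t nonneg_meas_kerB)].
  apply: h.
  - by move=> m; apply: measurable_funM => //; exact: mkk.
  - by move=> m; apply: measurable_funM; [exact: hf'.1|exact: mtrans].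
  - by move=> m x; rewrite !mulr_ge0 ?ks2 ?kb2 ?ltW.
  - by move=> m x; rewrite mulr_ge0 ?hf'.2 ?hg.2.
  - by rewrite mulr_gt0// mulr_gt0// ltr_pwDl.
  apply: (@le_trans _ _ (\esum_(m in [set: int]) ((mass p + 1)%:E * (a' m)%:E))%E).
    apply: le_esum => m _.
    apply: (@le_trans _ _ (\int[leb]_x ((a' m)%:E * (decay p (x + symbol L m))%:E))%E).
      apply: ge0_le_integral => //.
      - by move=> x _; rewrite lee_fin sqr_ge0.
      - by apply/measurable_EFinP; apply: measurable_funX; apply: measurable_funM => //; exact: mkk.
      - by apply: measurable_funeM; apply: measurable_decay_comp; exact: measurable_funD.
      - move=> x _; rewrite -EFinM lee_fin exprMn r2 ler_pM2l// exprMn kerS_sqr.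
        by rewrite ler_piMr ?decay_ge0// expr_le1// ?kerB_le1.
    rewrite ge0_integralZl_EFin ?(ltW (a'0 _))//; last 2 first.
    - by move=> x _; rewrite lee_fin decay_ge0.
    - by apply: measurable_decay_comp; exact: measurable_funD.
    by rewrite integral_decayD// muleC -!EFinM lee_fin ler_pM2r// lerDl.
  rewrite zsumZ ?(ltW M0)//; last by move=> m; rewrite lee_fin ltW.
  by rewrite EFinM lee_wpmul2l// lee_fin ltW.
have hwS : nonneg_meas (wS f) by apply: nonneg_measM => //; exact: nonneg_meas_kerS.
have hwB : nonneg_meas (wB g) by apply: nonneg_measM => //; exact: nonneg_meas_kerB.
have z0 t := zconv_ge0 (nsq hf') (nsq hg) 0 t.
apply: (@le_trans _ _ (\int[leb]_t (((mass p + 1) * (A * (1 + D)))%:E * zconv (sq f') (sq g) 0 t))%E).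
  apply: ge0_le_integral => //.
  - by move=> t _; apply: mule_ge0; exact: zconv_ge0.
  - by apply: emeasurable_funM; exact: measurable_zconv.
  - by apply: measurable_funeM; apply: measurable_zconv; exact: nsq.
have AD : 0 <= (mass p + 1) * (A * (1 + D)) by rewrite mulr_ge0 ?(ltW M0)// mulr_ge0 ?(ltW A0)// addr_ge0.
rewrite ge0_integralZl_EFin//; last by apply: measurable_zconv; exact: nsq.
rewrite (_ : (mass p + 1) * (1 + D) * A = (mass p + 1) * (A * (1 + D))); last by ring.
rewrite lee_wpmul2l ?lee_fin// integral_zconv; [|exact: nsq|exact: nsq].
have -> : energy g = (\esum_(m in [set: int]) \int[leb]_x (sq g (0 - m)%R x)%:E)%E.
  exact/esym/(zsum_sub (fun m => \int[leb]_x (sq g m x)%:E)%E 0).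
apply: le_esum => m _.
have g0 : (0 <= \int[leb]_x (sq g (0 - m)%R x)%:E)%E.
  by apply: integral_ge0 => x _; rewrite lee_fin sqr_ge0.
rewrite -[leRHS]mul1e lee_wpmul2r//.
rewrite /sq /f'; under eq_integral do rewrite exprMn EFinM.
rewrite ge0_integralZl_EFin ?sqr_ge0//; last 2 first.
- by move=> x _; rewrite lee_fin sqr_ge0.
- by apply/measurable_EFinP; apply: measurable_funX; exact: hf.1.
rewrite aE -EFinM lee_fin exprVn r2 ler_pdivrMl// mulr1 lerDl.
by rewrite mulr_ge0 ?(ltW A0)// ltW.
Qed.

(** The bilinear estimate freed from the weights: f and g stand for the weighted
    moduli of the transforms of the two factors. *)
Lemma bilinear_zconv : exists2 K : R, 0 < K & forall f g A,
  nonneg_meas f -> nonneg_meas g -> 0 < A -> (energy f <= A%:E)%E ->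
  (\esum_(n in [set: int]) \int[leb]_t
     (zconv (wS f) (wB g) n t * zconv (wS f) (wB g) n t) <=
   (K * A)%:E * energy g)%E.
Proof.
have [K1 K10 H1] := bilinear_neq0; have [K2 K20 H2] := bilinear_eq0.
exists (K1 + K2); first by rewrite addr_gt0.
move=> f g A hf hg A0 fA.
have hwS : nonneg_meas (wS f) by apply: nonneg_measM => //; exact: nonneg_meas_kerS.
have hwB : nonneg_meas (wB g) by apply: nonneg_measM => //; exact: nonneg_meas_kerB.
have z0 n t := zconv_ge0 hwS hwB n t.
have zz0 n t := zconv_ge0 (nsq hf) (nsq hg) n t.
have iz0 n : (0 <= \int[leb]_t zconv (sq f) (sq g) n t)%E by exact: integral_ge0.
pose d (n : int) := if n == 0 then ((K2 * A)%:E * energy g)%E else 0%E.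
have KA0 : 0 <= K2 * A by rewrite mulr_ge0 ?ltW.
have d0 (n : int) : (0 <= d n)%E.
  by rewrite /d; case: ifP => // _; rewrite mule_ge0 ?lee_fin ?energy_ge0.
apply: (@le_trans _ _ (\esum_(n in [set: int])
    (K1%:E * (\int[leb]_t zconv (sq f) (sq g) n t) + d n))%E).
  apply: le_esum => n _; rewrite /d; case: ifPn => [/eqP ->|n0].
    rewrite (le_trans (H2 f g A hf hg A0 fA))// leeDr// mule_ge0// lee_fin ltW//.
  have mz : measurable_fun setT (zconv (sq f) (sq g) n) by apply: measurable_zconv; exact: nsq.
  apply: (@le_trans _ _ (\int[leb]_t (K1%:E * zconv (sq f) (sq g) n t))%E); last first.
    rewrite adde0 (@ge0_integralZl_EFin _ _ _ leb _ measurableT)//; last exact: ltW.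
  apply: ge0_le_integral => //.
  - by move=> t _; exact: mule_ge0.
  - by apply: emeasurable_funM; exact: measurable_zconv.
  - exact: measurable_funeM.
  - by move=> t _; exact: H1.
rewrite zsumD//; last by move=> n; rewrite mule_ge0// lee_fin ltW.
rewrite zsumZ ?(ltW K10)// zsum_integral_zconv; [|exact: nsq|exact: nsq].
have -> : (\esum_(n in [set: int]) d n = (K2 * A)%:E * energy g)%E.
  transitivity (\esum_(n in [set (0 : int)]) ((K2 * A)%:E * energy g))%E.
    rewrite [RHS]esum_mkcond; apply: eq_esum => n _; rewrite /d.
    case: eqP => [->|n0]; first by rewrite mem_set.
    by rewrite memNset.
  by rewrite esum_set1// mule_ge0 ?energy_ge0.
have K1A : 0 <= K1 * A by rewrite mulr_ge0 ?ltW.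
rewrite mulrDl EFinD ge0_muleDl ?lee_fin//.
rewrite leeD2r// EFinM -muleA lee_wpmul2l ?lee_fin ?(ltW K10)//.
by rewrite lee_wpmul2r// energy_ge0.
Qed.

End Bilinear.

(** * Smooth and Schwartz functions *)

Section SmoothAlgebra.
Context {R : realType}.
Implicit Types f g : R -> R.

Lemma smooth_derivable f x : smooth f -> derivable f x 1.
Proof. by move=> /(_ 0%N x); rewrite derive1n0. Qed.

Lemma smooth_derive f : smooth f -> smooth (derive1 f).
Proof. by move=> sf k x; rewrite -derive1Sn; exact: sf. Qed.

Lemma smooth_continuous f : smooth f -> continuous f.
Proof.
by move=> sf x; apply/differentiable_continuous/derivable1_diffP; exact: smooth_derivable.
Qed.

Lemma schwartz_derive f : schwartz f -> schwartz (derive1 f).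
Proof.
move=> [sf hf]; split; first exact: smooth_derive.
by move=> m k; have [M HM] := hf m k.+1; exists M => x; rewrite -derive1Sn.
Qed.

(** The ring of functions generated by Q, presented inductively so that its
    stability under differentiation, hence all the Leibniz formulas at once,
    comes by structural induction. *)
Inductive generated (Q : (R -> R) -> Prop) : (R -> R) -> Prop :=
| gen_base f : Q f -> generated Q f
| gen_add f g : generated Q f -> generated Q g -> generated Q (fun x => f x + g x)
| gen_opp f : generated Q f -> generated Q (fun x => - f x)
| gen_mul f g : generated Q f -> generated Q g -> generated Q (fun x => f x * g x).

Section generated.
Variable Q : (R -> R) -> Prop.
Hypothesis Qderivable : forall f, Q f -> forall x, derivable f x 1.
Hypothesis Qderive : forall f, Q f -> Q (derive1 f).

Lemma generated_derive f : generated Q f ->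
  (forall x, derivable f x 1) /\ generated Q (derive1 f).
Proof.
elim=> {f} [f Qf|f g gf [df gdf] gg [dg gdg]|f gf [df gdf]|f g gf [df gdf] gg [dg gdg]].
- by split; [exact: Qderivable|apply: gen_base; exact: Qderive].
- split=> [x|]; first exact: (derivableD (df x) (dg x)).
  rewrite (_ : derive1 _ = (fun x => derive1 f x + derive1 g x)); first exact: gen_add.
  by apply/funext => x; rewrite derive1E (deriveD (df x) (dg x)) -!derive1E.
- split=> [x|]; first exact: (derivableN (df x)).
  rewrite (_ : derive1 _ = (fun x => - derive1 f x)); first exact: gen_opp.
  by apply/funext => x; rewrite derive1E (deriveN (df x)) -derive1E.
- split=> [x|]; first exact: (derivableM (df x) (dg x)).
  rewrite (_ : derive1 _ = (fun x => f x * derive1 g x + g x * derive1 f x)).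
    by apply: gen_add; exact: gen_mul.
  by apply/funext => x; rewrite derive1E (deriveM (df x) (dg x)) -!derive1E.
Qed.

Lemma generated_derive1n f k : generated Q f -> generated Q (derive1n k f).
Proof.
elim: k f => [f|k IH f]; first by rewrite derive1n0.
by rewrite derive1Sn => /generated_derive[_]; exact: IH.
Qed.

Lemma generated_smooth f : generated Q f -> smooth f.
Proof. by move=> gf k x; have [] := generated_derive (generated_derive1n k gf). Qed.

End generated.

Lemma smooth_ring f : generated smooth f -> smooth f.
Proof.
apply: generated_smooth; first by move=> g sg x; exact: smooth_derivable.
exact: smooth_derive.
Qed.

(** In a product one factor keeps the polynomial weight and the other is merely
    bounded; derivatives stay in the ring. *)
Lemma schwartz_ring f : generated schwartz f -> schwartz f.
Proof.
have dS g : schwartz g -> forall x, derivable g x 1.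
  by move=> [sg _] x; exact: smooth_derivable.
have bS g : generated schwartz g -> forall m, exists M : R, forall x, `|x ^+ m * g x| <= M.
  elim=> {g} [g [_ hg] m|g h _ ig _ ih m|g _ ig m|g h _ ig _ ih m].
  - by have [M HM] := hg m 0%N; exists M => x; have := HM x; rewrite derive1n0.
  - have [M HM] := ig m; have [N HN] := ih m; exists (M + N) => x.
    by rewrite mulrDr (le_trans (ler_normD _ _))// lerD.
  - by have [M HM] := ig m; exists M => x; rewrite mulrN normrN.
  - have [M HM] := ig m; have [N HN] := ih 0%N; exists (M * N) => x.
    rewrite mulrA normrM ler_pM//.
    by have := HN x; rewrite expr0 mul1r.
move=> gf; split; first exact: (generated_smooth dS schwartz_derive gf).
by move=> m k; exact: (bS _ (generated_derive1n dS schwartz_derive k gf)).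
Qed.

End SmoothAlgebra.

Section ComplexSmooth.
Context {R : realType}.
Implicit Types f g : R -> R[i].

Let ReMf f g : (fun x => complex.Re (f x * g x)) =
  (fun x => complex.Re (f x) * complex.Re (g x) + - (complex.Im (f x) * complex.Im (g x))).
Proof. by apply/funext => x; rewrite ReM. Qed.

Let ImMf f g : (fun x => complex.Im (f x * g x)) =
  (fun x => complex.Re (f x) * complex.Im (g x) + complex.Im (f x) * complex.Re (g x)).
Proof. by apply/funext => x; rewrite ImM. Qed.

Let ReBf f g : (fun x => complex.Re (f x - g x)) =
  (fun x => complex.Re (f x) + - complex.Re (g x)).
Proof. by apply/funext => x; rewrite ReD ReN. Qed.

Let ImBf f g : (fun x => complex.Im (f x - g x)) =
  (fun x => complex.Im (f x) + - complex.Im (g x)).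
Proof. by apply/funext => x; rewrite ImD ImN. Qed.

Let ReJf f : (fun x => complex.Re (conjc (f x))) = (fun x => complex.Re (f x)).
Proof. by apply/funext => x; case: (f x). Qed.

Let ImJf f : (fun x => complex.Im (conjc (f x))) = (fun x => - complex.Im (f x)).
Proof. by apply/funext => x; case: (f x). Qed.

Section complex_ring.
Variable Q : (R -> R) -> Prop.
Hypothesis Q_ring : forall h, generated Q h -> Q h.

Let cQ f : Prop := Q (fun x => complex.Re (f x)) /\ Q (fun x => complex.Im (f x)).

Lemma complex_ringM f g : cQ f -> cQ g -> cQ (fun x => f x * g x).
Proof.
move=> [f1 f2] [g1 g2]; split; apply: Q_ring; rewrite ?ReMf ?ImMf.
  by apply: gen_add; [|apply: gen_opp]; apply: gen_mul; exact: gen_base.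
by apply: gen_add; apply: gen_mul; exact: gen_base.
Qed.

Lemma complex_ringB f g : cQ f -> cQ g -> cQ (fun x => f x - g x).
Proof.
move=> [f1 f2] [g1 g2]; split; apply: Q_ring; rewrite ?ReBf ?ImBf.
  by apply: gen_add; [|apply: gen_opp]; exact: gen_base.
by apply: gen_add; [|apply: gen_opp]; exact: gen_base.
Qed.

Lemma complex_ringJ f : cQ f -> cQ (fun x => conjc (f x)).
Proof.
move=> [f1 f2]; split; apply: Q_ring; rewrite ?ReJf ?ImJf; first exact: gen_base.
by apply: gen_opp; exact: gen_base.
Qed.

End complex_ring.

Lemma csmooth_ccontinuous f : csmooth f -> ccontinuous f.
Proof. by move=> [f1 f2]; split; exact: smooth_continuous. Qed.

(** On a compact interval a smooth function is Lipschitz, by the mean value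
    theorem. *)
Lemma csmooth_lipschitz f (L : R) : 0 < L -> csmooth f -> exists K : R,
  forall x y, x \in `[0, L] -> y \in `[0, L] -> cmod (f x - f y) <= K * `|x - y|.
Proof.
move=> L0 [f1 f2].
have lip (h : R -> R) : smooth h -> exists K : R, forall x y,
    x \in `[0, L] -> y \in `[0, L] -> `|h x - h y| <= K * `|x - y|.
  move=> sh; have ch := smooth_continuous (smooth_derive sh).
  have cn : {within `[0, L], continuous (fun x => `|(derive1 h) x|)}.
    by apply: continuous_subspaceT => x; apply: cvg_norm; exact: ch.
  have [c _ cM] := EVT_max (ltW L0) cn; exists `|(derive1 h) c|.
  have main x y : x \in `[0, L] -> y \in `[0, L] -> x <= y ->
      `|h y - h x| <= `|(derive1 h) c| * `|y - x|.
    move=> xI yI xy; have [||z zI ->] := @MVT_segment _ h (derive1 h) x y xy.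
    - by move=> z _; apply: DeriveDef; [exact: smooth_derivable|rewrite derive1E].
    - by apply: continuous_subspaceT; exact: smooth_continuous.
    rewrite normrM ler_wpM2r// cM//.
    move: xI yI zI; rewrite !in_itv/= => /andP[x0 _] /andP[_ yL] /andP[xz zy].
    by rewrite (le_trans x0 xz) (le_trans zy yL).
  move=> x y xI yI; have [xy|/ltW yx] := leP x y; last exact: main.
  by rewrite distrC (distrC x); exact: main.
have [K1 H1] := lip _ f1; have [K2 H2] := lip _ f2; exists (K1 + K2) => x y xI yI.
rewrite (le_trans (cmod_le _))// mulrDl ReD ImD ReN ImN.
by rewrite lerD ?H1 ?H2.
Qed.

End ComplexSmooth.

(** * Transforms of products, mode by mode *)

Section ProductTransform.
Context {R : realType}.
Local Notation leb := (@lebesgue_measure R).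
Implicit Types f g : int -> R -> R[i].

Definition spectrum f : int -> R -> R := fun m x => cmod (fourier_transform (f m) x).

(** The condition under which products are computed mode by mode; a finite
    X_{s,b} norm with s >= 0 and b > 1/2 implies it. *)
Definition finite_spectrum f : Prop :=
  [/\ forall m, cintegrable setT (f m),
      forall m, cintegrable setT (fourier_transform (f m)) &
      (energy (spectrum f) < +oo)%E].

Lemma finite_spectrum_energy f : finite_spectrum f ->
  (energy (fun m x => cmod (f m x)) < +oo)%E.
Proof.
move=> [fi fhi ef].
have p0 : 0 <= (2 * pi)^-1 :> R by rewrite invr_ge0 mulr_ge0// pi_ge0.
apply: (@le_lt_trans _ _ (((2 * pi)^-1)%:E * energy (spectrum f))%E).
  rewrite /energy -zsumZ//; last first.
    by move=> m; apply: integral_ge0 => x _; rewrite lee_fin sqr_ge0.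
  by apply: le_esum => m _; exact: plancherel_le.
by rewrite lte_mul_pinfty// lee_fin.
Qed.

Variables (f g : int -> R -> R[i]).
Hypotheses (hf : finite_spectrum f) (hg : finite_spectrum g).

Let mf m : measurable_fun setT (fun t => cmod (f m t)).
Proof. by have [h _ _] := hf; apply: cmeasurable_cmod; exact: cintegrable_cmeasurable. Qed.

Let mg m : measurable_fun setT (fun t => cmod (g m t)).
Proof. by have [h _ _] := hg; apply: cmeasurable_cmod; exact: cintegrable_cmeasurable. Qed.

Section fixed.
Variables (n : int) (h : R -> R[i]).
Hypothesis fgh : forall t,
  ccvg (cesaro_mean (fun k => f (zig k) t * g (n - zig k) t)) (h t).

(* H dominates all the Cesaro means. It is integrable, since the moduli of both
   factors are square summable by plancherel_le. *)
Let H (t : R) : \bar R :=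
  (\esum_(m in [set: int]) (cmod (f m t) * cmod (g (n - m)%R t))%:E)%E.

Let term0 m t : (0 <= (cmod (f m t) * cmod (g (n - m) t))%:E)%E.
Proof. by rewrite lee_fin mulr_ge0 ?cmod_ge0. Qed.

Let mterm m : measurable_fun setT (fun t => (cmod (f m t) * cmod (g (n - m) t))%:E).
Proof. by apply/measurable_EFinP; exact: measurable_funM. Qed.

Let H0 t : (0 <= H t)%E. Proof. by apply: esum_ge0 => m _; exact: term0. Qed.

Let mH : measurable_fun setT H. Proof. exact: measurable_zsum. Qed.

Let iH : (\int[leb]_t H t < +oo)%E.
Proof.
rewrite integral_zsum//.
apply: (@le_lt_trans _ _ (energy (fun m x => cmod (f m x)) + energy (fun m x => cmod (g m x)))%E);
  last by apply: lte_add_pinfty; exact: finite_spectrum_energy.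
have mf2 m : measurable_fun setT (fun x => (cmod (f m x) ^+ 2)%:E).
  by apply/measurable_EFinP; exact: measurable_funX.
have mg2 m : measurable_fun setT (fun x => (cmod (g m x) ^+ 2)%:E).
  by apply/measurable_EFinP; exact: measurable_funX.
rewrite {2}/energy -(zsum_sub (fun m => \int[leb]_x (cmod (g m x) ^+ 2)%:E)%E n) -zsumD.
- apply: le_esum => m _; rewrite -ge0_integralD//; last 4 first.
  + by move=> x _; rewrite lee_fin sqr_ge0.
  + exact: mf2.
  + by move=> x _; rewrite lee_fin sqr_ge0.
  + exact: mg2.
  apply: ge0_le_integral => //.
  - exact: mterm.
  - by apply: emeasurable_funD; [exact: mf2|exact: mg2].
  move=> x _; rewrite -EFinD lee_fin.
  have := sqr_ge0 (cmod (f m x) - cmod (g (n - m) x)).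
  have := cmod_ge0 (f m x); have := cmod_ge0 (g (n - m) x); nra.
- by move=> m; apply: integral_ge0 => x _; rewrite lee_fin sqr_ge0.
- by move=> m; apply: integral_ge0 => x _; rewrite lee_fin sqr_ge0.
Qed.

Let Hi : leb.-integrable setT H.
Proof.
by apply/integrableP; split => //; under eq_integral do rewrite gee0_abs//; exact: iH.
Qed.

Let Hfi : leb.-integrable setT (EFin \o (fine \o H)).
Proof.
apply/integrableP; split.
  by apply/measurable_EFinP; apply: measurableT_comp.
apply: le_lt_trans iH; apply: ge0_le_integral => //.
  by apply: measurableT_comp => //; apply/measurable_EFinP; apply: measurableT_comp.
move=> t _ /=; have := H0 t; case: (H t) => [r|_|//].
  by rewrite !lee_fin => r0; rewrite ger0_norm.
by rewrite /= normr0 leey.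
Qed.

Let partial_le (t : R) N : H t \is a fin_num ->
  \sum_(0 <= k < N) cmod (f (zig k) t * g (n - zig k) t) <= fine (H t).
Proof.
move=> Ht; rewrite -lee_fin fineK// /H zsum_series; last by move=> m; exact: term0.
rewrite -sumEFin; under eq_bigr do rewrite cmodM.
by apply: nneseries_lim_ge => k _ _; exact: term0.
Qed.

Let ti k : cintegrable setT (fun t => f (zig k) t * g (n - zig k) t).
Proof.
have [fi fhi _] := hf; have [gi _ _] := hg.
exact: (cintegrable_fourierM (fi _) (fhi _) (gi _)).
Qed.

Let Ci M : cintegrable setT
  (fun t => cesaro_mean (fun k => f (zig k) t * g (n - zig k) t) M).
Proof.
apply: cintegrableZ => //; apply: cintegrable_sum => // N.
exact: cintegrable_sum.
Qed.

Let mh : cmeasurable setT h.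
Proof.
split.
  apply: (@measurable_fun_cvg _ _ _ setT (fun M t => complex.Re (cesaro_mean (fun k => f (zig k) t * g (n - zig k) t) M))).
    by move=> M; exact: (cintegrable_cmeasurable (Ci M)).1.
  by move=> t _; exact: (ccvg_ReIm (fgh t)).1.
apply: (@measurable_fun_cvg _ _ _ setT (fun M t => complex.Im (cesaro_mean (fun k => f (zig k) t * g (n - zig k) t) M))).
  by move=> M; exact: (cintegrable_cmeasurable (Ci M)).2.
by move=> t _; exact: (ccvg_ReIm (fgh t)).2.
Qed.

Let dom tau : cintegrable setT (fun t => expi (- (t * tau)) * h t) /\
  ccvg (fun M => fourier_transform
     (fun t => cesaro_mean (fun k => f (zig k) t * g (n - zig k) t) M) tau)
   (fourier_transform h tau).
Proof.
have mexp : cmeasurable setT (fun t : R => expi (- (t * tau))).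
  by apply: cmeasurable_expi; apply: measurableT_comp => //; exact: measurable_funM.
apply: (@dominated_ccvg _ setT (fun M t => expi (- (t * tau)) * cesaro_mean (fun k => f (zig k) t * g (n - zig k) t) M)
  (fun t => expi (- (t * tau)) * h t) (fine \o H)) => //.
- by move=> M; apply: cmeasurableM => //; exact: cintegrable_cmeasurable.
- exact: cmeasurableM.
- by apply: aeW => t _; exact: ccvgMl.
- apply: (ae_imply (integrable_ae measurableT Hi)) => t Ht M _.
  rewrite cmodM cmod_expi mul1r; apply: cmod_cesaro_mean => N.
  by apply: partial_le; exact: Ht.
Qed.

Lemma cintegrable_product : cintegrable setT h.
Proof.
have := (dom 0).1; congr (cintegrable _ _); apply/funext => t.
by rewrite mulr0 oppr0 expi0 mul1r.
Qed.

(** The transform of each Cesaro mean is bounded, term by term, by the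
    convolution; dominated convergence passes to the limit. *)
Lemma product_spectrum tau :
  ((cmod (fourier_transform h tau))%:E <=
   ((2 * pi)^-1)%:E * zconv (spectrum f) (spectrum g) n tau)%E.
Proof.
have [fi fhi _] := hf; have [gi _ _] := hg.
have p0 : 0 <= (2 * pi)^-1 :> R by rewrite invr_ge0 mulr_ge0// pi_ge0.
have c0 m : (0 <= \int[leb]_x (spectrum f m x * spectrum g (n - m) (tau - x))%:E)%E.
  by apply: integral_ge0 => x _; rewrite lee_fin mulr_ge0 ?cmod_ge0.
have ks N : ((\sum_(0 <= k < N) cmod (fourier_transform (fun t => f (zig k) t * g (n - zig k) t)%R tau))%:E <=
   ((2 * pi)^-1)%:E * zconv (spectrum f) (spectrum g) n tau)%E.
  rewrite /zconv -zsumZ// zsum_series; last first.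
    by move=> m; apply: mule_ge0 => //; rewrite lee_fin.
  rewrite -sumEFin.
  apply: (@le_trans _ _ (\sum_(0 <= k < N) (((2 * pi)^-1)%:E * \int[leb]_x
      (spectrum f (zig k) x * spectrum g (n - zig k) (tau - x))%:E)%E)%E).
    by apply: lee_sum => k _; exact: cmod_fourier_transformM.
  by apply: nneseries_lim_ge => k _ _; apply: mule_ge0 => //; rewrite lee_fin.
move: ks; case: (X in (_ <= X)%E) => [B|_|].
- move=> ks; rewrite lee_fin.
  apply: (ccvg_cmod_le (dom tau).2) => M.
  rewrite /cesaro_mean fourier_transformZ ?fourier_transform_sum//; last 2 first.
  + by move=> N; exact: cintegrable_sum.
  + by apply: cintegrable_sum => // N; exact: cintegrable_sum.
  under eq_bigr do rewrite fourier_transform_sum//.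
  apply: (cmod_cesaro_mean (z := fun k => fourier_transform (fun t => f (zig k) t * g (n - zig k) t) tau)) => N.
  by rewrite -lee_fin.
- by rewrite leey.
- by move=> /(_ 0%N); rewrite leeNy_eq.
Qed.

End fixed.
End ProductTransform.

(** * The function space and its norms *)

Section YSpace.
Context {R : realType}.
Local Notation leb := (@lebesgue_measure R).
Variable L : R.
Hypothesis L0 : 0 < L.
Implicit Types F G : R -> R -> R[i].

Definition modes F : int -> R -> R[i] := fun n t => fourier_coef L (F ^~ t) n.

Lemma Y_modes F n : Yspace L F -> cintegrable setT (modes F n).
Proof. by case=> _ _ _; exact. Qed.

Lemma Y_ccontinuous F t : Yspace L F -> ccontinuous (F ^~ t).
Proof. by case=> _ _ /(_ t) h _; exact: csmooth_ccontinuous. Qed.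

Let iwave f n : ccontinuous f -> cintegrable `[0, L] (fun x => wave L (- n) x * f x).
Proof.
move=> cf; apply: ccontinuous_cintegrable; apply: ccontinuousM => //.
exact: ccontinuous_wave.
Qed.

Lemma fourier_coefB (f g : R -> R[i]) n : ccontinuous f -> ccontinuous g ->
  fourier_coef L (fun x => f x - g x) n = fourier_coef L f n - fourier_coef L g n.
Proof.
move=> cf cg; rewrite !fourier_coefE -mulrBr -cintegralB//; try exact: iwave.
by congr (_ * _); apply: eq_cintegral => x _; rewrite mulrBr.
Qed.

Lemma fourier_coefJ (f : R -> R[i]) n : ccontinuous f ->
  fourier_coef L (fun x => conjc (f x)) n = conjc (fourier_coef L f (- n)).
Proof.
move=> cf; rewrite !fourier_coefE conjcM -cintegralJ//; last exact: iwave.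
rewrite (_ : conjc (real_complex R L^-1) = real_complex R L^-1).
  congr (_ * _); apply: eq_cintegral => x _.
  by rewrite conjcM wave_conj opprK.
by apply: cplxP => //=; rewrite oppr0.
Qed.

Lemma modesB F G n : Yspace L F -> Yspace L G ->
  modes (fun x t => F x t - G x t) n = (fun t => modes F n t - modes G n t).
Proof.
by move=> YF YG; apply/funext => t; apply: fourier_coefB; exact: Y_ccontinuous.
Qed.

Lemma modesJ F n : Yspace L F ->
  modes (fun x t => conjc (F x t)) n = (fun t => conjc (modes F (- n) t)).
Proof.
by move=> YF; apply/funext => t; apply: fourier_coefJ; exact: Y_ccontinuous.
Qed.

Lemma YspaceB F G : Yspace L F -> Yspace L G -> Yspace L (fun x t => F x t - G x t).
Proof.
move=> YF YG; have [F1 F2 F3 F4] := YF; have [G1 G2 G3 G4] := YG; split.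
- by move=> t x; rewrite F1 G1.
- by move=> x; exact: (complex_ringB (@schwartz_ring R) (F2 x) (G2 x)).
- by move=> t; exact: (complex_ringB (@smooth_ring R) (F3 t) (G3 t)).
- move=> n; have := modesB n YF YG; rewrite /modes => ->.
  have := cintegrableD measurableT (F4 n) (cintegrableN measurableT (G4 n)).
  by [].
Qed.

Lemma YspaceJ F : Yspace L F -> Yspace L (fun x t => conjc (F x t)).
Proof.
move=> YF; have [F1 F2 F3 F4] := YF; split.
- by move=> t x; rewrite F1.
- by move=> x; exact: (complex_ringJ (@schwartz_ring R) (F2 x)).
- by move=> t; exact: (complex_ringJ (@smooth_ring R) (F3 t)).
- move=> n; have := modesJ n YF; rewrite /modes => ->.
  exact: cintegrableJ.
Qed.

Lemma st_fourierB F G tau n : Yspace L F -> Yspace L G ->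
  st_fourier L (fun x t => F x t - G x t) tau n = st_fourier L F tau n - st_fourier L G tau n.
Proof.
move=> YF YG; rewrite -[LHS]/(fourier_transform (modes _ n) tau) modesB//.
by rewrite fourier_transformB//; exact: Y_modes.
Qed.

Lemma st_fourierJ F tau n : Yspace L F ->
  st_fourier L (fun x t => conjc (F x t)) tau n = conjc (st_fourier L F (- tau) (- n)).
Proof.
move=> YF; rewrite -[LHS]/(fourier_transform (modes _ n) tau) modesJ//.
by rewrite fourier_transformJ//; exact: Y_modes.
Qed.

Lemma modesM F G n t : Yspace L F -> Yspace L G ->
  ccvg (cesaro_mean (fun k => modes F (zig k) t * modes G (n - zig k) t))
       (modes (fun x t => F x t * G x t) n t).
Proof.
move=> YF YG; have [_ _ F3 _] := YF.
have [K HK] := csmooth_lipschitz L0 (F3 t).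
exact: (fourier_coefM L0 n (Y_ccontinuous t YF) (Y_ccontinuous t YG) HK).
Qed.

(** Smoothness and decay in each variable separately are algebraic; the
    integrability in time of the coefficients of the product comes from the
    domination of their convolution series. *)
Lemma YspaceM F G : Yspace L F -> Yspace L G ->
  finite_spectrum (modes F) -> finite_spectrum (modes G) ->
  Yspace L (fun x t => F x t * G x t).
Proof.
move=> YF YG fF fG; have [F1 F2 F3 F4] := YF; have [G1 G2 G3 G4] := YG; split.
- by move=> t x; rewrite F1 G1.
- by move=> x; exact: (complex_ringM (@schwartz_ring R) (F2 x) (G2 x)).
- by move=> t; exact: (complex_ringM (@smooth_ring R) (F3 t) (G3 t)).
- by move=> n; apply: (cintegrable_product fF fG (n := n)) => t; exact: modesM.
Qed.

Section weighted.
Variable w : R -> int -> R.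
Hypothesis w0 : nonneg_meas (fun m x => w x m).

Definition wspectrum F : int -> R -> R := fun m x => w x m * cmod (st_fourier L F x m).

Lemma nonneg_meas_spectrum F : Yspace L F -> nonneg_meas (spectrum (modes F)).
Proof.
move=> YF; split=> [m|m x]; last exact: cmod_ge0.
by apply: cmeasurable_cmod; apply: cmeasurable_fourier_transform; exact: Y_modes.
Qed.

Lemma nonneg_meas_wspectrum F : Yspace L F -> nonneg_meas (wspectrum F).
Proof. by move=> YF; apply: nonneg_measM => //; exact: nonneg_meas_spectrum. Qed.

Lemma wnormE F : wnorm L w F = (energy (wspectrum F) `^ 2^-1)%E.
Proof. by []. Qed.

Lemma wnorm_le F (A : R) : 0 <= A ->
  (wnorm L w F <= A%:E)%E <-> (energy (wspectrum F) <= (A ^+ 2)%:E)%E.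
Proof.
move=> A0; rewrite wnormE.
have := energy_ge0 (wspectrum F).
case: (energy (wspectrum F)) => [e|_|//]; last first.
  by rewrite poweRyr// ; split; rewrite leye_eq.
rewrite lee_fin => e0; rewrite poweR_EFin !lee_fin powR12_sqrt//.
rewrite -[in X in X <-> _](ger0_norm A0) -sqrtr_sqr.
by split=> [|h]; [rewrite ler_sqrt// sqr_ge0|rewrite ler_wsqrtr].
Qed.

Lemma wnorm_ge0 F : (0 <= wnorm L w F)%E.
Proof. exact: poweR_ge0. Qed.

Lemma wnorm_energy F : (wnorm L w F < +oo)%E -> (energy (wspectrum F) < +oo)%E.
Proof.
move=> h; have f : wnorm L w F \is a fin_num by rewrite ge0_fin_numE// wnorm_ge0.
have : (wnorm L w F <= (fine (wnorm L w F))%:E)%E by rewrite fineK.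
move=> /wnorm_le; rewrite fine_ge0 ?wnorm_ge0// => /(_ erefl) h'.
exact: le_lt_trans h' (ltry _).
Qed.

(** Each transform is the product of k, which is square integrable, and of a
    function bounded by the weighted transform. For the modulation weights the
    square integrability of k is the condition b > 1/2. *)
Lemma weighted_finite_spectrum (k : int -> R -> R) F : Yspace L F ->
  nonneg_meas k -> (forall m x, k m x <= 1) ->
  (forall m, (\int[leb]_x (k m x ^+ 2)%:E < +oo)%E) ->
  (forall m x, 1 <= k m x * w x m) -> (wnorm L w F < +oo)%E ->
  finite_spectrum (modes F).
Proof.
move=> YF [mk k0] k1 ik kw wF; have eF := wnorm_energy wF.
have [mw wsp0] := nonneg_meas_wspectrum YF.
have [ms s0] := nonneg_meas_spectrum YF.
have sw m x : spectrum (modes F) m x <= k m x * wspectrum F m x.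
  rewrite /wspectrum mulrA -[leLHS]mul1r ler_wpM2r//; exact: cmod_ge0.
have m2 (f : int -> R -> R) m : measurable_fun setT (f m) ->
    measurable_fun setT (fun x => (f m x ^+ 2)%:E).
  by move=> mf; apply/measurable_EFinP; exact: measurable_funX.
have ew m : (\int[leb]_x (wspectrum F m x ^+ 2)%:E < +oo)%E.
  apply: le_lt_trans eF; apply: (zsum_ge (f := fun m => \int[leb]_x (wspectrum F m x ^+ 2)%:E)%E) => j.
  by apply: integral_ge0 => x _; rewrite lee_fin sqr_ge0.
split; first by move=> m; exact: Y_modes.
  move=> m; apply/cintegrableP => //; split.
    by apply: cmeasurable_fourier_transform; exact: Y_modes.
  apply: (@le_lt_trans _ _ (\int[leb]_x ((k m x ^+ 2)%:E + (wspectrum F m x ^+ 2)%:E))%E).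
    apply: ge0_le_integral => //.
    - by move=> x _; rewrite lee_fin cmod_ge0.
    - by apply/measurable_EFinP; exact: ms.
    - by apply: emeasurable_funD; apply: m2.
    move=> x _; rewrite -EFinD lee_fin (le_trans (sw m x))//.
    have := sqr_ge0 (k m x - wspectrum F m x).
    have := k0 m x; have := wsp0 m x; nra.
  rewrite ge0_integralD//; last 4 first.
  - by move=> x _; rewrite lee_fin sqr_ge0.
  - exact: m2.
  - by move=> x _; rewrite lee_fin sqr_ge0.
  - exact: m2.
  exact: lte_add_pinfty.
apply: le_lt_trans eF; apply: le_esum => m _; apply: ge0_le_integral => //.
- by move=> x _; rewrite lee_fin sqr_ge0.
- exact: m2.
- exact: m2.
move=> x _; rewrite lee_fin ler_pXn2r ?nnegrE ?s0 ?wsp0//.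
by rewrite (le_trans (sw m x))// ler_piMl.
Qed.

(** Minkowski's inequality, from
    (f + g)^2 <= (1 + B / A) f^2 + (1 + A / B) g^2. *)
Lemma energy_triangle (f g h : int -> R -> R) (A B : R) :
  nonneg_meas f -> nonneg_meas g -> nonneg_meas h ->
  (forall m x, h m x <= f m x + g m x) -> 0 < A -> 0 < B ->
  (energy f <= (A ^+ 2)%:E)%E -> (energy g <= (B ^+ 2)%:E)%E ->
  (energy h <= ((A + B) ^+ 2)%:E)%E.
Proof.
move=> [mf f0] [mg g0] [mh h0] hfg A0 B0 fA gB.
pose a := 1 + B / A; pose c := 1 + A / B.
have a0 : 0 <= a by rewrite addr_ge0// divr_ge0 ?ltW.
have c0 : 0 <= c by rewrite addr_ge0// divr_ge0 ?ltW.
have m2 (p : R -> R) : measurable_fun setT p -> measurable_fun setT (fun x => (p x ^+ 2)%:E).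
  by move=> mp; apply/measurable_EFinP; exact: measurable_funX.
have s0 (p : R -> R) x : (0 <= (p x ^+ 2)%:E)%E by rewrite lee_fin sqr_ge0.
apply: (@le_trans _ _ (a%:E * energy f + c%:E * energy g)%E); last first.
  rewrite (_ : (A + B) ^+ 2 = a * A ^+ 2 + c * B ^+ 2).
    by rewrite [leRHS]EFinD; apply: leeD; rewrite [leRHS]EFinM; exact: lee_wpmul2l.
  by rewrite /a /c; field; rewrite !gt_eqF.
have i0 (p : R -> R) : (0 <= \int[leb]_x (p x ^+ 2)%:E)%E by exact: integral_ge0.
rewrite -!zsumZ// -zsumD; last 2 first.
- by move=> m; rewrite mule_ge0.
- by move=> m; rewrite mule_ge0.
apply: le_esum => m _.
rewrite -!ge0_integralZl_EFin//; [|exact: m2|exact: m2].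
rewrite -ge0_integralD//; last 4 first.
- by move=> x _; rewrite mule_ge0.
- by apply: measurable_funeM; exact: m2.
- by move=> x _; rewrite mule_ge0.
- by apply: measurable_funeM; exact: m2.
apply: ge0_le_integral => //.
- exact: m2.
- by apply: emeasurable_funD; apply: measurable_funeM; exact: m2.
move=> x _; rewrite -!EFinM -EFinD lee_fin.
have h1 : h m x ^+ 2 <= (f m x + g m x) ^+ 2.
  by rewrite ler_pXn2r ?nnegrE ?h0 ?addr_ge0.
rewrite (le_trans h1)// -subr_ge0.
rewrite (_ : _ - _ = (B * f m x - A * g m x) ^+ 2 / (A * B)).
  by rewrite divr_ge0 ?sqr_ge0// mulr_ge0 ?ltW.
by rewrite /a /c; field; rewrite !gt_eqF.
Qed.

Lemma wnorm_triangle F G : Yspace L F -> Yspace L G ->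
  (wnorm L w (fun x t => F x t - G x t)%R <= wnorm L w F + wnorm L w G)%E.
Proof.
move=> YF YG.
case EF : (wnorm L w F) (wnorm_ge0 F) => [A| |] // A0; last first.
  by rewrite addye ?leey// -ltNye (lt_le_trans _ (wnorm_ge0 G)).
case EG : (wnorm L w G) (wnorm_ge0 G) => [B| |] // B0; last by rewrite addey ?leey.
rewrite lee_fin in A0; rewrite lee_fin in B0.
apply/lee_addgt0Pr => e e0; rewrite -!EFinD.
have e2 : 0 < e / 2 by rewrite divr_gt0.
have A1 : 0 < A + e / 2 by rewrite ltr_wpDl.
have B1 : 0 < B + e / 2 by rewrite ltr_wpDl.
rewrite (_ : A + B + e = (A + e / 2) + (B + e / 2)); last by field.
apply/wnorm_le; first by rewrite addr_ge0 ?ltW.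
apply: (energy_triangle (nonneg_meas_wspectrum YF) (nonneg_meas_wspectrum YG)) => //.
- by apply: nonneg_meas_wspectrum; exact: YspaceB.
- move=> m x; rewrite /wspectrum -mulrDr ler_wpM2l ?w0.2// st_fourierB//.
  exact: cmodB.
- by apply: (@wnorm_le F _ (ltW A1)).1; rewrite EF lee_fin lerDl ltW.
- by apply: (@wnorm_le G _ (ltW B1)).1; rewrite EG lee_fin lerDl ltW.
Qed.

Lemma wnorm_subC F G : Yspace L F -> Yspace L G ->
  wnorm L w (fun x t => F x t - G x t) = wnorm L w (fun x t => G x t - F x t).
Proof.
move=> YF YG; rewrite !wnormE.
have -> : wspectrum (fun x t => F x t - G x t) = wspectrum (fun x t => G x t - F x t).
  apply/funext => m; apply/funext => x; rewrite /wspectrum.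
  have -> := st_fourierB x m YF YG.
  by rewrite cmodBC -(st_fourierB x m YG YF).
by [].
Qed.

Lemma wnorm_subrr F : Yspace L F -> wnorm L w (fun x t => F x t - F x t) = 0%E.
Proof.
move=> YF; rewrite wnormE /energy esum1 ?poweR0r ?invr_eq0//.
move=> m _; rewrite (_ : (fun _ => _) = cst 0%E) ?integral0//.
by apply/funext => x; rewrite /wspectrum (st_fourierB _ _ YF YF) subrr cmod0 mulr0 expr0n.
Qed.

End weighted.
End YSpace.

(** * The estimates for functions *)

Section Estimates.
Context {R : realType}.
Local Notation leb := (@lebesgue_measure R).
Variables (L s b : R).
Hypotheses (L0 : 0 < L) (s0 : 0 <= s) (b2 : 2^-1 < b).
Implicit Types F G : R -> R -> R[i].

Lemma measurable_bracket (r : R) (f : R -> R) : measurable_fun setT f ->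
  measurable_fun setT (fun x => japanese (f x) `^ r).
Proof.
move=> mf; apply: (measurableT_comp (f := fun z : R => z `^ r)); first exact: measurable_powR.
by apply: measurable_funD => //; apply: measurableT_comp.
Qed.

Lemma nonneg_meas_weightS (r : R) : nonneg_meas (fun m x => weightS L s r x m).
Proof.
split=> [m|m x]; last by rewrite mulr_ge0 ?powR_ge0.
by apply: measurable_funM => //; apply: measurable_bracket; exact: measurable_funD.
Qed.

Lemma nonneg_meas_weightB (r : R) : nonneg_meas (fun m x => weightB L s r x m).
Proof.
split=> [m|m x]; last by rewrite mulr_ge0 ?powR_ge0.
by apply: measurable_funM => //; apply: measurable_bracket; exact: measurable_funB.
Qed.

Lemma powR_bracketN_le1 (a x : R) : 0 <= a -> japanese x `^ (- a) <= 1.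
Proof.
move=> a0; rewrite powRN invf_le1; last by rewrite powR_gt0// japanese_gt0.
rewrite (_ : 1 = 1 `^ a); last by rewrite powR1.
by rewrite ge0_ler_powR ?nnegrE ?japanese_ge1// ltW// japanese_gt0.
Qed.

Lemma weightS_le (a x : R) m : 0 <= a -> weightS L s (- a) x m <= japanese m%:~R `^ s.
Proof. by move=> a0; rewrite ler_piMl ?powR_ge0// powR_bracketN_le1. Qed.

Lemma weightB_le (a x : R) m : 0 <= a -> weightB L s (- a) x m <= japanese m%:~R `^ s.
Proof. by move=> a0; rewrite ler_piMl ?powR_ge0// powR_bracketN_le1. Qed.

Let bracketK (x : R) : japanese x `^ (- b) * japanese x `^ b = 1.
Proof. by rewrite powRN mulVf// gt_eqF// powR_gt0// japanese_gt0. Qed.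

Lemma kerS_weightS m x : kerS L b m x * weightS L s b x m = japanese m%:~R `^ s.
Proof. by rewrite mulrA bracketK mul1r. Qed.

Lemma kerB_weightB m x : kerB L b m x * weightB L s b x m = japanese m%:~R `^ s.
Proof. by rewrite mulrA bracketK mul1r. Qed.

Lemma powR_bracket_ge1 (x : R) : 1 <= japanese x `^ s.
Proof.
rewrite (_ : 1 = 1 `^ s); last by rewrite powR1.
by rewrite ge0_ler_powR ?nnegrE ?japanese_ge1// ltW// japanese_gt0.
Qed.

(** The bracket is submultiplicative. *)
Lemma powR_bracketM (m n : int) :
  japanese n%:~R `^ s <= japanese m%:~R `^ s * japanese (n - m)%:~R `^ s :> R.
Proof.
have j0 (x : R) : 0 <= japanese x by rewrite ltW// japanese_gt0.
rewrite -powRM//; apply: ge0_ler_powR => //; rewrite ?nnegrE ?mulr_ge0//.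
by rewrite (le_trans _ (japaneseD_le _ _))// intrB addrC subrK.
Qed.

Lemma finite_spectrum_S F : Yspace L F -> (wnorm L (weightS L s b) F < +oo)%E ->
  finite_spectrum (modes L F).
Proof.
move=> YF; apply: (weighted_finite_spectrum (nonneg_meas_weightS b) (k := kerS L b)) => //.
- exact: nonneg_meas_kerS.
- exact: kerS_le1.
- exact: integral_kerS_sqr.
- by move=> m x; rewrite kerS_weightS powR_bracket_ge1.
Qed.

Lemma finite_spectrum_B F : Yspace L F -> (wnorm L (weightB L s b) F < +oo)%E ->
  finite_spectrum (modes L F).
Proof.
move=> YF; apply: (weighted_finite_spectrum (nonneg_meas_weightB b) (k := kerB L b)) => //.
- exact: nonneg_meas_kerB.
- exact: kerB_le1.
- exact: integral_kerB_sqr.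
- by move=> m x; rewrite kerB_weightB powR_bracket_ge1.
Qed.

(* The factor <n>^s is distributed over the two factors. *)
Let weighted_zconv F G n t : Yspace L F -> Yspace L G ->
  ((japanese n%:~R `^ s)%:E * zconv (spectrum (modes L F)) (spectrum (modes L G)) n t <=
   zconv (wS L b (wspectrum L (weightS L s b) F)) (wB L b (wspectrum L (weightB L s b) G)) n t)%E.
Proof.
move=> YF YG.
have [mf f0] := nonneg_meas_spectrum YF; have [mg g0] := nonneg_meas_spectrum YG.
have mker m : measurable_fun setT
    (fun x => spectrum (modes L F) m x * spectrum (modes L G) (n - m) (t - x)).
  apply: measurable_funM => //; apply: (measurableT_comp (mg (n - m))).
  exact: measurable_funB.
have k0 m x : 0 <= spectrum (modes L F) m x * spectrum (modes L G) (n - m) (t - x).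
  by rewrite mulr_ge0.
rewrite -zsumZ ?powR_ge0//; last first.
  by move=> m; apply: integral_ge0 => x _; rewrite lee_fin.
apply: le_esum => m _; rewrite -ge0_integralZl_EFin ?powR_ge0//; last 2 first.
- by move=> x _; rewrite lee_fin.
- by apply/measurable_EFinP; exact: mker.
have wfE x : wS L b (wspectrum L (weightS L s b) F) m x = japanese m%:~R `^ s * spectrum (modes L F) m x.
  by rewrite /wS /wspectrum mulrA kerS_weightS.
have wgE x : wB L b (wspectrum L (weightB L s b) G) (n - m) x =
    japanese (n - m)%:~R `^ s * spectrum (modes L G) (n - m) x.
  by rewrite /wB /wspectrum mulrA kerB_weightB.
apply: ge0_le_integral => //.
- by move=> x _; rewrite -EFinM lee_fin mulr_ge0 ?powR_ge0.
- by apply: measurable_funeM; apply/measurable_EFinP; exact: mker.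
- under eq_fun do rewrite wfE wgE mulrACA.
  by apply/measurable_EFinP; apply: measurable_funM => //; exact: mker.
- by move=> x _; rewrite wfE wgE -EFinM lee_fin mulrACA ler_wpM2r// powR_bracketM.
Qed.

(** The transform of the product is dominated by a convolution; once the factor
    <n>^s is distributed, this is a case of bilinear_zconv. *)
Lemma product_bound : exists2 K : R, 0 < K & forall F G (w : R -> int -> R) A B,
  Yspace L F -> Yspace L G -> nonneg_meas (fun m x => w x m) ->
  (forall x m, w x m <= japanese m%:~R `^ s) -> 0 < A -> 0 < B ->
  (wnorm L (weightS L s b) F <= A%:E)%E -> (wnorm L (weightB L s b) G <= B%:E)%E ->
  Yspace L (fun x t => F x t * G x t) /\
  (wnorm L w (fun x t => F x t * G x t)%R <= (K * A * B)%:E)%E.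
Proof.
have [K K0 HK] := bilinear_zconv L0 b2.
pose c : R := (2 * pi)^-1; have c0 : 0 <= c by rewrite invr_ge0 mulr_ge0// pi_ge0.
exists (1 + c ^+ 2 * K); first by rewrite ltr_pwDl// mulr_ge0 ?sqr_ge0 ?ltW.
move=> F G w A B YF YG hw wle A0 B0 FA GB.
have fF := finite_spectrum_S YF (le_lt_trans FA (ltry _)).
have fG := finite_spectrum_B YG (le_lt_trans GB (ltry _)).
have YFG := YspaceM L0 YF YG fF fG; split => //.
have K1 : 0 <= 1 + c ^+ 2 * K by rewrite addr_ge0// mulr_ge0 ?sqr_ge0 ?ltW.
apply: (wnorm_le _ _ _ _).2; first by rewrite mulr_ge0 ?(ltW B0)// mulr_ge0 ?(ltW A0).
set f := wspectrum L (weightS L s b) F; set g := wspectrum L (weightB L s b) G.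
have hf : nonneg_meas f by exact: (nonneg_meas_wspectrum (nonneg_meas_weightS b) YF).
have hg : nonneg_meas g by exact: (nonneg_meas_wspectrum (nonneg_meas_weightB b) YG).
have fA : (energy f <= (A ^+ 2)%:E)%E by apply: (wnorm_le _ _ _ _).1 => //; exact: ltW.
have gB : (energy g <= (B ^+ 2)%:E)%E by apply: (wnorm_le _ _ _ _).1 => //; exact: ltW.
have hwf : nonneg_meas (wS L b f) by apply: nonneg_measM => //; exact: nonneg_meas_kerS.
have hwg : nonneg_meas (wB L b g) by apply: nonneg_measM => //; exact: nonneg_meas_kerB.
pose Z n t := zconv (wS L b f) (wB L b g) n t.
have Z0 n t : (0 <= Z n t)%E by exact: zconv_ge0.
have mZ n : measurable_fun setT (Z n) by exact: measurable_zconv.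
have ptw n t : ((wspectrum L w (fun x t => F x t * G x t)%R n t)%:E <= c%:E * Z n t)%E.
  apply: (@le_trans _ _ ((japanese n%:~R `^ s)%:E *
      (c%:E * zconv (spectrum (modes L F)) (spectrum (modes L G)) n t))%E).
    rewrite /wspectrum EFinM lee_pmul ?lee_fin ?hw.2 ?cmod_ge0//.
    exact: (product_spectrum fF fG (fun t => modesM L0 n t YF YG) t).
  by rewrite muleCA lee_wpmul2l ?lee_fin//; exact: weighted_zconv.
have [mp p0] := nonneg_meas_wspectrum hw YFG.
apply: (@le_trans _ _ ((c ^+ 2)%:E * \esum_(n in [set: int]) \int[leb]_t (Z n t * Z n t))%E).
  rewrite -zsumZ ?sqr_ge0//; last by move=> n; apply: integral_ge0 => t _; exact: mule_ge0.
  apply: le_esum => n _; rewrite -ge0_integralZl_EFin ?sqr_ge0//; last 2 first.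
  - by move=> t _; exact: mule_ge0.
  - by apply: emeasurable_funM; exact: mZ.
  apply: ge0_le_integral => //.
  - by move=> t _; rewrite lee_fin sqr_ge0.
  - by apply/measurable_EFinP; apply: measurable_funX; exact: mp.
  - by apply: measurable_funeM; apply: emeasurable_funM; exact: mZ.
  move=> t _; have h := ptw n t; have h0 := p0 n t.
  rewrite -lee_fin in h0; have := lee_pmul h0 h0 h h.
  by rewrite muleACA -!EFinM -!expr2.
have A2 : 0 < A ^+ 2 by rewrite exprn_gt0.
apply: (@le_trans _ _ ((c ^+ 2)%:E * ((K * A ^+ 2)%:E * (B ^+ 2)%:E))%E).
  rewrite lee_wpmul2l ?lee_fin ?sqr_ge0// (le_trans (HK f g _ hf hg A2 fA))//.
  by rewrite lee_wpmul2l// lee_fin mulr_ge0 ?ltW.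
rewrite -!EFinM lee_fin.
rewrite (_ : c ^+ 2 * (K * A ^+ 2 * B ^+ 2) = (c ^+ 2 * K) * (A * B) ^+ 2); last by ring.
rewrite (_ : (_ * A * B) ^+ 2 = (1 + c ^+ 2 * K) ^+ 2 * (A * B) ^+ 2); last by ring.
rewrite ler_wpM2r ?sqr_ge0//.
have : 0 <= c ^+ 2 * K by rewrite mulr_ge0 ?sqr_ge0 ?ltW.
move: (c ^+ 2 * K) => x x0; nra.
Qed.

Let le_integral_reflect_sqr (f g : R -> R) (c : R) :
  measurable_fun setT f -> measurable_fun setT g -> 0 <= c ->
  (forall x, 0 <= f x) -> (forall x, f x <= c * g (- x)) ->
  (\int[leb]_x (f x ^+ 2)%:E <= (c ^+ 2)%:E * \int[leb]_x (g x ^+ 2)%:E)%E.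
Proof.
move=> mf mg c0 f0 fg.
have mg2 : measurable_fun setT (fun x => (g x ^+ 2)%:E).
  by apply/measurable_EFinP; exact: measurable_funX.
have mg2N : measurable_fun setT (fun x : R => (g (- x) ^+ 2)%:E).
  by apply: (measurableT_comp mg2); exact: measurable_funN.
rewrite -(ge0_integral_reflect mg2); last by move=> x; rewrite lee_fin sqr_ge0.
rewrite -ge0_integralZl_EFin ?sqr_ge0//; last first.
  by move=> x _; rewrite lee_fin sqr_ge0.
apply: ge0_le_integral => //.
- by move=> x _; rewrite lee_fin sqr_ge0.
- by apply/measurable_EFinP; exact: measurable_funX.
- exact: measurable_funeM.
move=> x _; rewrite -EFinM lee_fin -exprMn ler_pXn2r ?nnegrE//.
exact: le_trans (f0 x) (fg x).
Qed.

(** Conjugation reflects the transform, and turns the Schroedinger weight into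
    its mirror image; the Boussinesq weight, even in both variables, is
    dominated by a multiple of either. *)
Lemma conj_bound : exists2 K : R, 0 < K & forall F A, Yspace L F -> 0 < A ->
  (wnorm L (weightS L s b) F <= A%:E)%E ->
  (wnorm L (weightB L s b) (fun x t => conjc (F x t)) <= (K * A)%:E)%E.
Proof.
have b0 : 0 <= b by rewrite ltW// (lt_trans _ b2).
pose D : R := (1 + (2 * pi / L) ^+ 2) `^ b.
have D1 : 0 < 1 + (2 * pi / L) ^+ 2 by rewrite ltr_pwDl// sqr_ge0.
have D0 : 0 < D by rewrite powR_gt0.
exists D => // F A YF A0 FA.
apply: (wnorm_le _ _ _ _).2; first by rewrite mulr_ge0 ?ltW.
have eA : (energy (wspectrum L (weightS L s b) F) <= (A ^+ 2)%:E)%E.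
  by apply: (wnorm_le _ _ _ _).1 => //; exact: ltW.
have YJ := YspaceJ YF.
have [mj j0] := nonneg_meas_wspectrum (nonneg_meas_weightB b) YJ.
have [mf f0] := nonneg_meas_wspectrum (nonneg_meas_weightS b) YF.
have mf2 m : measurable_fun setT (fun x => (wspectrum L (weightS L s b) F m x ^+ 2)%:E).
  by apply/measurable_EFinP; exact: measurable_funX.
apply: (@le_trans _ _ ((D ^+ 2)%:E * energy (wspectrum L (weightS L s b) F))%E); last first.
  by rewrite exprMn [leRHS]EFinM lee_wpmul2l// lee_fin sqr_ge0.
rewrite {2}/energy -(zsum_opp (fun m => \int[leb]_x (wspectrum L (weightS L s b) F m x ^+ 2)%:E)%E).
rewrite -zsumZ ?sqr_ge0//; last first.
  by move=> m; apply: integral_ge0 => x _; rewrite lee_fin sqr_ge0.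
apply: le_esum => m _.
apply: (le_integral_reflect_sqr (mj m) (mf (- m)) (ltW D0) (j0 m)) => x.
rewrite /wspectrum st_fourierJ// cmodJ mulrA ler_wpM2r ?cmod_ge0//.
rewrite /weightB /weightS mulrNz japaneseN mulrA ler_wpM2r ?powR_ge0//.
have j1 (y : R) : 0 <= japanese y by rewrite ltW// japanese_gt0.
rewrite -powRM ?(ltW D1)//; apply: ge0_ler_powR; rewrite ?nnegrE ?mulr_ge0 ?(ltW D1)//.
have [_] := boussinesq_le L0 (- x) (- m).
by rewrite normrN gammaLN /symbol mulrNz.
Qed.

End Estimates.

(** * Extension to the completions *)

Section RealLimits.
Context {R : realType}.

Lemma cvge0P (u : nat -> \bar R) : (forall k, (0 <= u k)%E) ->
  u @ \oo --> 0%E <->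
  (forall e : R, 0 < e -> exists K, forall k, (K <= k)%N -> (u k < e%:E)%E).
Proof.
move=> u0; split=> [/fine_cvgP[[K1 _ fK] uc] e e0|h].
  move/cvgrPdist_lt : uc => /(_ e e0)[K2 _ HK].
  exists (maxn K1 K2) => k; rewrite geq_max => /andP[k1 k2].
  rewrite -[u k]fineK; last exact: fK.
  have := HK k k2; rewrite sub0r normrN lte_fin => /=; apply: le_lt_trans.
  exact: ler_norm.
apply/fine_cvgP; split.
  have [K HK] := h 1 ltr01; exists K => // k /= Kk.
  by rewrite ge0_fin_numE// (lt_trans (HK k Kk))// ltry.
apply/cvgrPdist_lt => e e0; have [K HK] := h e e0; exists K => // k /= Kk.
rewrite sub0r normrN ger0_norm ?fine_ge0// -lte_fin fineK ?HK//.
by rewrite ge0_fin_numE// (lt_trans (HK k Kk))// ltry.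
Qed.

Lemma le_mul_limit (x k U : R) : 0 <= k -> (forall A, U < A -> x <= k * A) -> x <= k * U.
Proof.
move=> k0 h; apply/ler_addgt0Pr => e e0.
have k1 : 0 < k + 1 by rewrite ltr_wpDl.
have d0 : 0 < e / (k + 1) by rewrite divr_gt0.
have := h (U + e / (k + 1)); rewrite ltrDl => /(_ d0) /le_trans; apply.
rewrite mulrDr lerD2l mulrCA ler_piMr ?(ltW e0)// ler_pdivrMr// mul1r lerDl.
exact: ler01.
Qed.

End RealLimits.

Section FiniteNorm.
Context {R : realType}.
Variables (L : R) (w : R -> int -> R).
Hypothesis w0 : nonneg_meas (fun m x => w x m).
Implicit Types F G : R -> R -> R[i].

Definition Yfinite F : Prop := Yspace L F /\ (wnorm L w F < +oo)%E.
Definition rnorm F : R := fine (wnorm L w F).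

Lemma rnormE F : Yfinite F -> wnorm L w F = (rnorm F)%:E.
Proof. by case=> _ h; rewrite fineK// ge0_fin_numE// wnorm_ge0. Qed.

Lemma rnorm_ge0 F : 0 <= rnorm F.
Proof. by rewrite fine_ge0// wnorm_ge0. Qed.

Lemma YfiniteB F G : Yfinite F -> Yfinite G -> Yfinite (fun x t => F x t - G x t).
Proof.
move=> hF hG; have [YF _] := hF; have [YG _] := hG; split; first exact: YspaceB.
rewrite (le_lt_trans (wnorm_triangle w0 YF YG))// (rnormE hF) (rnormE hG).
by rewrite -EFinD ltry.
Qed.

Lemma rnormB F G H : H = (fun x t => F x t - G x t) -> Yfinite F -> Yfinite G ->
  rnorm H <= rnorm F + rnorm G.
Proof.
move=> -> hF hG; have := wnorm_triangle w0 hF.1 hG.1.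
by rewrite (rnormE hF) (rnormE hG) (rnormE (YfiniteB hF hG)) -EFinD lee_fin.
Qed.

Lemma rnorm_subC F G : Yfinite F -> Yfinite G ->
  rnorm (fun x t => F x t - G x t) = rnorm (fun x t => G x t - F x t).
Proof. by move=> [YF _] [YG _]; rewrite /rnorm (wnorm_subC w YF YG). Qed.

Lemma rnorm_le F G : Yfinite F -> Yfinite G ->
  rnorm F <= rnorm G + rnorm (fun x t => F x t - G x t).
Proof.
move=> hF hG; rewrite (rnorm_subC hF hG).
apply: (rnormB _ hG (YfiniteB hG hF)).
by apply/funext => x; apply/funext => t; rewrite subKr.
Qed.

Lemma rnorm_dist F G : Yfinite F -> Yfinite G ->
  `|rnorm F - rnorm G| <= rnorm (fun x t => F x t - G x t).
Proof.
move=> hF hG; rewrite ler_norml lerBlDl (rnorm_le hF hG) andbT.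
by rewrite lerNl opprB lerBlDl (rnorm_subC hF hG) rnorm_le.
Qed.

Lemma rnorm_lt F e : Yfinite F -> (wnorm L w F < e%:E)%E = (rnorm F < e).
Proof. by move=> hF; rewrite rnormE// lte_fin. Qed.

Lemma cauchy_seq_cvg (F : nat -> R -> R -> R[i]) : cauchy_seq L w F ->
  exists l : R, rnorm (F k) @[k --> \oo] --> l.
Proof.
move=> [hF cF]; apply/cvg_ex; apply: cauchy_cvg; apply: cauchy_exP => e e0.
have [K HK] := cF e e0; exists (rnorm (F K)); exists K => // k /= Kk.
rewrite /ball/= (le_lt_trans (rnorm_dist (hF K) (hF k)))//.
by rewrite -rnorm_lt ?HK//; exact: YfiniteB.
Qed.

Lemma cauchy_seq_bounded (F : nat -> R -> R -> R[i]) : cauchy_seq L w F ->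
  exists2 M : R, 0 <= M & exists K, forall k, (K <= k)%N -> rnorm (F k) <= M.
Proof.
move=> [hF cF]; have [K HK] := cF 1 ltr01.
exists (rnorm (F K) + 1); first by rewrite addr_ge0 ?rnorm_ge0.
exists K => k Kk; rewrite (le_trans (rnorm_le (hF k) (hF K)))// lerD2l ltW//.
by rewrite -rnorm_lt ?HK//; exact: YfiniteB.
Qed.

Lemma cauchy_class_refl (F : nat -> R -> R -> R[i]) : cauchy_seq L w F ->
  cauchy_class L w F F.
Proof.
move=> cF; split => //; have [hF _] := cF.
rewrite (_ : (fun k => _) = cst 0%E); first exact: cvg_cst.
by apply/funext => k; rewrite (wnorm_subrr _ (hF k).1).
Qed.

Lemma rnorm_cvg0 (F : nat -> R -> R -> R[i]) :
  wnorm L w (F k) @[k --> \oo] --> 0%E -> rnorm (F k) @[k --> \oo] --> 0.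
Proof. by move=> /fine_cvgP[]. Qed.

Lemma representativeP (u : completion L w) :
  cauchy_seq L w (representative u) /\ reps u = cauchy_class L w (representative u).
Proof. by rewrite /representative; case: cid2. Qed.

Lemma cnormE (u : completion L w) (l : R) :
  rnorm (representative u k) @[k --> \oo] --> l -> cnorm u = l%:E.
Proof.
move=> ul; have [[hu _] _] := representativeP u.
apply/cvg_lim => //; rewrite (_ : (fun k => _) = (fun k => (rnorm (representative u k))%:E)).
  by apply: cvg_EFin => //; exact: nearW.
by apply/funext => k; exact: rnormE.
Qed.

End FiniteNorm.

(** Let A and B decrease to the norms, which may vanish. *)
Lemma bound_at_norms (R : realType) (L K : R) (w1 w2 w3 : R -> int -> R)
    (F G H : R -> R -> R[i]) : 0 <= K -> Yfinite L w1 F -> Yfinite L w2 G ->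
  (forall A B, 0 < A -> 0 < B ->
     (wnorm L w1 F <= A%:E)%E -> (wnorm L w2 G <= B%:E)%E ->
     Yspace L H /\ (wnorm L w3 H <= (K * A * B)%:E)%E) ->
  Yfinite L w3 H /\ rnorm L w3 H <= K * rnorm L w1 F * rnorm L w2 G.
Proof.
move=> K0 hF hG h.
have above w F' A : Yfinite L w F' -> rnorm L w F' < A -> 0 < A /\ (wnorm L w F' <= A%:E)%E.
  by move=> hF' FA; rewrite (le_lt_trans (rnorm_ge0 _ _ _) FA) (rnormE hF') lee_fin ltW.
have main A B : rnorm L w1 F < A -> rnorm L w2 G < B ->
    Yfinite L w3 H /\ rnorm L w3 H <= K * A * B.
  move=> /(above _ _ _ hF)[A0 FA] /(above _ _ _ hG)[B0 GB].
  have [YH wH] := h A B A0 B0 FA GB.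
  have fin : Yfinite L w3 H by split => //; rewrite (le_lt_trans wH)// ltry.
  by split => //; rewrite -lee_fin -(rnormE fin).
have l1 (w : R -> int -> R) F' : rnorm L w F' < rnorm L w F' + 1 by rewrite ltrDl.
split; first exact: (main _ _ (l1 _ _) (l1 _ _)).1.
apply: le_mul_limit => [|B GB]; first by rewrite mulr_ge0 ?rnorm_ge0.
have [B0 _] := above _ _ _ hG GB.
rewrite mulrAC; apply: le_mul_limit => [|A FA]; first by rewrite mulr_ge0// ltW.
by rewrite mulrAC; exact: (main _ _ FA GB).2.
Qed.

Opaque rnorm.

Section BilinearExtension.
Context {R : realType}.
Variables (L : R) (w1 w2 w3 : R -> int -> R).
Hypotheses (hw1 : nonneg_meas (fun m x => w1 x m)) (hw2 : nonneg_meas (fun m x => w2 x m))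
  (hw3 : nonneg_meas (fun m x => w3 x m)).
Variables (op : R[i] -> R[i] -> R[i]) (C : R).
Hypotheses (opBl : forall a a' z, op (a - a') z = op a z - op a' z)
  (opBr : forall a z z', op a (z - z') = op a z - op a z') (C0 : 0 <= C).
Implicit Types F G : R -> R -> R[i].

Let opf F G : R -> R -> R[i] := fun x t => op (F x t) (G x t).

Hypothesis op_bound : forall F G, Yfinite L w1 F -> Yfinite L w2 G ->
  Yfinite L w3 (opf F G) /\ rnorm L w3 (opf F G) <= C * rnorm L w1 F * rnorm L w2 G.

(* Uniform continuity of op on bounded sets, from
   op F G - op F' G' = op (F - F') G - op F' (G' - G). *)
Let op_close (M e : R) : 0 <= M -> 0 < e -> exists2 d : R, 0 < d &
  forall F F' G G', Yfinite L w1 F -> Yfinite L w1 F' -> Yfinite L w2 G -> Yfinite L w2 G' ->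
  rnorm L w1 F' <= M -> rnorm L w2 G <= M ->
  rnorm L w1 (fun x t => F x t - F' x t) < d ->
  rnorm L w2 (fun x t => G x t - G' x t) < d ->
  rnorm L w3 (fun x t => opf F G x t - opf F' G' x t) < e.
Proof.
move=> M0 e0; have CM1 : 0 < C * M * 2 + 1 by rewrite ltr_wpDl// !mulr_ge0.
exists (e / (C * M * 2 + 1)); first by rewrite divr_gt0.
set d := e / _; have d0 : 0 < d by rewrite divr_gt0.
move=> F F' G G' hF hF' hG hG' MF' MG dF dG.
have hFF' := YfiniteB hw1 hF hF'; have hGG' := YfiniteB hw2 hG' hG.
have [h1 b1] := op_bound hFF' hG; have [h2 b2] := op_bound hF' hGG'.
have E : (fun x t => opf F G x t - opf F' G' x t) =
    (fun x t => opf (fun x t => F x t - F' x t) G x t - opf F' (fun x t => G' x t - G x t) x t).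
  by apply/funext => x; apply/funext => t; rewrite /opf opBl opBr opprB addrA subrK.
apply: (le_lt_trans (rnormB hw3 E h1 h2)).
apply: (@le_lt_trans _ _ (C * d * M + C * M * d)).
  apply: lerD.
    apply: (le_trans b1); apply: ler_pM; [|exact: rnorm_ge0| |exact: MG].
      by apply: mulr_ge0 => //; exact: rnorm_ge0.
    by apply: ler_wpM2l; [exact: C0|exact: ltW dF].
  apply: (le_trans b2); apply: ler_pM; [|exact: rnorm_ge0| |].
  - by apply: mulr_ge0 => //; exact: rnorm_ge0.
  - by apply: ler_wpM2l; [exact: C0|exact: MF'].
  - by rewrite (rnorm_subC hG' hG); exact: ltW dG.
have -> : C * d * M + C * M * d = (C * M * 2) * d by ring.
by rewrite /d mulrA ltr_pdivrMr// mulrC ltr_pM2l// ltrDl.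
Qed.

Let op_cauchy (F G : nat -> R -> R -> R[i]) : cauchy_seq L w1 F -> cauchy_seq L w2 G ->
  cauchy_seq L w3 (fun k => opf (F k) (G k)).
Proof.
move=> cF cG; have [hF eF] := cF; have [hG eG] := cG.
have fin k : Yfinite L w3 (opf (F k) (G k)) by exact: (op_bound (hF k) (hG k)).1.
split; first exact: fin.
have [M1 M10 [K1 HK1]] := cauchy_seq_bounded hw1 cF.
have [M2 M20 [K2 HK2]] := cauchy_seq_bounded hw2 cG.
move=> e e0; have M120 : 0 <= M1 + M2 by rewrite addr_ge0.
have [d d0 Hd] := op_close M120 e0.
have [K3 HK3] := eF d d0; have [K4 HK4] := eG d d0.
exists (maxn (maxn K1 K2) (maxn K3 K4)) => j k; rewrite !geq_max.
move=> /andP[/andP[j1 j2] /andP[j3 j4]] /andP[/andP[k1 k2] /andP[k3 k4]].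
rewrite rnorm_lt; last exact: YfiniteB.
apply: Hd => //.
- by rewrite (le_trans (HK1 _ k1))// lerDl.
- by rewrite (le_trans (HK2 _ j2))// lerDr.
- by rewrite -rnorm_lt ?HK3//; exact: YfiniteB.
- by rewrite -rnorm_lt ?HK4//; exact: YfiniteB.
Qed.

Let op_equiv (F F' G G' : nat -> R -> R -> R[i]) :
  cauchy_seq L w1 F -> cauchy_class L w1 F F' ->
  cauchy_seq L w2 G -> cauchy_class L w2 G G' ->
  cauchy_class L w3 (fun k => opf (F k) (G k)) (fun k => opf (F' k) (G' k)).
Proof.
move=> cF [cF' FF'] cG [cG' GG']; split; first exact: op_cauchy.
have [hF _] := cF; have [hG _] := cG; have [hF' _] := cF'; have [hG' _] := cG'.
have fin k : Yfinite L w3 (opf (F k) (G k)) by exact: (op_bound (hF k) (hG k)).1.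
have fin' k : Yfinite L w3 (opf (F' k) (G' k)) by exact: (op_bound (hF' k) (hG' k)).1.
apply/cvge0P => [k|e e0]; first exact: wnorm_ge0.
have [M1 M10 [K1 HK1]] := cauchy_seq_bounded hw1 cF'.
have [M2 M20 [K2 HK2]] := cauchy_seq_bounded hw2 cG.
have M120 : 0 <= M1 + M2 by rewrite addr_ge0.
have [d d0 Hd] := op_close M120 e0.
have [K3 HK3] := (cvge0P (fun k => wnorm_ge0 _ _ _)).1 FF' d d0.
have [K4 HK4] := (cvge0P (fun k => wnorm_ge0 _ _ _)).1 GG' d d0.
exists (maxn (maxn K1 K2) (maxn K3 K4)) => k; rewrite !geq_max.
move=> /andP[/andP[k1 k2] /andP[k3 k4]].
rewrite rnorm_lt; last exact: YfiniteB.
apply: Hd => //.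
- by rewrite (le_trans (HK1 _ k1))// lerDl.
- by rewrite (le_trans (HK2 _ k2))// lerDr.
- by rewrite -rnorm_lt ?HK3//; exact: YfiniteB.
- by rewrite -rnorm_lt ?HK4//; exact: YfiniteB.
Qed.

(** A bounded biadditive operation on functions extends to the completions,
    with the same bound: a product of Cauchy sequences is a Cauchy sequence
    whose class depends only on the classes of the factors. *)
Lemma bilinear_extension (u : completion L w1) (v : completion L w2) :
  exists2 z : completion L w3, extends_to op u v z &
    (cnorm z <= C%:E * cnorm u * cnorm v)%E.
Proof.
have [cF uE] := representativeP u; have [cG vE] := representativeP v.
set F := representative u in cF uE; set G := representative v in cG vE.
pose H k := opf (F k) (G k); have cH : cauchy_seq L w3 H by exact: op_cauchy.
have zP : exists2 H', cauchy_seq L w3 H' & cauchy_class L w3 H = cauchy_class L w3 H'.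
  exact: (ex_intro2 _ _ H cH erefl).
exists (Completion zP).
  by move=> F' G'; rewrite uE vE => uF' vG'; exact: (op_equiv cF uF' cG vG').
set z := Completion zP; have [cZ zE] := representativeP z.
set Z := representative z in cZ zE.
have [_ ZH] : cauchy_class L w3 Z H by rewrite -zE; exact: cauchy_class_refl.
have [U FU] := cauchy_seq_cvg hw1 cF; have [V GV] := cauchy_seq_cvg hw2 cG.
have [W ZW] := cauchy_seq_cvg hw3 cZ.
rewrite (cnormE FU) (cnormE GV) (cnormE ZW) -!EFinM lee_fin.
have ZH0 := rnorm_cvg0 ZH.
have lim : C * rnorm L w1 (F k) * rnorm L w2 (G k) +
    rnorm L w3 (fun x t => Z k x t - H k x t) @[k --> \oo] --> C * U * V + 0.
  exact: (cvgD (cvgM (cvgM (cvg_cst C) FU) GV) ZH0).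
rewrite addr0 in lim.
apply: (ler_cvg_to ZW lim); apply: nearW => k.
have hZ := cZ.1 k; have hH := cH.1 k.
apply: (le_trans (rnorm_le hw3 hZ hH)); apply: lerD; last exact: lexx.
exact: (op_bound (cF.1 k) (cG.1 k)).2.
Qed.

End BilinearExtension.

Theorem theorem1p1 (R : realType) (L s a b : R) :
  0 < L -> 0 <= s -> 4^-1 < a -> a < 2^-1 -> 2^-1 < b ->
  exists2 c : R, 0 < c &
    (forall (u : XS L s b) (v : XB L s b),
       exists2 z : XS L s (- a),
         extends_to (fun p q => p * q) u v z &
         (cnorm z <= c%:E * cnorm u * cnorm v)%E) /\
    (forall u1 u2 : XS L s b,
       exists2 z : XB L s (- a),
         extends_to (fun p q => p * conjc q) u1 u2 z &
         (cnorm z <= c%:E * cnorm u1 * cnorm u2)%E).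
Proof.
move=> L0 s0 a4 _ b2.
have a0 : 0 <= a by rewrite ltW// (lt_trans _ a4)// invr_gt0.
have [K K0 HK] := product_bound L0 s0 b2; have [D D0 HD] := conj_bound s L0 b2.
have c0 : 0 <= K * (1 + D) by rewrite mulr_ge0 ?addr_ge0// ltW.
have hS r := nonneg_meas_weightS L s r; have hB r := nonneg_meas_weightB L s r.
exists (K * (1 + D)); first by rewrite mulr_gt0// ltr_pwDl// ltW.
split=> [u v|u1 u2].
  have Bl (p p' q : R[i]) : (p - p') * q = p * q - p' * q by exact: mulrBl.
  have Br (p q q' : R[i]) : p * (q - q') = p * q - p * q' by exact: mulrBr.
  apply: (bilinear_extension (hS b) (hB b) (hS (- a)) Bl Br c0) => F G hF hG.
  apply: (bound_at_norms c0 hF hG) => A B A0 B0 FA GB.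
  have [YFG wFG] := HK F G _ A B hF.1 hG.1 (hS (- a)) (fun x m => weightS_le L s x m a0) A0 B0 FA GB.
  split=> //; rewrite (le_trans wFG)// lee_fin ler_pM2r// ler_pM2r//.
  by rewrite ler_peMr ?(ltW K0)// lerDl ltW.
have Bl (p p' q : R[i]) : (p - p') * conjc q = p * conjc q - p' * conjc q by exact: mulrBl.
have Br (p q q' : R[i]) : p * conjc (q - q') = p * conjc q - p * conjc q'.
  by rewrite conjcB mulrBr.
apply: (bilinear_extension (hS b) (hS b) (hB (- a)) (op := fun p q => p * conjc q) Bl Br c0).
move=> F G hF hG; apply: (bound_at_norms c0 hF hG) => A B A0 B0 FA GB.
have [YFG wFG] := HK F (fun x t => conjc (G x t)) _ A (D * B) hF.1 (YspaceJ hG.1)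
  (hB (- a)) (fun x m => weightB_le L s x m a0) A0 (mulr_gt0 D0 B0) FA (HD G B hG.1 B0 GB).
split=> //; rewrite (le_trans wFG)// lee_fin.
rewrite mulrA ler_pM2r// mulrAC ler_pM2r// ler_pM2l// lerDr.
exact: ler01.
Qed.
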